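(* Let $\mathfrak{g}$ be a root-reductive Lie algebra for which $\mathfrak{sl}(V,V_* )$ is a direct summand of $[\mathfrak{g},\mathfrak{g}]$. The following statements hold for any maximal toral subalgebra $\mathfrak{t}\subseteq\mathfrak{g}$: (1) If $\langle V^\alpha,V_*^\beta\rangle\neq 0$, then $\beta=-\alpha$. If furthermore the rank of $\langle\cdot,\cdot\rangle|_{V'\times V_*'}$ is at least $2$, then $\dim V^\alpha=\dim V_*^{-\alpha}=1$. (2) If $\langle\cdot,\cdot\rangle|_{V^\alpha\times V_*^{-\alpha}}=0$, then $V^\alpha\otimes V_*^{-\alpha}\subseteq\mathfrak{z}(\mathfrak{z}_{\mathfrak{sl}(V,V_* )}(\mathfrak{t}))$. (3) If the rank of $\langle\cdot,\cdot\rangle|_{V'\times V_*'}$ is at least $2$, then $\langle\cdot,\cdot\rangle|_{V^0\times V_*^0}=0$. Hence $\langle\cdot,\cdot\rangle|_{V^0\times V_*^0}$ has rank $0$ or $1$. Also, $(V^0\otimes V_*^0)\cap\mathfrak{t}=0$. (4) $\mathfrak{z}_{\mathfrak{sl}(V,V_* )}(\mathfrak{t})$ is nilpotent of depth at most $2$. If $\mathfrak{g}=\mathfrak{sl}(V,V_* )$, a subalgebra $\mathfrak{t}\subseteq\mathfrak{g}$ is maximal toral if and only if (3'), (5), and (6) hold, where (3') $\langle\cdot,\cdot\rangle|_{V^0\times V_*^0}=0$, and $(V^0\otimes V_*^0)\cap\mathfrak{t}=0$; (5) $(\operatorname{supp}V)\setminus\{0\}=-(\operatorname{supp}V_* )\setminus\{0\}$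 and $\dim V^\alpha=\dim V_*^{-\alpha}=1$ for any $\alpha\in\operatorname{supp}V\setminus\{0\}$; (6) $\mathfrak{t}=\mathfrak{sl}(V,V_* )\cap\bigoplus_{0\neq\alpha\in\operatorname{supp}V}V^\alpha\otimes V_*^{-\alpha}$.
   Context: Everything is over $\mathbb{C}$. An inclusion of finite-dimensional reductive Lie algebras $\mathfrak{l}\subseteq\mathfrak{m}$ is a root inclusion if, for some Cartan subalgebra $\mathfrak{h}_{\mathfrak{m}}$ of $\mathfrak{m}$, $\mathfrak{l}\cap\mathfrak{h}_{\mathfrak{m}}$ is a Cartan subalgebra of $\mathfrak{l}$ and each $\mathfrak{l}\cap\mathfrak{h}_{\mathfrak{m}}$-root space of $\mathfrak{l}$ is also a root space of $\mathfrak{m}$. A Lie algebra is root-reductive if it is isomorphic to a union $\bigcup_{i\in\mathbb{Z}_{>0}}\mathfrak{g}_i$ of nested finite-dimensional reductive Lie algebras with respect to root inclusions for a fixed choice of nested Cartan subalgebras $\mathfrak{h}_i\subseteq\mathfrak{g}_i$ with $\mathfrak{h}_{i-1}=\mathfrak{h}_i\cap\mathfrak{g}_{i-1}$. An element of $\mathfrak{g}$ is semisimple if it is semisimple in some (equivalently every large enough) $\mathfrak{g}_i$ containing it, i.e. acts semisimply on $\mathfrak{g}_i$ by the adjoint action. A subalgebra is toral if all its elements are semisimple. $V,V_*$ are countably infinite-dimensional vector spaces with a nondegenerate pairing $\langle\cdot,\cdot\rangle:V\times V_*\to\mathbb{C}$. $V\otimes V_*$ is an associative algebra with $(v\otimes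 w)\cdot(v'\otimes w')=\langle v',w\rangle\,v\otimes w'$; with the commutator bracket it is the Lie algebra $\mathfrak{gl}(V,V_* )$, and $\mathfrak{sl}(V,V_* )$ is its derived subalgebra (the kernel of $v\otimes w\mapsto\langle v,w\rangle$). The natural actions are $(v\otimes w)\cdot u=\langle u,w\rangle v$ on $V$ and $(v\otimes w)\cdot u=-\langle v,u\rangle w$ on $V_*$. $V$ and $V_*$ are regarded as $[\mathfrak{g},\mathfrak{g}]$-modules on which $\mathfrak{sl}(V,V_* )$ acts naturally and all other direct summands of $[\mathfrak{g},\mathfrak{g}]$ act trivially, and they are endowed with $\mathfrak{g}$-module structures extending these, for which the pairing is $\mathfrak{g}$-invariant (for $\mathfrak{g}=\mathfrak{sl}(V,V_* )$ these are the natural modules). Intersections of $V^0\otimes V_*^0$ with $\mathfrak{t}$ are taken in $\mathfrak{sl}(V,V_* )\subseteq V\otimes V_*$, i.e. $(V^0\otimes V_*^0)\cap\mathfrak{t}$ means $\big((V^0\otimes V_*^0)\cap\mathfrak{sl}(V,V_* )\big)\cap\mathfrak{t}$. For a subalgebra $\mathfrak{t}\subseteq\mathfrak{g}$, a $\mathfrak{t}$-module $M$ and $\alpha\in\mathfrak{t}^*$, $M^\alpha:=\{m\in M:\exists\, i\in\mathbb{Z}_{>0}\text{ such that }(x-\alpha(x)1)^i\cdot m=0\ \forall x\in\mathfrak{t}\}$, $\operatorname{supp}M:=\{\alpha\in\mathfrak{t}^*:M^\alpha\neq 0\}$, and $M'$ is the maximal locally finite $\mathfrak{t}$-submodule of $M$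 (the sum of all finite-dimensional $\mathfrak{t}$-submodules). $\mathfrak{z}_{\mathfrak{k}}(\mathfrak{a})$ is the set of elements of $\mathfrak{k}$ commuting with all of $\mathfrak{a}$; $\mathfrak{z}(\mathfrak{k})$ is the center of $\mathfrak{k}$. ''Nilpotent of depth at most $2$'' means $[[\mathfrak{k},\mathfrak{k}],\mathfrak{k}]=0$. *)

(* Defs.v *)
From HB Require Import structures.
From mathcomp Require Export all_boot all_order all_algebra.
From mathcomp Require Export boolp classical_sets reals complex.

Set Implicit Arguments.
Unset Strict Implicit.
Unset Printing Implicit Defensive.

Import Order.TTheory GRing.Theory Num.Theory.
Local Open Scope ring_scope.
Local Open Scope classical_set_scope.

HB.mixin Record isLieAlgebra (K : fieldType) L of GRing.Lmodule K L := {
  lie : L -> L -> L;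
  lie_linearl : forall y, linear (lie^~ y);
  lie_linearr : forall x, linear (lie x);
  liexx : forall x, lie x x = 0;
  lie_jacobi : forall x y z,
    lie x (lie y z) + lie y (lie z x) + lie z (lie x y) = 0
}.

#[short(type="lieAlgType")]
HB.structure Definition LieAlgebra (K : fieldType) :=
  {L of GRing.Lmodule K L & isLieAlgebra K L}.

Definition subspace (K : fieldType) (V : lmodType K) (A : set V) : Prop :=
  A 0 /\ forall (a : K) u v, A u -> A v -> A (a *: u + v).

Definition lspan (K : fieldType) (V : lmodType K) (A : set V) : set V :=
  smallest (@subspace K V) A.

Definition findim (K : fieldType) (V : lmodType K) (A : set V) : Prop :=
  exists s : seq V, A = lspan [set` s].

Definition lfree (K : fieldType) (V : lmodType K) (I : eqType) (e : I -> V)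
    : Prop :=
  forall (s : seq I) (c : I -> K), uniq s ->
    \sum_(i <- s) c i *: e i = 0 -> forall i, i \in s -> c i = 0.

Definition lbasis (K : fieldType) (V : lmodType K) (I : eqType) (e : I -> V)
    (A : set V) : Prop :=
  lfree e /\ lspan (range e) = A.

Definition has_dim (K : fieldType) (V : lmodType K) (A : set V) (n : nat)
    : Prop :=
  exists e : 'I_n -> V, lbasis e A.

Definition countably_infinite_dim (K : fieldType) (V : lmodType K) : Prop :=
  exists e : nat -> V, lbasis e [set: V].

(* A linear functional on the subspace A is represented by its extension by 0
   outside A, so that equality of functions is equality in the dual of A. *)
Definition dual (K : fieldType) (V : lmodType K) (A : set V) : set (V -> K) :=
  [set f | (forall (a : K) u v, A u -> A v -> f (a *: u + v) = a * f u + f v)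
           /\ forall u, ~ A u -> f u = 0].

Definition lieprod (K : fieldType) (g : lieAlgType K) (A B : set g) : set g :=
  lspan [set z | exists x y, [/\ A x, B y & z = lie x y]].

Definition subalgebra (K : fieldType) (g : lieAlgType K) (A : set g) : Prop :=
  subspace A /\ forall x y, A x -> A y -> A (lie x y).

Definition lie_ideal (K : fieldType) (g : lieAlgType K) (A I : set g) : Prop :=
  [/\ subspace I, I `<=` A & forall x y, A x -> I y -> I (lie x y)].

Definition ideal_sum (K : fieldType) (g : lieAlgType K) (A I J : set g)
    : Prop :=
  [/\ lie_ideal A I, lie_ideal A J, I `&` J = [set 0] & lspan (I `|` J) = A].

Definition centralizer (K : fieldType) (g : lieAlgType K) (A B : set g)
    : set g :=
  [set x | A x /\ forall y, B y -> lie x y = 0].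

Definition lie_center (K : fieldType) (g : lieAlgType K) (A : set g) : set g :=
  centralizer A A.

Definition lie_nilpotent (K : fieldType) (g : lieAlgType K) (A : set g)
    : Prop :=
  exists n, iter n (lieprod A) A = [set 0].

(* Complete reducibility of the adjoint representation. *)
Definition reductive (K : fieldType) (g : lieAlgType K) (A : set g) : Prop :=
  forall I, lie_ideal A I -> exists J, ideal_sum A I J.

Definition cartan (K : fieldType) (g : lieAlgType K) (A h : set g) : Prop :=
  [/\ subalgebra h, h `<=` A, lie_nilpotent h &
      [set x | A x /\ forall y, h y -> h (lie x y)] = h].

Definition root_space (K : fieldType) (g : lieAlgType K) (A h : set g)
    : set (set g) :=
  [set S | S <> [set 0] /\
     exists a, [/\ dual h a, a <> (fun=> 0) &
       S = [set x | A x /\ forall y, h y -> lie y x = a y *: x]]].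

Definition root_inclusion (K : fieldType) (g : lieAlgType K) (l m hm : set g)
    : Prop :=
  [/\ l `<=` m, cartan m hm, cartan l (l `&` hm) &
      root_space l (l `&` hm) `<=` root_space m hm].

(* A root-reductive structure on g: g itself is the union of the chain gs, with
   nested Cartan subalgebras hs. *)
Definition root_exhaustion (K : fieldType) (g : lieAlgType K)
    (gs hs : nat -> set g) : Prop :=
  [/\ forall i, [/\ subalgebra (gs i), findim (gs i) & reductive (gs i)],
      forall i, cartan (gs i) (hs i),
      forall i, root_inclusion (gs i) (gs i.+1) (hs i.+1),
      forall i, hs i = hs i.+1 `&` gs i &
      \bigcup_i gs i = [set: g]].

(* Over an algebraically closed field, ad x acts semisimply on the
   finite-dimensional gs i exactly when gs i is spanned by eigenvectors. *)
Definition semisimple (K : fieldType) (g : lieAlgType K) (gs : nat -> set g)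
    : set g :=
  [set x | exists i, gs i x /\
     gs i `<=` lspan [set y | gs i y /\ exists c : K, lie x y = c *: y]].

Definition toral (K : fieldType) (g : lieAlgType K) (gs : nat -> set g)
    (t : set g) : Prop :=
  subalgebra t /\ t `<=` semisimple gs.

Definition maximal_toral (K : fieldType) (g : lieAlgType K)
    (gs : nat -> set g) (t : set g) : Prop :=
  toral gs t /\ forall t', toral gs t' -> t `<=` t' -> t' = t.

Definition lie_module (K : fieldType) (g : lieAlgType K) (M : lmodType K)
    (act : {bilinear g -> M -> M}) : Prop :=
  forall x y m, act (lie x y) m = act x (act y m) - act y (act x m).

Definition weight_space (K : fieldType) (g : lieAlgType K) (M : lmodType K)
    (act : g -> M -> M) (t : set g) (a : g -> K) : set M :=
  [set m | exists i : nat, (0 < i)%N /\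
     forall x, t x -> iter i (fun u => act x u - a x *: u) m = 0].

Definition supp (K : fieldType) (g : lieAlgType K) (M : lmodType K)
    (act : g -> M -> M) (t : set g) : set (g -> K) :=
  [set a | dual t a /\ weight_space act t a <> [set 0]].

Definition locally_finite_part (K : fieldType) (g : lieAlgType K)
    (M : lmodType K) (act : g -> M -> M) (t : set g) : set M :=
  lspan [set m | exists W : set M,
    [/\ W m, findim W & forall x u, t x -> W u -> W (act x u)]].

Definition nondegenerate (K : fieldType) (V W : lmodType K)
    (p : {bilinear V -> W -> K | *%R & *%R}) : Prop :=
  (forall v, (forall w, p v w = 0) -> v = 0) /\
  (forall w, (forall v, p v w = 0) -> w = 0).

Definition zero_on (K : fieldType) (V W : lmodType K)
    (p : {bilinear V -> W -> K | *%R & *%R}) (A : set V) (B : set W) : Prop :=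
  forall v w, A v -> B w -> p v w = 0.

(* n <= rank of p on A x B: some n vectors of A induce linearly independent
   functionals on B. *)
Definition rank_ge (K : fieldType) (V W : lmodType K)
    (p : {bilinear V -> W -> K | *%R & *%R}) (A : set V) (B : set W) (n : nat)
    : Prop :=
  exists v : 'I_n -> V, (forall i, A (v i)) /\
    forall c : 'I_n -> K,
      (forall w, B w -> p (\sum_(i < n) c i *: v i) w = 0) ->
      forall i, c i = 0.

Definition has_rank (K : fieldType) (V W : lmodType K)
    (p : {bilinear V -> W -> K | *%R & *%R}) (A : set V) (B : set W) (n : nat)
    : Prop :=
  rank_ge p A B n /\ ~ rank_ge p A B n.+1.

Definition tensor_product (K : fieldType) (V W T : lmodType K)
    (tens : {bilinear V -> W -> T}) : Prop :=
  forall (U : lmodType K) (f : {bilinear V -> W -> U}),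
    exists phi : {linear T -> U},
      (forall v w, phi (tens v w) = f v w) /\
      forall psi : {linear T -> U},
        (forall v w, psi (tens v w) = f v w) -> psi =1 phi.

Definition tensor_sub (K : fieldType) (V W T : lmodType K)
    (tens : {bilinear V -> W -> T}) (A : set V) (B : set W) : set T :=
  lspan [set z | exists v w, [/\ A v, B w & z = tens v w]].

(* gl is the tensor product of V and W via tens, with the commutator bracket of
   the associative product mul, which the universal property makes unique. *)
Definition is_gl (K : fieldType) (V W : lmodType K) (gl : lieAlgType K)
    (p : {bilinear V -> W -> K | *%R & *%R}) (tens : {bilinear V -> W -> gl})
    : Prop :=
  tensor_product tens /\
  exists mul : {bilinear gl -> gl -> gl},
    (forall v w v' w', mul (tens v w) (tens v' w') = p v' w *: tens v w') /\
    (forall x y, lie x y = mul x y - mul y x).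

(* sl(V, W), when gl is gl(V, W) *)
Definition sl_of (K : fieldType) (gl : lieAlgType K) : set gl :=
  lieprod [set: gl] [set: gl].
Arguments sl_of {K} gl.

(* The values of f outside A are irrelevant. *)
Definition lie_embedding_on (K : fieldType) (l g : lieAlgType K) (A : set l)
    (f : l -> g) : Prop :=
  [/\ forall (a : K) x y, A x -> A y -> f (a *: x + y) = a *: f x + f y,
      forall x y, A x -> A y -> f (lie x y) = lie (f x) (f y) &
      forall x y, A x -> A y -> f x = f y -> x = y].

(* iota identifies sl(V, W) with a direct summand of [g, g], of which J is the
   sum of the other direct summands. *)
Definition sl_summand (K : fieldType) (gl g : lieAlgType K) (iota : gl -> g)
    (J : set g) : Prop :=
  lie_embedding_on (sl_of gl) iota /\
  ideal_sum (lieprod [set: g] [set: g]) (iota @` sl_of gl) J.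

(* Since gl is spanned by pure tensors, the formulas for sums of pure tensors
   determine the natural actions of sl(V, W). *)
Definition natural_modules (K : fieldType) (V W : lmodType K)
    (gl g : lieAlgType K) (p : {bilinear V -> W -> K | *%R & *%R})
    (tens : {bilinear V -> W -> gl}) (iota : gl -> g) (J : set g)
    (actV : {bilinear g -> V -> V}) (actW : {bilinear g -> W -> W}) : Prop :=
  [/\ lie_module actV /\ lie_module actW,
      forall n (v : 'I_n -> V) (w : 'I_n -> W),
        sl_of gl (\sum_(i < n) tens (v i) (w i)) ->
        (forall u, actV (iota (\sum_(i < n) tens (v i) (w i))) u =
                   \sum_(i < n) p u (w i) *: v i) /\
        (forall u, actW (iota (\sum_(i < n) tens (v i) (w i))) u =
                   - \sum_(i < n) p (v i) u *: w i),
      forall x, J x -> (forall u, actV x u = 0) /\ (forall u, actW x u = 0) &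
      forall x v w, p (actV x v) w + p v (actW x w) = 0].

(* Main.v *)
(* Semisimplicity in the sense of the exhaustion amounts to diagonalizability of
   [ad x] on the whole of [g]: a Cartan subalgebra of a reductive algebra acts
   diagonalizably, so that for a root inclusion of [l] in [m] the central component of
   [x] in [l], which lies in the Cartan subalgebra of [m], is diagonalizable on [m],
   and its component in [[l, l]] is diagonalizable on [m] by complete reducibility.
   Hence [t] is maximal toral exactly when it consists of diagonalizable elements
   and contains every diagonalizable element commuting with it. Diagonalizability of
   [ad x] passes to [V] and [V*], because [sl] is spanned by eigenvectors of [ad x] and
   [V] is irreducible, and conversely for elements of [sl].

   An element of [sl] commuting with [t] is a sum of tensors [v (x) w] of weight
   vectors of opposite weights. If [p v w = p v' w' = 1] for two such tensors, with
   [p v w' = p v' w = 0], then [v (x) w - v' (x) w'] is diagonalizable and commutes with [t],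
   so it belongs to [t], and evaluating weights on it forces the weight spaces of
   [v] and [w] to be lines of nonzero weight. If [V'] and [V*'] pair with rank
   at least two, such a second tensor always exists and the commutant is abelian;
   otherwise products [c d e] in the commutant are [tr(d) c e = 0]. *)

From HB Require Import structures.
From mathcomp Require Import ring.
From mathcomp Require Import spectral.
Require Import Defs.

Set Implicit Arguments.
Unset Strict Implicit.
Unset Printing Implicit Defensive.

Import Order.TTheory GRing.Theory Num.Theory.
Local Open Scope ring_scope.
Local Open Scope classical_set_scope.

(** * Subspaces and generalized eigenspaces *)

Section Subspaces.
Variables (F : fieldType) (V : lmodType F).
Implicit Types (A B S : set V).

(** The definitions dictate the route. [semisimple] tests a single [gs i], [cartan] means nilpotent
    and self-normalizing, and [reductive] means that ideals have complements; the diagonal action of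
    Cartan subalgebras and Weyl's theorem are derived in exactly this language. Complements of
    ideals replace solvable radicals throughout, and complex conjugation enters through Cartan's
    criterion. Since [g] and [V] are infinite-dimensional, diagonalizability is a statement about
    spans of eigenvectors, used one vector at a time through annihilating polynomials. As [iota] is
    linear only on [sl_of gl], a tensor can be moved into [g] by itself only if it is isotropic. The
    passage from (3'), (5), (6) back to maximality meets its own obstacle: elements of [t] are not
    known to be diagonalizable, and the lines of weights [a] and [-a] must first be shown to pair
    nontrivially. They do, since otherwise every element of [t], a combination of tensors of such
    lines, would kill the line of weight [a], although [a] is not zero. *)

Lemma lspan_subspace A : subspace (lspan A).
Proof.
split=> [B [[B0 _] _] //|a u v Au Av B [sB AB]].
by apply: sB.2; [apply: Au | apply: Av].
Qed.

Lemma sub_lspan A : A `<=` lspan A.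
Proof. exact: sub_gen_smallest. Qed.

Lemma lspan_min A B : subspace B -> A `<=` B -> lspan A `<=` B.
Proof. exact: smallest_sub. Qed.

Lemma lspan_le A B : A `<=` B -> lspan A `<=` lspan B.
Proof. by move=> AB; apply: lspan_min (lspan_subspace _) _ => x /AB /sub_lspan. Qed.

Lemma subspace0 A : subspace A -> A 0. Proof. by case. Qed.

Lemma subspaceZ A a u : subspace A -> A u -> A (a *: u).
Proof. by move=> [A0 AP] Au; rewrite -[_ *: _]addr0; apply: AP. Qed.

Lemma subspaceD A u v : subspace A -> A u -> A v -> A (u + v).
Proof. by move=> [A0 AP] Au Av; rewrite -[u]scale1r; apply: AP. Qed.

Lemma subspaceN A u : subspace A -> A u -> A (- u).
Proof. by move=> sA Au; rewrite -scaleN1r; apply: subspaceZ. Qed.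

Lemma subspaceB A u v : subspace A -> A u -> A v -> A (u - v).
Proof. by move=> sA Au Av; apply: subspaceD => //; apply: subspaceN. Qed.

Lemma subspace_sum A (I : Type) (r : seq I) (P : pred I) (f : I -> V) :
  subspace A -> (forall i, P i -> A (f i)) -> A (\sum_(i <- r | P i) f i).
Proof.
move=> sA Af; elim/big_rec: _ => [|i x Pi Ax]; first exact: subspace0.
by apply: subspaceD => //; apply: Af.
Qed.

Lemma subspace_sum_seq A (I : eqType) (r : seq I) (f : I -> V) :
  subspace A -> (forall i, i \in r -> A (f i)) -> A (\sum_(i <- r) f i).
Proof. by move=> sA Af; rewrite big_seq; apply: subspace_sum. Qed.

Lemma subspaceT : subspace [set: V]. Proof. by split. Qed.

Lemma subspace_set0 : subspace [set 0 : V].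
Proof. by split=> [//|a u v -> ->]; rewrite scaler0 addr0. Qed.

Lemma subspaceI A B : subspace A -> subspace B -> subspace (A `&` B).
Proof.
move=> [A0 AP] [B0 BP]; split=> // a u v [Au Bu] [Av Bv].
by split; [apply: AP | apply: BP].
Qed.

Lemma lspan_sum A v : lspan A v ->
  exists s : seq (F * V), (forall c, c \in s -> A c.2) /\
    v = \sum_(c <- s) c.1 *: c.2.
Proof.
move: v; apply: lspan_min.
- split=> [|a u v [su [Au ->]] [sv [Av ->]]].
    by exists [::]; rewrite big_nil.
  exists ([seq (a * c.1, c.2) | c <- su] ++ sv); split.
    move=> c; rewrite mem_cat => /orP[/mapP[d /Au Ad ->]|/Av] //.
  rewrite big_cat big_map scaler_sumr; congr (_ + _).
  by apply: eq_bigr => c _; rewrite scalerA.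
- move=> u Au; exists [:: (1, u)]; rewrite big_seq1 scale1r; split=> // c.
  by rewrite inE => /eqP->.
Qed.

Lemma sum2_lspan A B v : subspace A -> subspace B ->
  lspan (A `|` B) v -> exists a b, [/\ A a, B b & v = a + b].
Proof.
move=> sA sB; move: v; apply: lspan_min.
- split=> [|k u v [a [b [Aa Bb ->]]] [c [d [Ac Bd ->]]]].
    by exists 0, 0; rewrite addr0; split=> //; apply: subspace0.
  exists (k *: a + c), (k *: b + d).
  by split; [apply: sA.2 | apply: sB.2 | rewrite scalerDr addrACA].
- move=> u [Au|Bu].
    by exists u, 0; rewrite addr0; split=> //; apply: subspace0.
  by exists 0, u; rewrite add0r; split=> //; apply: subspace0.
Qed.

End Subspaces.

(** * Polynomials in an operator and the primary decomposition *)

Section PolyAction.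
Variables (F : fieldType) (V : lmodType F) (f : {linear V -> V}).
Implicit Types (p q : {poly F}) (c : F) (u v : V).

(** This is [p(f) v]. Acting on vectors serves spaces of any dimension and needs no ring of
    endomorphisms. *)
Definition pact p v : V := \sum_(i < size p) p`_i *: iter i f v.

Lemma pact_widen n p v : (size p <= n)%N ->
  pact p v = \sum_(i < n) p`_i *: iter i f v.
Proof.
move=> le_pn; rewrite /pact -!(big_mkord xpredT (fun i => p`_i *: iter i f v)).
rewrite (big_cat_nat _ le_pn) //= [X in _ + X]big1_seq ?addr0 // => i.
by rewrite /= mem_index_iota => /andP[? _]; rewrite nth_default ?scale0r.
Qed.

Lemma pactD p q v : pact (p + q) v = pact p v + pact q v.
Proof.
rewrite (pact_widen (n := maxn (size p) (size q)) v (size_polyD p q)).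
rewrite (pact_widen (p := p) v (leq_maxl _ (size q))).
rewrite (pact_widen (p := q) v (leq_maxr (size p) _)) -big_split /=.
by apply: eq_bigr => i _; rewrite coefD scalerDl.
Qed.

Lemma pactZ c p v : pact (c *: p) v = c *: pact p v.
Proof.
rewrite (pact_widen v (size_scale_leq c p)) scaler_sumr.
by apply: eq_bigr => i _; rewrite coefZ scalerA.
Qed.

Lemma pactC c v : pact c%:P v = c *: v.
Proof.
by rewrite (pact_widen v (size_polyC_leq1 c)) big_ord1 coefC eqxx.
Qed.

Lemma pact0 v : pact 0 v = 0.
Proof. by rewrite -[0]polyC0 pactC scale0r. Qed.

Lemma pact1 v : pact 1 v = v. Proof. by rewrite pactC scale1r. Qed.

Lemma pact_iter_linear n : linear (iter n f).
Proof. by elim: n => //= n IHn a u v; rewrite /= IHn linearP. Qed.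

Lemma pact_linear p : linear (pact p).
Proof.
move=> a u v; rewrite /pact scaler_sumr -big_split /=; apply: eq_bigr => i _.
by rewrite (pact_iter_linear i) scalerDr !scalerA mulrC.
Qed.

HB.instance Definition _ p := GRing.isLinear.Build F V V *:%R (pact p) (pact_linear p).

Lemma pactXM p v : pact ('X * p) v = f (pact p v).
Proof.
have [->|p0] := eqVneq p 0; first by rewrite mulr0 pact0 linear0.
rewrite [in LHS]/pact mulrC size_mulX // big_ord_recl coefMX scale0r add0r /pact linear_sum.
by apply: eq_bigr => i _; rewrite coefMX /= linearZ.
Qed.

Lemma pactM p q v : pact (p * q) v = pact p (pact q v).
Proof.
elim/poly_ind: p => [|p c IHp]; first by rewrite mul0r !pact0.
rewrite mulrDl !pactD mul_polyC pactZ pactC ['X]lock mulrAC -lock [p * q * _]mulrC.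
by rewrite [p * 'X]mulrC !pactXM IHp.
Qed.

Lemma pact_comm p q v : pact p (pact q v) = pact q (pact p v).
Proof. by rewrite -!pactM mulrC. Qed.

Lemma pactX v : pact 'X v = f v.
Proof. by rewrite -['X]mulr1 pactXM pact1. Qed.

Lemma pactXsubC c v : pact ('X - c%:P) v = f v - c *: v.
Proof. by rewrite -polyCN pactD pactX pactC scaleNr. Qed.

Lemma pactXsubC_exp c k v :
  pact (('X - c%:P) ^+ k) v = iter k (fun u => f u - c *: u) v.
Proof. by elim: k => [|k IHk]; rewrite ?pact1 // exprS pactM IHk pactXsubC. Qed.

Lemma pact_dvd p q v : p %| q -> pact p v = 0 -> pact q v = 0.
Proof.
by move=> /Pdiv.Field.dvdpP[r ->] pv; rewrite pactM pv linear0.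
Qed.

Lemma pact_stable (S : set V) p v : subspace S -> (forall u, S u -> S (f u)) ->
  S v -> S (pact p v).
Proof.
move=> sS fS Sv; apply: subspace_sum => // i _; apply: subspaceZ => //.
by elim: {i}(i : nat) => //= i; apply: fS.
Qed.

Lemma pact_coprime p q v : coprimep p q -> pact p v = 0 -> pact q v = 0 -> v = 0.
Proof.
move=> /Pdiv.Field.Bezout_eq1_coprimepP[[a b] /= ab1] pv qv.
by rewrite -[v]pact1 -ab1 pactD !pactM pv qv !linear0 addr0.
Qed.

Lemma pact_eig p c v : f v = c *: v -> pact p v = p.[c] *: v.
Proof.
move=> fv; elim/poly_ind: p => [|p d IHp]; first by rewrite pact0 horner0 scale0r.
rewrite pactD pactC [p * 'X]mulrC pactXM IHp linearZ /= fv scalerA -scalerDl.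
by rewrite !hornerE mulrC.
Qed.

End PolyAction.

Section Crt.
Variable F : fieldType.
Implicit Types (s : seq F) (c : F).

(** One exponent serves all roots. With [m = 1] and distinct roots, annihilation by it expresses
    diagonalizability; in finite dimension over a closed field every operator is annihilated by some
    [ppow m s]. *)
Definition ppow m s : {poly F} := \prod_(c <- s) ('X - c%:P) ^+ m.

Lemma ppow_cons m c s : ppow m (c :: s) = ('X - c%:P) ^+ m * ppow m s.
Proof. exact: big_cons. Qed.

Lemma coprime_exp_ppow k m c s : c \notin s -> coprimep (('X - c%:P) ^+ k) (ppow m s).
Proof.
move=> cs; apply: coprimep_expl; elim: s cs => [|d s IHs].
  by rewrite /ppow big_nil coprimep1.
rewrite inE negb_or => /andP[cd cs]; rewrite ppow_cons coprimepMr IHs // andbT.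
by apply: coprimep_expr; rewrite coprimep_XsubC2 // subr_eq0 eq_sym.
Qed.

(** Chinese remainder theorem. A Bezout multiple of [ppow m s] is [1] modulo the new factor and [0]
    modulo the old ones, so it can carry the correction [phi a - q]. *)
Lemma ppow_crt m s (phi : F -> F) : uniq s ->
  exists q, forall c, c \in s -> ('X - c%:P) ^+ m %| q - (phi c)%:P.
Proof.
elim: s => [|a s IHs]; first by exists 0.
move=> /= /andP[as_ /IHs[q qP]].
have /Pdiv.Field.Bezout_eq1_coprimepP[[u w] /= uw1] := coprime_exp_ppow m m as_.
exists (q + ((phi a)%:P - q) * (w * ppow m s)) => c.
rewrite inE => /predU1P[->|cs].
  have -> : w * ppow m s = 1 - u * ('X - a%:P) ^+ m by rewrite -uw1 addrC addKr.
  set P := _ ^+ m; suff -> : q + ((phi a)%:P - q) * (1 - u * P) - (phi a)%:P =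
      (q - (phi a)%:P) * u * P by rewrite dvdp_mull.
  by ring.
rewrite addrAC dvdp_add ?qP // mulrA dvdp_mull //.
rewrite /ppow (big_rem c) //=.
by rewrite dvdp_mulr.
Qed.

End Crt.

Section Spectral.
Variables (F : fieldType) (V : lmodType F) (f : {linear V -> V}).
Implicit Types (c : F) (u v : V) (s : seq F) (S : set V).

Definition geig c k v := iter k (fun u => f u - c *: u) v = 0.

Lemma geigE c k v : geig c k v <-> pact f (('X - c%:P) ^+ k) v = 0.
Proof. by rewrite pactXsubC_exp. Qed.

Lemma geig_linear c k : subspace (geig c k).
Proof.
split=> [|a u v]; first by rewrite geigE linear0.
by rewrite !geigE linearP /= => -> ->; rewrite scaler0 addr0.
Qed.

Lemma geig_pact c k p v : geig c k v -> geig c k (pact f p v).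
Proof. by rewrite !geigE pact_comm => ->; rewrite linear0. Qed.

Lemma geig_le c k k' v : (k <= k')%N -> geig c k v -> geig c k' v.
Proof.
by move=> kk'; rewrite !geigE; apply: pact_dvd; rewrite dvdp_exp2l.
Qed.

Lemma geig1 c v : geig c 1 v <-> f v = c *: v.
Proof.
by rewrite /geig /=; split=> [/eqP|->]; rewrite ?subrr // subr_eq0 => /eqP.
Qed.

Lemma geig_ppow_notin c k m s v : c \notin s ->
  pact f (ppow m s) v = 0 -> geig c k v -> v = 0.
Proof.
by move=> cs sv /geigE cv; apply: (pact_coprime (coprime_exp_ppow k m cs) cv sv).
Qed.

(** Applying [(X - c)^m] to [v] leaves a generalized eigenvector for [c] killed by the factors of
    the other roots, which are coprime to every power of [X - c]. *)
Lemma geig_ppow_in c k m s v : uniq s -> c \in s ->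
  pact f (ppow m s) v = 0 -> geig c k v -> geig c m v.
Proof.
move=> us cs sv cv; apply/geigE.
apply: (@geig_ppow_notin c k m (rem c s)).
- by rewrite mem_rem_uniq // inE eqxx.
- by move: sv; rewrite /ppow (big_rem c) //= mulrC pactM.
- exact: geig_pact.
Qed.

(* [q] applied to an operator is [phi] applied to its semisimple part. *)
Lemma spec_calculus m s (phi : F -> F) : uniq s ->
  exists q, forall v c k, pact f (ppow m s) v = 0 -> geig c k v ->
    pact f q v = phi c *: v.
Proof.
move=> us; have [q qP] := ppow_crt m phi us; exists q => v c k sv cv.
have [cs|cs] := boolP (c \in s); last first.
  by rewrite (geig_ppow_notin cs sv cv) linear0 scaler0.
have /geigE cmv := geig_ppow_in us cs sv cv.
have := pact_dvd (qP _ cs) cmv.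
by rewrite -polyCN pactD pactC scaleNr => /eqP; rewrite subr_eq0 => /eqP.
Qed.

(** The projections [e c] are polynomials fixed before [v], so the components of [v] stay in every
    [f]-stable subspace that contains [v]. *)
Lemma geig_dec m s : uniq s -> exists e : F -> {poly F}, forall v,
  pact f (ppow m s) v = 0 ->
  v = \sum_(c <- s) pact f (e c) v /\ forall c, c \in s -> geig c m (pact f (e c) v).
Proof.
elim: s => [_|a s IHs /= /andP[as_ us]].
  by exists (fun=> 0) => v; rewrite /ppow big_nil pact1 => ->; rewrite big_nil.
have [e eP] := IHs us.
have /Pdiv.Field.Bezout_eq1_coprimepP[[u w] /= uw1] := coprime_exp_ppow m m as_.
exists (fun c => if c == a then w * ppow m s else e c * (u * ('X - a%:P) ^+ m)) => v.
rewrite ppow_cons => av.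
have [|v2 v2P] := eP (pact f (u * ('X - a%:P) ^+ m) v).
  by rewrite -pactM mulrCA [_ * (_ ^+ m)]mulrC pactM av linear0.
split.
  rewrite big_cons eqxx -{1}[v](pact1 f) -uw1 pactD addrC v2; congr (_ + _).
  rewrite !big_seq; apply: eq_bigr => c cs.
  by rewrite (negPf (memPn as_ c cs)) [in RHS]pactM.
move=> c; rewrite inE; case: eqP => [-> _|_ /= /v2P]; last by rewrite -pactM.
by apply/geigE; rewrite -pactM mulrCA pactM av linear0.
Qed.

Definition eigs S : set V := [set v | S v /\ exists c, f v = c *: v].

Definition diag_on S := S `<=` lspan (eigs S).

Lemma ppow_sub m s s' : uniq s -> uniq s' -> {subset s <= s'} ->
  ppow m s %| ppow m s'.
Proof.
move=> us us' ss'; rewrite /ppow [X in _ %| X](bigID (mem s)) /=.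
rewrite -[X in _ %| X * _]big_filter dvdp_mulr //.
suff -> : \prod_(i <- [seq i <- s' | i \in s]) ('X - i%:P) ^+ m = ppow m s by [].
apply: perm_big; apply: uniq_perm; rewrite ?filter_uniq // => c; rewrite mem_filter.
by case cs: (c \in s) => //=; rewrite ss'.
Qed.

(** In infinite dimension no single polynomial need annihilate [S], but each vector is a finite
    combination of eigenvectors and has its own squarefree annihilator. *)
Lemma diag_ann S v : diag_on S -> S v ->
  exists2 s, uniq s & pact f (ppow 1 s) v = 0.
Proof.
move=> dS /dS {dS}; move: v; apply: lspan_min.
- split=> [|a u v [s us su] [s' us' sv]].
    by exists [::]; rewrite ?linear0.
  exists (undup (s ++ s')); rewrite ?undup_uniq // linearP /=.
  rewrite (pact_dvd _ su) ?(pact_dvd _ sv) ?scaler0 ?addr0 //;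
    apply: ppow_sub => //; rewrite ?undup_uniq // => c cs;
    by rewrite mem_undup mem_cat cs ?orbT.
- move=> v [_ [c fv]]; exists [:: c] => //.
  by rewrite /ppow big_seq1 pactXsubC fv subrr.
Qed.

(** The eigencomponents of a vector of [T] are polynomials in [f] applied to it, hence lie in
    [T]. *)
Lemma diag_sub S T : diag_on S -> T `<=` S -> subspace T ->
  (forall v, T v -> T (f v)) -> diag_on T.
Proof.
move=> dS TS sT fT v Tv; have [s us sv] := diag_ann dS (TS _ Tv).
have [e eP] := geig_dec 1 us; have [ev eig] := eP _ sv; rewrite ev.
apply: subspace_sum_seq; first exact: lspan_subspace.
move=> c cs; apply: sub_lspan; split; first exact: pact_stable.
by exists c; apply/geig1; exact: eig.
Qed.

(** The squarefree annihilator of [v] leaves only exponent [1]. This turns [weight_space] into a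
    joint eigenspace and makes [f (f v) = 0] imply [f v = 0]. *)
Lemma diag_geig S v c k : diag_on S -> S v -> geig c k v -> f v = c *: v.
Proof.
move=> dS Sv cv; have [s us sv] := diag_ann dS Sv.
have [cs|cs] := boolP (c \in s); first exact/(geig1 c v).1/(geig_ppow_in us cs sv cv).
by rewrite (geig_ppow_notin cs sv cv) linear0 scaler0.
Qed.

Lemma diag_eig_dec S v : diag_on S -> S v -> subspace S -> (forall u, S u -> S (f u)) ->
  exists s (u : F -> V), [/\ uniq s, v = \sum_(c <- s) u c &
    forall c, c \in s -> S (u c) /\ f (u c) = c *: u c].
Proof.
move=> dS Sv sS fS; have [s us sv] := diag_ann dS Sv.
have [e eP] := geig_dec 1 us; have [ev eig] := eP _ sv.
exists s, (fun c => pact f (e c) v); split=> // c cs.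
by split; [exact: pact_stable | apply/geig1; exact: eig].
Qed.

End Spectral.

(** [f2] preserves the eigenspaces of [f1] and is diagonalizable on them by [diag_sub]. [f3] is a
    separate map because intended instances such as [ad (x + c *: y)] are not literally sums of
    maps. *)
Lemma diag_comb (F : fieldType) (V : lmodType F) (f1 f2 f3 : {linear V -> V}) a
    (S : set V) : subspace S -> (forall v, S v -> S (f1 v)) -> (forall v, S v -> S (f2 v)) ->
  (forall v, S v -> f3 v = f1 v + a *: f2 v) ->
  (forall v, S v -> f1 (f2 v) = f2 (f1 v)) ->
  diag_on f1 S -> diag_on f2 S -> diag_on f3 S.
Proof.
move=> sS f1S f2S f3E f12 d1 d2 v Sv; have [s [u [us -> uP]]] := diag_eig_dec d1 Sv sS f1S.
apply: subspace_sum_seq => [|c cs]; first exact: lspan_subspace.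
have [Suc fuc] := uP c cs; pose T := [set w | S w /\ f1 w = c *: w].
have sT : subspace T.
  split=> [|b w w' [Sw fw] [Sw' fw']].
    by split; [apply: subspace0 | rewrite linear0 scaler0].
  by split; [apply: sS.2 | rewrite linearP fw fw' scalerDr !scalerA mulrC].
have f2T w : T w -> T (f2 w).
  by move=> [Sw fw]; split; [apply: f2S | rewrite f12 // fw linearZ].
have TS : T `<=` S by move=> w [].
have Tuc : T (u c) by split.
have [s' [u' [_ -> u'P]]] := diag_eig_dec (diag_sub d2 TS sT f2T) Tuc sT f2T.
apply: subspace_sum_seq => [|d ds]; first exact: lspan_subspace.
have [[Sw fw] f2w] := u'P d ds; apply: sub_lspan; split=> //.
by exists (c + a * d); rewrite f3E // fw f2w scalerDl scalerA.
Qed.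

Section GeigMul.
Variables (F : fieldType) (U V W : lmodType F).
Variables (f1 : {linear U -> U}) (f2 : {linear V -> V}) (f3 : {linear W -> W}).
Variables (b : U -> V -> W) (A : set U) (B : set V).
Hypotheses (sA : subspace A) (sB : subspace B).
Hypotheses (fA : forall u, A u -> A (f1 u)) (fB : forall v, B v -> B (f2 v)).
Hypothesis b0l : forall v, B v -> b 0 v = 0.
Hypothesis b0r : forall u, A u -> b u 0 = 0.
Hypothesis bBl : forall c u v, A u -> B v -> b (f1 u - c *: u) v = b (f1 u) v - c *: b u v.
Hypothesis bBr : forall c u v, A u -> B v -> b u (f2 v - c *: v) = b u (f2 v) - c *: b u v.
Hypothesis bf : forall u v, A u -> B v -> f3 (b u v) = b (f1 u) v + b u (f2 v).

(** With [b] as product, [f3 - (a + c)] acts as [f1 - a] on the left factor plus [f2 - c] on the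
    right one, and each lowers one exponent. The identities are asked only on [A] and [B], since a
    representation is linear only on its subalgebra. *)
Lemma geig_mul a c i j u v : A u -> B v -> geig f1 a i u -> geig f2 c j v ->
  geig f3 (a + c) (i + j) (b u v).
Proof.
move: {2}(i + j)%N (leqnn (i + j)) => n; elim: n i j u v => [|n IHn] i j u v.
  by rewrite leqn0 addn_eq0 => /andP[/eqP-> /eqP->] _ Bv; rewrite /geig /= => -> _; exact: b0l.
case: i => [|i].
  by move=> _ _ Bv; rewrite {1}/geig /= => -> _; rewrite b0l //; apply: subspace0 (geig_linear _ _ _).
case: j => [|j].
  by move=> _ Au _ _; rewrite {1}/geig /= => ->; rewrite b0r //; apply: subspace0 (geig_linear _ _ _).
rewrite addSn ltnS => le_n Au Bv ui vj.
rewrite /geig iterSr -/(geig f3 (a + c) (i + j.+1) _).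
have -> : f3 (b u v) - (a + c) *: b u v = b (f1 u - a *: u) v + b u (f2 v - c *: v).
  by rewrite bf // bBl // bBr // scalerDl opprD addrACA.
apply: subspaceD; first exact: geig_linear.
  apply: (IHn i j.+1 _ v) => //.
  - by apply: subspaceB => //; [apply: fA | apply: subspaceZ].
  - by move: ui; rewrite /geig iterSr.
rewrite addnS -addSn; apply: (IHn i.+1 j u) => //; first by rewrite addSn -addnS.
- by apply: subspaceB => //; [apply: fB | apply: subspaceZ].
- by move: vj; rewrite /geig iterSr.
Qed.

End GeigMul.

(** * Finite-dimensional subspaces in coordinates *)

Section FiniteDim.
Variables (F : fieldType) (V : lmodType F).
Implicit Types (A S : set V).

(** A matrix of maximal rank with row space inside [S] exhausts [S]: a further vector of [S] would
    raise the rank. *)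
Lemma rV_subspace n (S : set 'rV[F]_n) : subspace S ->
  exists M : 'M[F]_n, forall v, S v <-> (v <= M)%MS.
Proof.
move=> sS; pose P r := `[< exists2 M : 'M[F]_n, \rank M = r &
  forall v : 'rV_n, (v <= M)%MS -> S v >].
have exP : exists r, P r.
  exists 0%N; apply/asboolP; exists 0 => [|v]; first exact: mxrank0.
  by rewrite submx0 => /eqP->; apply: subspace0.
have ubP r : P r -> (r <= n)%N by move=> /asboolP[M <- _]; apply: rank_leq_row.
case: (ex_maxnP exP ubP) => r /asboolP[M rM MS] rmax; exists M => v; split=> [Sv|/MS//].
have : P (\rank (M + v)%MS).
  apply/asboolP; exists (M + v)%MS => // w /sub_addsmxP[[a b] ->] /=.
  by apply: subspaceD => //; [apply: MS; rewrite submxMl |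
    rewrite [b]mx11_scalar mul_scalar_mx; apply: subspaceZ].
move=> /rmax; rewrite -rM => le_r.
have := mxrank_leqif_sup (addsmxSl M v).
by move=> /geq_leqif; rewrite le_r => /esym H; apply: submx_trans (addsmxSr M v) H.
Qed.

(** Coordinates by row vectors give a dimension for inductions and turn operators into matrices;
    [findim] offers only a spanning list. *)
Definition fdimn A n := exists phi : {linear 'rV[F]_n -> V},
  injective phi /\ A = range phi.
Definition fdim A := exists n, fdimn A n.

Lemma fdim_range n (phi : {linear 'rV[F]_n -> V}) : fdim (range phi).
Proof.
have [|M MP] := @rV_subspace n [set v | phi v = 0].
  by split=> [|a u v]; rewrite /= ?linear0 // linearP => -> ->; rewrite scaler0 addr0.
exists (\rank (M^C)%MS), (phi \o mulmxr (row_base M^C)%MS); split.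
  move=> u v /= /eqP; rewrite -subr_eq0 -linearB -mulmxBl => /eqP /MP uvM.
  apply/eqP; rewrite -subr_eq0 -(mulmx_free_eq0 _ (row_base_free M^C%MS)) -submx0.
  rewrite -(capmx_compl M) sub_capmx uvM /=.
  by apply: submx_trans (submxMl _ _) _; rewrite eq_row_base.
apply/seteqP; split=> _ [r _ <-] //=; last by eexists.
have : (r <= M + M^C)%MS by rewrite submx_full // addsmx_compl_full.
move=> /sub_addsmxP[[a b] /= ->]; rewrite linearD /=.
have -> : phi (a *m M) = 0 by apply/MP; apply: submxMl.
have /submxP[d ->] : (b *m M^C <= row_base M^C)%MS by rewrite eq_row_base submxMl.
by rewrite add0r; exists d.
Qed.

Lemma fdimn_subspace A n : fdimn A n -> subspace A.
Proof.
move=> [phi [_ ->]]; split=> [|a _ _ [u _ <-] [v _ <-]].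
  by exists 0; rewrite ?linear0.
by exists (a *: u + v); rewrite ?linearP.
Qed.

Lemma fdim_subspace A : fdim A -> subspace A.
Proof. by move=> [n /fdimn_subspace]. Qed.

Lemma findim_fdim A : findim A -> fdim A.
Proof.
move=> [s ->]; pose phi (r : 'rV[F]_(size s)) := \sum_(i < size s) r 0 i *: s`_i.
have phiL : linear phi.
  move=> a u v; rewrite /phi scaler_sumr -big_split /=; apply: eq_bigr => i _.
  by rewrite !mxE scalerDl scalerA.
pose L := GRing.isLinear.Build _ _ _ _ phi phiL.
pose phi' : {linear 'rV[F]_(size s) -> V} := HB.pack phi L.
have -> : lspan [set` s] = range phi'; last exact: fdim_range.
apply/seteqP; split.
  apply: lspan_min => [|x /= xs].
    split=> [|a _ _ [u _ <-] [v _ <-]]; first by exists 0; rewrite ?linear0.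
    by exists (a *: u + v); rewrite ?linearP.
  have ix : (index x s < size s)%N by rewrite index_mem.
  exists (delta_mx 0 (Ordinal ix)) => //=; rewrite /phi (bigD1 (Ordinal ix)) //=.
  rewrite big1 => [|i ni]; rewrite mxE ?eqxx ?scale1r ?addr0 ?nth_index //=.
  by rewrite (negPf ni) scale0r.
move=> _ [r _ <-]; apply: subspace_sum => [|i _]; first exact: lspan_subspace.
by apply: (subspaceZ _ (lspan_subspace _)); apply: sub_lspan; apply: mem_nth.
Qed.

Lemma fdimn_preim A n (phi : {linear 'rV[F]_n -> V}) S : subspace S ->
  A = range phi -> S `<=` A -> exists M : 'M[F]_n,
  (forall v, S (phi v) <-> (v <= M)%MS) /\ S = phi @` [set v | (v <= M)%MS].
Proof.
move=> sS -> SA; have [|M MP] := @rV_subspace n [set v | S (phi v)].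
  by split=> [|a u v] /=; rewrite ?linear0 ?linearP; [apply: subspace0 | apply: sS.2].
exists M; split=> //; apply/seteqP; split=> [v Sv|_ [v /MP Sv <-]//].
by have [r _ rv] := SA _ Sv; exists r => //; apply/MP; rewrite /= rv.
Qed.

Lemma fdim_sub A S : fdim A -> subspace S -> S `<=` A -> fdim S.
Proof.
move=> [n [phi [_ Aphi]]] sS SA; have [M [_ ->]] := fdimn_preim sS Aphi SA.
have -> : phi @` [set v | (v <= M)%MS] = range (phi \o mulmxr M); last exact: fdim_range.
apply/seteqP; split=> [_ [v /submxP[d ->] <-]|_ [v _ <-]]; first by exists d.
by exists (v *m M) => //=; apply: submxMl.
Qed.

Lemma fdimn_proper A S n : fdimn A n -> subspace S -> S `<=` A -> S <> A ->
  exists2 m, (m < n)%N & fdimn S m.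
Proof.
move=> [phi [injphi Aphi]] sS SA neSA; have [M [MP SM]] := fdimn_preim sS Aphi SA.
exists (\rank M); last first.
  exists (phi \o mulmxr (row_base M)); split.
    by move=> u v /= /injphi /(row_free_inj (row_base_free M)).
  rewrite SM; apply/seteqP; split=> [_ [v vM <-]|_ [v _ <-]].
    by have /submxP[d ->] : (v <= row_base M)%MS by rewrite eq_row_base //; exists d.
  by exists (v *m row_base M) => //=; rewrite -(eq_row_base M) submxMl.
rewrite ltn_neqAle rank_leq_row andbT; apply/negP => fullM; apply: neSA.
by rewrite SM Aphi; apply/seteqP; split=> _ [v _ <-]; exists v => //=; rewrite submx_full.
Qed.

Lemma fdim_max A (P : set V -> Prop) S0 : fdim A -> P S0 ->
  (forall S, P S -> subspace S /\ S `<=` A) ->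
  exists S, P S /\ forall T, P T -> S `<=` T -> T = S.
Proof.
move=> [n [phi [injphi Aphi]]] PS0 PA.
pose Q r := `[< exists2 M : 'M[F]_n, \rank M = r & P (phi @` [set v | (v <= M)%MS]) >].
have PM S : P S -> exists M : 'M[F]_n,
    (forall v, S (phi v) <-> (v <= M)%MS) /\ S = phi @` [set v | (v <= M)%MS].
  by move=> PS; have [sS SA] := PA _ PS; apply: fdimn_preim Aphi SA.
have exQ : exists r, Q r.
  have [M [_ MS]] := PM _ PS0; exists (\rank M); apply/asboolP; exists M => //.
  by rewrite -MS.
have ubQ r : Q r -> (r <= n)%N by move=> /asboolP[M <- _]; apply: rank_leq_row.
case: (ex_maxnP exQ ubQ) => r /asboolP[M rM MP] rmax.
exists (phi @` [set v | (v <= M)%MS]); split=> // T PT MT.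
have [N [NP TN]] := PM _ PT.
have MN : (M <= N)%MS.
  by apply/row_subP => i; apply/NP/MT; exists (row i M) => //; apply: row_sub.
have /rmax : Q (\rank N) by apply/asboolP; exists N => //; rewrite -TN.
rewrite -rM => le_r; have := mxrank_leqif_sup MN.
move=> /geq_leqif; rewrite le_r => /esym NM; rewrite TN.
apply/seteqP; split=> _ [v vN <-]; exists v => //=; last exact: submx_trans MN.
exact: submx_trans NM.
Qed.

End FiniteDim.

Section MatrixOf.
Variables (F : fieldType) (V : lmodType F) (n : nat) (phi : {linear 'rV[F]_n -> V}).
Variables (A : set V).
Hypotheses (Aphi : A = range phi) (injphi : injective phi).

(** The matrix acts on rows from the right. [xget] selects coordinates of the image, with default
    [0] when the image leaves the range of [phi]. *)
Definition mxof (f : V -> V) : 'M[F]_n :=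
  \matrix_i xget 0 [set r | phi r = f (phi (delta_mx 0 i))].

Lemma mxofP (f : {linear V -> V}) r : (forall v, A v -> A (f v)) ->
  phi (r *m mxof f) = f (phi r).
Proof.
move=> fA; rewrite [r in RHS]row_sum_delta mulmx_sum_row !linear_sum /=.
apply: eq_bigr => i _; rewrite !linearZ /=; congr (_ *: _); rewrite rowK.
have : A (f (phi (delta_mx 0 i))) by apply: fA; rewrite Aphi; exists (delta_mx 0 i).
by rewrite Aphi => -[s _ sE]; apply: (xgetPex 0 (P := [set r | phi r = f _])); exists s.
Qed.

Lemma mx_phi_inj (M N : 'M[F]_n) : (forall r, phi (r *m M) = phi (r *m N)) -> M = N.
Proof.
by move=> MN; apply/row_matrixP => i; rewrite !rowE; apply: injphi.
Qed.

End MatrixOf.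

Section ClosedField.
Variables (F : closedFieldType) (V : lmodType F).
Implicit Types (A : set V) (f : {linear V -> V}).

Lemma dvdp_ppow (p : {poly F}) : p != 0 -> exists m s, uniq s /\ p %| ppow m s.
Proof.
move=> p0; have [r ->] := closed_field_poly_normal p.
exists (size r), (undup r); split; first exact: undup_uniq.
rewrite dvdpZl ?lead_coef_eq0 //; elim: r => [|a r IHr] /=.
  by rewrite big_nil dvd1p.
have le_r : ppow (size r) (undup r) %| ppow (size r).+1 (undup r).
  rewrite /ppow; elim: (undup r) => [|b s IHs]; first by rewrite !big_nil.
  by rewrite !big_cons dvdp_mul // dvdp_exp2l.
rewrite big_cons; case: ifP => ar; last first.
  rewrite ppow_cons dvdp_mul //; last exact: dvdp_trans IHr le_r.
  by rewrite -{1}['X - _]expr1 dvdp_exp2l.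
have ua : a \in undup r by rewrite mem_undup.
rewrite /ppow [X in _ %| X](big_rem a) //= exprS -mulrA dvdp_mul //.
apply: (dvdp_trans IHr); rewrite /ppow [X in X %| _](big_rem a) //= dvdp_mul //.
elim: (rem a (undup r)) => [|b s IHs]; first by rewrite !big_nil.
by rewrite !big_cons dvdp_mul // dvdp_exp2l.
Qed.

Lemma fdim_ann f A : fdim A -> (forall v, A v -> A (f v)) ->
  exists m s, uniq s /\ forall v, A v -> pact f (ppow m s) v = 0.
Proof.
(* Dimension zero is separate because [horner_mx] requires a matrix of positive size. *)
move=> [[|n] [phi [injphi Aphi]]] fA.
  exists 0%N, [::]; split=> // v; rewrite Aphi => -[r _ <-].
  by rewrite [r]thinmx0 !linear0.
pose M := mxof phi f.
have MP q r : phi (r *m horner_mx M q) = pact f q (phi r).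
  elim/poly_ind: q r => [|q c IHq] r; first by rewrite rmorph0 mulmx0 linear0 pact0.
  rewrite rmorphD rmorphM /= horner_mx_X horner_mx_C mulmxDr linearD /= mulmxA.
  rewrite (mxofP Aphi) // IHq pactD [q * 'X]mulrC pactXM pactC; congr (_ + _).
  by rewrite mul_mx_scalar linearZ.
have [m [s [us sM]]] := dvdp_ppow (monic_neq0 (char_poly_monic M)).
exists m, s; split=> // v; rewrite Aphi => -[r _ <-]; apply: (pact_dvd sM).
by rewrite -MP Cayley_Hamilton mulmx0 linear0.
Qed.

Lemma geig_dec_fdim f A v : fdim A -> (forall v, A v -> A (f v)) -> A v ->
  exists m s (u : F -> V), [/\ uniq s, v = \sum_(c <- s) u c &
    forall c, c \in s -> A (u c) /\ geig f c m (u c)].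
Proof.
move=> fdA fA Av; have [m [s [us sA]]] := fdim_ann fdA fA.
have [e eP] := geig_dec f m us; have [ev eig] := eP _ (sA _ Av).
exists m, s, (fun c => pact f (e c) v); split=> // c cs; split; last exact: eig.
by apply: pact_stable => //; apply: fdim_subspace.
Qed.

Lemma geig_eig f A c k v : (forall u, A u -> A (f u)) -> subspace A -> A v -> v <> 0 ->
  geig f c k v -> exists u, [/\ A u, u <> 0 & f u = c *: u].
Proof.
move=> fA sA; elim: k v => [|k IHk] v Av v0; first by rewrite /geig.
rewrite /geig iterSr => vk; have [fv|fv] := pselect (f v - c *: v = 0).
  by exists v; split=> //; apply/eqP; rewrite -subr_eq0; apply/eqP.
by apply: IHk fv vk; apply: subspaceB; [|apply: fA|apply: subspaceZ].
Qed.

Lemma exists_eig f A v : fdim A -> (forall u, A u -> A (f u)) -> A v -> v <> 0 ->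
  exists u c, [/\ A u, u <> 0 & f u = c *: u].
Proof.
move=> fdA fA Av v0; have [m [s [u [us ev uP]]]] := geig_dec_fdim fdA fA Av.
have [[c cs uc0]|nex] := pselect (exists2 c, c \in s & u c <> 0).
  have [Auc gc] := uP c cs.
  by have [w [? ? ?]] := geig_eig fA (fdim_subspace fdA) Auc uc0 gc; exists w, c.
exfalso; apply: v0; rewrite ev big_seq big1 // => c cs.
by apply: contrapT => uc; apply: nex; exists c.
Qed.

(** Induction on the dimension: if some [f x] is not scalar on [A], its eigenspaces are proper,
    stable under the whole commuting family, and span [A]. *)
Lemma joint_eig (T : Type) (t : set T) (f : T -> {linear V -> V}) A : fdim A ->
  (forall x v, t x -> A v -> A (f x v)) ->
  (forall x, t x -> diag_on (f x) A) ->
  (forall x y v, t x -> t y -> A v -> f x (f y v) = f y (f x v)) ->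
  A `<=` lspan [set v | A v /\ forall x, t x -> exists c, f x v = c *: v].
Proof.
move=> [n]; elim/ltn_ind: n A => n IHn A dA fA dfA fC.
have sA := fdimn_subspace dA.
have [sc|] := pselect (forall x, t x -> exists c, forall v, A v -> f x v = c *: v).
  by move=> v Av; apply: sub_lspan; split=> // x /sc[c cP]; exists c; apply: cP.
move=> /existsNP[x /not_implyP[tx nsc]] v Av.
have fxA u : A u -> A (f x u) by apply: fA.
have [s [u [us -> uP]]] := diag_eig_dec (dfA _ tx) Av sA fxA.
apply: subspace_sum_seq; first exact: lspan_subspace.
move=> c cs; have [Auc fuc] := uP c cs.
pose B := [set w | A w /\ f x w = c *: w].
have sB : subspace B.
  split=> [|a w w' [Aw fw] [Aw' fw']].
    by split; [apply: subspace0 | rewrite linear0 scaler0].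
  by split; [apply: sA.2 | rewrite linearP fw fw' scalerDr !scalerA mulrC].
have BA : B `<=` A by move=> w [].
have [|m lt_mn dB] := fdimn_proper dA sB BA.
  by move=> BA'; apply: nsc; exists c => w; rewrite -BA' => -[].
have fB y w : t y -> B w -> B (f y w).
  by move=> ty [Aw fw]; split; [apply: fA | rewrite fC // fw linearZ].
have dfB y : t y -> diag_on (f y) B.
  by move=> ty; apply: diag_sub (dfA _ ty) BA sB _ => w; apply: fB.
have := IHn m lt_mn B dB fB dfB (fun y z w ty tz Bw => fC y z w ty tz (BA _ Bw)).
move=> /(_ (u c)) H; apply: (lspan_le _ (H _)); last by split.
by move=> w [[]].
Qed.

End ClosedField.

(** * Eigenvalues and traces of triangular matrices *)

Section TriangularTrace.
Variable F : numClosedFieldType.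

Lemma trig_mulmx_diag n (A B : 'M[F]_n) i : is_trig_mx A -> is_trig_mx B ->
  (A *m B) i i = A i i * B i i.
Proof.
move=> /is_trig_mxP tA /is_trig_mxP tB; rewrite mxE (bigD1 i) //= big1 ?addr0 // => j ji.
have [lt_ij|le_ji] := ltnP i j; first by rewrite tA ?mul0r.
by rewrite (tB j i) ?mulr0 // ltn_neqAle le_ji ji.
Qed.

Lemma trig_mulmx n (A B : 'M[F]_n) : is_trig_mx A -> is_trig_mx B -> is_trig_mx (A *m B).
Proof.
move=> /is_trig_mxP tA /is_trig_mxP tB; apply/is_trig_mxP => i j lt_ij.
rewrite mxE big1 // => k _; have [lt_ik|le_ki] := ltnP i k; first by rewrite tA ?mul0r.
by rewrite tB ?mulr0 // (leq_ltn_trans le_ki).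
Qed.

Lemma trig_horner n (U : 'M[F]_n.+1) q : is_trig_mx U ->
  is_trig_mx (horner_mx U q) /\ forall i, horner_mx U q i i = q.[U i i].
Proof.
move=> tU; elim/poly_ind: q => [|q c [tq qE]].
  by rewrite rmorph0; split=> [|i]; rewrite ?horner0 ?mxE //; apply: mx0_is_trig.
rewrite rmorphD rmorphM /= horner_mx_X horner_mx_C; split=> [|i].
  apply/is_trig_mxP => i j lt_ij; rewrite mxE (is_trig_mxP (trig_mulmx tq tU)) //.
  by rewrite mxE add0r -val_eqE /= ltn_eqF.
by rewrite mxE trig_mulmx_diag // qE mxE eqxx !hornerE.
Qed.

Lemma pact_mulmxr n (X : 'M[F]_n.+1) q (r : 'rV_n.+1) :
  pact (mulmxr X) q r = r *m horner_mx X q.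
Proof.
elim/poly_ind: q r => [|q c IHq] r; first by rewrite rmorph0 mulmx0 pact0.
rewrite rmorphD rmorphM /= horner_mx_X horner_mx_C mulmxDr mulmxA.
by rewrite pactD [q * 'X]mulrC pactXM pactC IHq mul_mx_scalar.
Qed.

(* After triangularization the trace is [\sum_i `|U i i| ^ 2]. *)
Lemma eigen0_of_trace n (X T : 'M[F]_n) q :
  (forall r : 'rV_n, r *m T = pact (mulmxr X) q r) ->
  (forall c (v : 'rV_n), v != 0 -> v *m X = c *: v -> q.[c] = c^*) ->
  \tr (X *m T) = 0 ->
  forall c (v : 'rV_n), v != 0 -> v *m X = c *: v -> c = 0.
Proof.
case: n X T => [|n] X T TE qc trXT c v v0 vX.
  by move: v0; rewrite [v]thinmx0 eqxx.
have {}TE : T = horner_mx X q.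
  by apply/row_matrixP => i; rewrite !rowE TE pact_mulmxr.
rewrite {}TE in trXT.
have [P Pu] := Schur X (ltn0Sn n).
have {}Pu : P \in unitmx by apply: unitarymx_unit.
have [U UE] : exists U, U = P *m X *m invmx P by exists (P *m X *m invmx P).
have -> : similar_trig P X = is_trig_mx U by rewrite UE -conjumx.
move=> tU.
have [tqU qU] := trig_horner q tU.
have eigU d : (exists2 w : 'rV_n.+1, w != 0 & w *m U = d *: w) <-> exists i, d = U i i.
  have -> : (exists2 w : 'rV_n.+1, w != 0 & w *m U = d *: w) <-> eigenvalue U d.
    by split=> [[w w0 wU]|/eigenvalueP[w wU w0]]; [apply/eigenvalueP; exists w | exists w].
  rewrite eigenvalue_root_char (char_poly_trig tU) rootE horner_prod.
  split=> [/prodf_eq0[i _]|[i ->]].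
    by rewrite hornerXsubC subr_eq0 => /eqP->; exists i.
  by apply/prodf_eq0; exists i => //; rewrite hornerXsubC subrr.
have qUE i : q.[U i i] = (U i i)^*.
  have [w w0 wU] : exists2 w : 'rV_n.+1, w != 0 & w *m U = U i i *: w by apply/eigU; exists i.
  apply: (qc _ (w *m P)).
    by apply: contraNneq w0 => wP0; rewrite -[w](mulmxK Pu) wP0 mul0mx.
  by rewrite scalemxAl -wU UE !mulmxA mulmxKV.
have : \sum_i U i i * (U i i)^* = 0.
  have XE : X = invmx P *m U *m P by rewrite UE -!mulmxA mulVmx // mulmx1 mulKmx.
  have hX : horner_mx X q = invmx P *m horner_mx U q *m P.
    by rewrite [in LHS]XE horner_mx_uconjC.
  rewrite -[RHS]trXT hX [in RHS]XE.
  rewrite -!mulmxA mulKVmx // mxtrace_mulC -!mulmxA mulmxV // mulmx1.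
  by apply: eq_bigr => i _; rewrite trig_mulmx_diag // qU qUE.
move=> /psumr_eq0P U0; have [|i ->] := (eigU c).1.
  exists (v *m invmx P).
    by apply: contraNneq v0 => wP0; rewrite -[v](mulmxKV Pu) wP0 mul0mx.
  by rewrite UE !mulmxA mulmxKV // vX scalemxAl.
apply/eqP; rewrite -mul_conjC_eq0 U0 // => j _; exact: mul_conjC_ge0.
Qed.

End TriangularTrace.

(** * Engel's theorem and Cartan's criterion *)

Section LieBasics.
Variables (K : fieldType) (g : lieAlgType K).

Lemma lie_bilinear : bilinear_for *:%R *:%R (@lie K g).
Proof. by split; [apply: lie_linearl | apply: lie_linearr]. Qed.

HB.instance Definition _ := bilinear_isBilinear.Build K g g g *:%R *:%R (@lie K g) lie_bilinear.

Implicit Types (x y z : g) (A B L I : set g).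

Definition ad x : g -> g := lie x.
HB.instance Definition _ x := GRing.isLinear.Build K g g *:%R (ad x) (lie_linearr x).

Lemma lieC x y : lie x y = - lie y x.
Proof.
apply/eqP; rewrite -addr_eq0; apply/eqP.
by have := liexx (x + y); rewrite linearDl !linearDr /= !liexx add0r addr0.
Qed.

Lemma lieJ x y z : lie x (lie y z) = lie (lie x y) z + lie y (lie x z).
Proof.
have := lie_jacobi x y z.
rewrite -[lie z (lie x y)]opprK -lieC -[lie z x]opprK -lieC linearNr => /eqP.
by rewrite subr_eq0 subr_eq addrC [in X in _ == X]addrC => /eqP ->; rewrite addrC.
Qed.

Lemma subalgebra_ad A x y : subalgebra A -> A x -> A y -> A (ad x y).
Proof. by move=> [_]; apply. Qed.

Lemma lieprod_mem A B x y : A x -> B y -> lieprod A B (lie x y).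
Proof. by move=> Ax By; apply: sub_lspan; exists x, y. Qed.

Lemma lieprod_sub A B I : subspace I -> (forall x y, A x -> B y -> I (lie x y)) ->
  lieprod A B `<=` I.
Proof. by move=> sI ABI; apply: lspan_min => // _ [x [y [Ax By ->]]]; apply: ABI. Qed.

Lemma ideal_subspace L I : lie_ideal L I -> subspace I. Proof. by case. Qed.

Lemma ideal_sub L I : lie_ideal L I -> I `<=` L. Proof. by case. Qed.

Lemma ideal_subalgebra L I : lie_ideal L I -> subalgebra I.
Proof. by case=> sI IL LI; split=> // x y Ix Iy; apply: LI => //; apply: IL. Qed.

Lemma idealT L : subalgebra L -> lie_ideal L L.
Proof. by move=> [sL LL]; split. Qed.

Lemma lieprod_ideal L I J : subalgebra L -> lie_ideal L I -> lie_ideal L J ->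
  lie_ideal L (lieprod I J).
Proof.
move=> [sL LL] [sI IL LI] [sJ JL LJ]; split; first exact: lspan_subspace.
  by apply: lieprod_sub => // x y Ix Jy; apply: LL; [apply: IL | apply: JL].
move=> x y Lx; move: y; apply: (@lspan_min _ _ _ [set y | lieprod I J (lie x y)]).
  split=> [|a u v]; rewrite /= ?linear0r ?linearPr; first exact: subspace0 (lspan_subspace _).
  exact: (lspan_subspace _).2.
move=> _ [u [v [Iu Jv ->]]] /=; rewrite lieJ.
by apply: (subspaceD (lspan_subspace _)); apply: lieprod_mem => //; [apply: LI | apply: LJ].
Qed.

Lemma center_ideal L : subalgebra L -> lie_ideal L (lie_center L).
Proof.
move=> [sL LL]; split.
- split=> [|a u v [Lu uL] [Lv vL]].
    by split=> [|y _]; [apply: subspace0 | rewrite linear0l].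
  split; first exact: sL.2.
  by move=> y Ly; rewrite linearPl /= uL // vL // scaler0 addr0.
- by move=> x [].
- move=> x y Lx [Ly yL]; split; first exact: LL.
  by move=> z Lz; rewrite [lie x y]lieC yL // oppr0 linear0l.
Qed.

Lemma ideal_sum_disj L I J x y : ideal_sum L I J -> I x -> J y -> lie x y = 0.
Proof.
move=> [[sI IL LI] [sJ JL LJ] IJ0 _] Ix Jy.
suff : (I `&` J) (lie x y) by rewrite IJ0.
split; last by apply: LJ => //; apply: IL.
by rewrite lieC; apply: subspaceN => //; apply: LI => //; apply: JL.
Qed.

Lemma ideal_sum_dec L I J x : ideal_sum L I J -> L x ->
  exists y z, [/\ I y, J z & x = y + z].
Proof. by move=> [[sI _ _] [sJ _ _] _ <-]; apply: sum2_lspan. Qed.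

End LieBasics.

Section Engel.
Variable F : fieldType.

(* Relative form of Engel's theorem; [B] plays the role of zero, so that no
   quotient module is needed. *)
Theorem engel (g : lieAlgType F) (K : set g) : fdim K -> subalgebra K ->
  (forall x y, K x -> K y -> exists k, iter k (ad x) y = 0) ->
  forall (V : lmodType F) (act : g -> {linear V -> V}) (M B : set V) v0,
  subspace M -> subspace B -> 
  (forall a x y v, K x -> K y -> M v -> act (a *: x + y) v = a *: act x v + act y v) ->
  (forall x y v, K x -> K y -> M v ->
     act (lie x y) v = act x (act y v) - act y (act x v)) ->
  (forall x v, K x -> M v -> M (act x v)) ->
  (forall x v, K x -> B v -> B (act x v)) ->
  (forall x v, K x -> M v -> exists k, B (iter k (act x) v)) ->
  M v0 -> ~ B v0 -> exists v, [/\ M v, ~ B v & forall x, K x -> B (act x v)].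
Proof.
move=> [n]; elim/ltn_ind: n g K => n IHn g K dK aK nilK V act M B v0 sM sB
  actP actL actM actB actN Mv0 Bv0.
have sK := fdimn_subspace dK.
have [K0|] := pselect (forall x, K x -> x = 0).
  exists v0; split=> // x /K0 ->; have K00 := subspace0 sK.
  have := actP (-1) 0 0 v0 K00 K00 Mv0; rewrite scaler0 addr0 scaleN1r addNr => ->.
  exact: subspace0.
move=> /existsNP[x0 /not_implyP[Kx0 x00]].
pose P (S : set g) := [/\ subalgebra S, S `<=` K & S <> K].
have [||S [[aS SK neSK] maxS]] := @fdim_max _ _ K P [set 0] (ex_intro _ _ dK).
- split; first split; first exact: subspace_set0.
  + by move=> x y -> ->; rewrite linear0l.
  + by move=> x ->; apply: subspace0.
  + by move=> K0; apply: x00; move: Kx0; rewrite -K0.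
- by move=> S [[]].
have sS := aS.1; have [m lt_mn dS] := fdimn_proper dK sS SK neSK.
have nilS x y : S x -> S y -> exists k, iter k (ad x) y = 0.
  by move=> /SK Kx /SK; apply: nilK.
(* The induction hypothesis for the maximal proper subalgebra [S], acting on [K] modulo [S], gives
   [y] outside [S] normalizing [S]. Then [S + F y] is a larger subalgebra, hence equal to [K]. *)
have [y [Ky nSy SyS]] : exists y, [/\ K y, ~ S y & forall x, S x -> S (lie x y)].
  have [y0 Ky0 nSy0] : exists2 y, K y & ~ S y.
    apply: contrapT => nex; apply: neSK; apply/seteqP; split=> // y Ky.
    by apply: contrapT => nSy; apply: nex; exists y.
  apply: (IHn m lt_mn g S dS aS nilS g (fun x => ad x) K S y0) => //.
  - by move=> a x y v _ _ _; rewrite /= /ad linearPl.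
  - by move=> x y v _ _ _; rewrite /= /ad [in RHS]lieJ addrK.
  - by move=> x v /SK; apply: aK.2.
  - by move=> x v; apply: aS.2.
  - by move=> x v /SK Kx Kv; have [k k0] := nilK x v Kx Kv; exists k; rewrite k0; apply: subspace0.
pose T : set g := [set z | exists s c, S s /\ z = s + c *: y].
have sT : subspace T.
  split=> [|a _ _ [s [c [Ss ->]]] [s' [c' [Ss' ->]]]].
    by exists 0, 0; rewrite scale0r addr0; split=> //; apply: subspace0.
  exists (a *: s + s'), (a * c + c'); split; first exact: sS.2.
  by rewrite scalerDr scalerA scalerDl addrACA.
have ST : S `<=` T by move=> s Ss; exists s, 0; rewrite scale0r addr0.
have TK : T = K.
  apply: contrapT => neTK; have := maxS T.
  have /[swap] /[apply] /(_ ST) : P T.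
    split=> //; last first.
      move=> _ [s [c [Ss ->]]].
      by apply: subspaceD => //; [apply: SK | apply: subspaceZ].
    split=> // _ _ [s [c [Ss ->]]] [s' [c' [Ss' ->]]].
    apply: ST; rewrite linearDl /= !linearDr /= !linearZl_LR /= !linearZr_LR /= liexx !scaler0 addr0.
    rewrite [lie y s']lieC scalerN.
    apply: (subspaceB sS); last by apply: (subspaceZ _ sS); apply: SyS.
    by apply: (subspaceD sS); [apply: aS.2 | apply: (subspaceZ _ sS); apply: SyS].
  by move=> TS; apply: nSy; rewrite -TS; exists 0, 1; rewrite add0r scale1r; split=> //; apply: subspace0.
have [|||||v1 [Mv1 nBv1 Sv1]] := IHn m lt_mn g S dS aS nilS V act M B v0 sM sB _ _ _ _ _ Mv0 Bv0.
- by move=> a x z v /SK Kx /SK Kz; apply: actP.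
- by move=> x z v /SK Kx /SK Kz; apply: actL.
- by move=> x v /SK; apply: actM.
- by move=> x v /SK; apply: actB.
- by move=> x v /SK; apply: actN.
(* The vectors that [S] kills modulo [B] are stable under [y], which is nilpotent modulo [B]; the
   last iterate outside [B] is killed modulo [B] by all of [K]. *)
pose Q v := [/\ M v, ~ B v & forall x, S x -> B (act x v)].
have [v [[Mv nBv Sv] Byv]] : exists v, Q v /\ B (act y v).
  have [k] := actN y v1 Ky Mv1.
  have : Q v1 by []. 
  elim: k v1 {Mv1 nBv1 Sv1} => [|k IHk] v [Mv nBv Sv]; first by [].
  rewrite iterSr => yk; have [Byv|nByv] := pselect (B (act y v)); first by exists v.
  apply: IHk yk; split=> //; first exact: actM.
  move=> x Sx; have Kx := SK _ Sx.
  have -> : act x (act y v) = act (lie x y) v + act y (act x v) by rewrite actL // subrK.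
  by apply: subspaceD => //; [apply/Sv/SyS | apply: actB => //; apply: Sv].
exists v; split=> // x; rewrite -TK => -[s [c [Ss ->]]].
rewrite addrC actP //; last exact: SK.
by apply: subspaceD => //; [apply: subspaceZ | apply: Sv].
Qed.

End Engel.

Section Representations.
Variables (F : numClosedFieldType) (g : lieAlgType F).
Implicit Types (L I K : set g) (x y : g).

(* [L] acts on row vectors by right multiplication, whence the order of the
   factors in the bracket condition. *)
Definition lie_rep L n (rho : g -> 'M[F]_n) :=
  (forall a x y, L x -> L y -> rho (a *: x + y) = a *: rho x + rho y) /\
  (forall x y, L x -> L y -> rho (lie x y) = rho y *m rho x - rho x *m rho y).

Section Rep.
Variables (L : set g) (n : nat) (rho : g -> 'M[F]_n).
Hypotheses (aL : subalgebra L) (fL : fdim L) (rhoP : lie_rep L rho).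
Let sL : subspace L := aL.1.

Lemma rep0 : rho 0 = 0.
Proof.
have L0 := subspace0 sL; have := rhoP.1 (-1) 0 0 L0 L0.
by rewrite scaler0 addr0 scaleN1r addNr.
Qed.

Lemma repZ a x : L x -> rho (a *: x) = a *: rho x.
Proof.
by move=> Lx; rewrite -[a *: x]addr0 rhoP.1 // ?rep0 ?addr0 //; apply: subspace0.
Qed.

Lemma rep_sum (I : eqType) (r : seq I) (f : I -> g) : (forall i, i \in r -> L (f i)) ->
  rho (\sum_(i <- r) f i) = \sum_(i <- r) rho (f i).
Proof.
elim: r => [|i r IHr] fL'; first by rewrite !big_nil rep0.
rewrite !big_cons -[f i]scale1r rhoP.1 ?scale1r ?IHr //; last first.
- by apply: subspace_sum_seq => // j jr; apply: fL'; rewrite inE jr orbT.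
- by apply: fL'; rewrite inE eqxx.
by move=> j jr; apply: fL'; rewrite inE jr orbT.
Qed.

Lemma rep_geig x y c d k j (v : 'rV_n) : L x -> L y ->
  geig (mulmxr (rho x)) d j v -> geig (ad x) c k y ->
  geig (mulmxr (rho x)) (d + c) (j + k) (v *m rho y).
Proof.
move=> Lx Ly; apply: (@geig_mul _ _ _ _ _ _ _ (fun u w => u *m rho w) setT L) => //.
- by move=> w Lw; apply: subalgebra_ad.
- by move=> w _; rewrite mul0mx.
- by move=> u _; rewrite rep0 mulmx0.
- by move=> b u w _ _; rewrite /= mulmxBl scalemxAl.
- move=> b u w _ Lw; rewrite -scaleNr addrC rhoP.1 //; last exact: aL.2.
  by rewrite scaleNr addrC mulmxBr scalemxAr.
- move=> u w _ Lw; rewrite /= rhoP.2 // mulmxBr !mulmxA addrC subrK //.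
Qed.

Lemma fdim_rV : fdim [set: 'rV[F]_n].
Proof.
by exists n, idfun; split=> [//|]; apply/seteqP; split=> // v _; exists v.
Qed.

(* The operator with eigenvalues conjugate to those of [rho x] normalizes
   [rho L], and pairs with [rho x] to the sum of the squared moduli. *)
Lemma cartan_nil x : (forall x y, L x -> L y -> \tr (rho x *m rho y) = 0) ->
  L x -> lieprod L L x -> forall v : 'rV_n, exists k, iter k (mulmxr (rho x)) v = 0.
Proof.
move=> tr0 Lx LLx; pose f := mulmxr (rho x) : {linear 'rV[F]_n -> 'rV[F]_n}.
have [m [s [us sA]]] := fdim_ann (f := f) fdim_rV (fun v _ => I).
have [q qP] := spec_calculus f m (fun c => c^*) us.
pose T := lin1_mx (pact f q); have TE r : r *m T = pact f q r by apply: mul_rV_lin1.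
(* A component of [y] of [ad x]-eigenvalue [c] moves the eigenvalue [d] to [d + c], so its
   commutator with [T] multiplies it by the conjugate of [c]. *)
have TL y : L y -> exists2 y', L y' & rho y *m T - T *m rho y = rho y'.
  move=> Ly; have [k [r [u [ur -> uP]]]] := geig_dec_fdim (f := ad x) fL (fun v => aL.2 x v Lx) Ly.
  exists (\sum_(c <- r) c^* *: u c).
    by apply: subspace_sum_seq => // c /uP[Lu _]; apply: subspaceZ.
  rewrite !rep_sum; try by move=> c /uP[Lu _] //; apply: subspaceZ.
  apply/row_matrixP => i; rewrite !rowE.
  have [k' [r' [w [_ -> wP]]]] := geig_dec_fdim (f := f) fdim_rV (fun v _ => I)
     (I : [set: 'rV_n] (delta_mx 0 i)).
  rewrite !mulmx_suml; apply: eq_big_seq => d /wP[_ wd].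
  rewrite mulmx_sumr -sumrB !mulmx_sumr; apply: eq_big_seq => c /uP[Lu uc].
  rewrite mulmxBr !mulmxA !TE (qP (w d) d k') ?sA // (qP (w d *m rho (u c)) (d + c) (k' + k)%N) ?sA //.
    by rewrite -scalemxAl -scalerBl rmorphD addrC addKr repZ // scalemxAr.
  exact: rep_geig.
(* [x] lies in [[L, L]]. On a bracket, cyclicity of the trace moves a commutator onto [T], and [TL]
   brings it back to [rho L], where the traces of products vanish. *)
have trT : \tr (rho x *m T) = 0.
  suff : (L `&` [set y | \tr (rho y *m T) = 0]) x by case.
  move: LLx; apply: lieprod_sub => [|y z Ly Lz].
    apply: (conj _ _); rewrite /= ?rep0 ?mul0mx ?linear0 //; first by split=> //; apply: subspace0.
    move=> a u v [Lu u0] [Lv v0]; split; first exact: sL.2.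
    by rewrite /= rhoP.1 // mulmxDl linearD /= -scalemxAl linearZ /= u0 v0 mulr0 addr0.
  split; first exact: aL.2.
  rewrite /= rhoP.2 // mulmxBl linearB /= -!mulmxA.
  rewrite [X in _ - X]mxtrace_mulC -mulmxA -linearB -mulmxBr /=.
  by have [y' Ly' ->] := TL y Ly; apply: tr0.
have ev0 := eigen0_of_trace TE _ trT.
move=> v; have [k [r [u [_ -> uP]]]] := geig_dec_fdim (f := f) fdim_rV (fun v _ => I)
     (I : [set: 'rV_n] v).
have f0 w : iter k f w = pact f (('X - 0%:P) ^+ k) w.
  rewrite pactXsubC_exp; apply: eq_iter => {}w; by rewrite scale0r subr0.
exists k; rewrite f0 linear_sum big1_seq // => c /= /uP[_ uc].
have [->|uc0] := pselect (u c = 0); first by rewrite linear0.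
have [w [_ w0 fw]] := geig_eig (A := setT) (fun v _ => I) (@subspaceT _ _) I uc0 uc.
suff c0 : c = 0 by move: uc; rewrite c0 geigE.
apply: (ev0 _ c w) => //; last exact/eqP.
move=> d z z0 zX; have := qP z d 1%N (sA _ I); rewrite geig1 => /(_ zX).
rewrite (@pact_eig _ _ f q d z zX) => /eqP; rewrite -subr_eq0 -scalerBl scaler_eq0.
by rewrite (negPf z0) orbF subr_eq0 => /eqP.
Qed.

End Rep.
End Representations.

Section SemisimpleAlgebras.
Variables (F : numClosedFieldType) (g : lieAlgType F).
Implicit Types (L I K : set g) (x y : g).

(** This is the form of semisimplicity that [reductive] yields directly for a complement of the
    center. *)
Definition lie_semisimple L := [/\ subalgebra L, fdim L,
  forall I, lie_ideal L I -> exists J, ideal_sum L I J & lie_center L = [set 0]].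

(** Split [v] along [[I, I]] and a complement [J]. The component [j] in [J] lies in [I]; it commutes
    with [I], since [[j, a]] is in both [[I, I]] and [J], and with a complement of [I]. So [j] is
    central, hence zero. *)
Lemma ss_ideal_perfect L I : lie_semisimple L -> lie_ideal L I -> I `<=` lieprod I I.
Proof.
move=> [aL fL cL zL] iI v Iv; have [sI IL LI] := iI.
have iD := lieprod_ideal aL iI iI; have [J DJ] := cL _ iD; have [J2 IJ2] := cL _ iI.
have [d [j [Dd Jj vE]]] := ideal_sum_dec DJ (IL _ Iv).
have [_ [sJ JL LJ] DJ0 _] := DJ.
have Ij : I j.
  have -> : j = v - d by rewrite vE addrC addKr.
  apply: (subspaceB sI) => //; apply: lieprod_sub Dd => // x y Ix Iy.
  by apply: LI => //; apply: IL.
suff j0 : j = 0 by rewrite vE j0 addr0.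
suff : lie_center L j by rewrite zL.
split; first exact: JL.
move=> y Ly; have [a [b [Ia Jb ->]]] := ideal_sum_dec IJ2 Ly.
rewrite linearDr /= (ideal_sum_disj IJ2 Ij Jb) addr0.
suff : (lieprod I I `&` J) (lie j a) by rewrite DJ0.
split; first exact: lieprod_mem.
by rewrite lieC; apply: (subspaceN sJ); apply: LJ => //; apply: IL.
Qed.

Lemma rep_sub L K n (rho : g -> 'M[F]_n) : K `<=` L -> lie_rep L rho -> lie_rep K rho.
Proof.
move=> KL [rl rb]; split=> [a|] x y /KL Lx /KL Ly; [exact: rl | exact: rb].
Qed.

Lemma geig_disj (V : lmodType F) (f : {linear V -> V}) c d k j v :
  geig f c k v -> geig f d j v -> c != d -> v = 0.
Proof.
move=> cv /geigE dv cd; apply: (@geig_ppow_notin _ _ f c k j [:: d]) => //.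
  by rewrite inE.
by rewrite /ppow big_seq1.
Qed.

(** A component of [y] of [ad x]-eigenvalue [c] sends generalized null vectors of [rho x] to
    generalized eigenvectors of value [c]. All vectors are generalized null vectors, so for [c != 0]
    the component acts by zero. *)
Lemma ad_nilpotent L n (rho : g -> 'M[F]_n) x y : subalgebra L -> fdim L ->
  lie_rep L rho -> (forall x, L x -> rho x = 0 -> x = 0) ->
  L x -> (forall v : 'rV_n, exists k, iter k (mulmxr (rho x)) v = 0) ->
  L y -> exists k, iter k (ad x) y = 0.
Proof.
move=> aL fL rhoP rinj Lx xnil Ly.
have [m [s [u [us yE uP]]]] := geig_dec_fdim (f := ad x) fL (fun v => aL.2 x v Lx) Ly.
exists m; suff: geig (ad x) 0 m y.
  by rewrite /geig => <-; apply: eq_iter => w; rewrite scale0r subr0.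
rewrite yE; apply: subspace_sum_seq => [|c cs]; first exact: geig_linear.
have [Lu uc] := uP c cs; have [c0|c0] := eqVneq c 0; first by rewrite -c0.
suff -> : u c = 0 by apply: subspace0 (geig_linear _ _ _).
apply: rinj => //; apply/row_matrixP => i; rewrite row0 rowE.
have geig0 (v : 'rV_n) : exists k, geig (mulmxr (rho x)) 0 k v.
  have [k vk] := xnil v; exists k; rewrite /geig -[RHS]vk.
  by apply: eq_iter => w; rewrite scale0r subr0.
have [k vk] := geig0 (delta_mx 0 i); have [j wj] := geig0 (delta_mx 0 i *m rho (u c)).
by apply: (geig_disj (rep_geig aL rhoP Lx Lu vk uc) wj); rewrite add0r.
Qed.

(** All [rho x] are nilpotent by [cartan_nil]. If some vector escaped the common kernel [B], Engel
    modulo [B] would give [w] outside [B] with every [w *m rho x] in [B]; products of two operators,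
    hence brackets, hence all of [L] would kill [w]. *)
Lemma perfect_trace0 L n (rho : g -> 'M[F]_n) : subalgebra L -> fdim L ->
  L `<=` lieprod L L -> lie_rep L rho -> (forall x, L x -> rho x = 0 -> x = 0) ->
  (forall x y, L x -> L y -> \tr (rho x *m rho y) = 0) ->
  forall x, L x -> x = 0.
Proof.
move=> aL fL pL rhoP rinj tr0.
have nil x : L x -> forall v : 'rV_n, exists k, iter k (mulmxr (rho x)) v = 0.
  by move=> Lx; apply: cartan_nil tr0 Lx (pL _ Lx).
pose B := [set v : 'rV[F]_n | forall x, L x -> v *m rho x = 0].
have sB : subspace B.
  split=> [x _|a u v Bu Bv x Lx]; first by rewrite mul0mx.
  by rewrite mulmxDl -scalemxAl Bu // Bv // scaler0 addr0.
suff BT v : B v.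
  move=> x Lx; apply: rinj => //; apply/row_matrixP => i.
  by rewrite rowE row0; apply: BT.
apply: contrapT => nBv.
have [||||||w [_ nBw wB]] := @engel _ g L fL aL _ _ (fun x => mulmxr (rho x)) setT B v
   (@subspaceT _ _) sB _ _ _ _ _ I nBv.
- by move=> x y Lx Ly; apply: (ad_nilpotent aL fL rhoP rinj Lx (nil x Lx) Ly).
- by move=> a x y u Lx Ly _; rewrite /= rhoP.1 // mulmxDr scalemxAr.
- by move=> x y u Lx Ly _; rewrite /= rhoP.2 // mulmxBr !mulmxA.
- by [].
- by move=> x u Lx Bu; rewrite /= Bu //; apply: subspace0.
- move=> x u Lx _; have [k uk] := nil x Lx u; exists k; rewrite uk; exact: subspace0.
apply: nBw => x /pL; move: x.
suff : lieprod L L `<=` L `&` [set x | w *m rho x = 0] by move=> H x /H[].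
apply: lieprod_sub => [|x y Lx Ly].
  split=> [|a x y [Lx wx] [Ly wy]].
    by split; [apply: subspace0 aL.1 | rewrite /= (rep0 aL rhoP) mulmx0].
  split; first exact: aL.1.2.
  by rewrite /= rhoP.1 // mulmxDr -scalemxAr wx wy scaler0 addr0.
split; first exact: aL.2.
by rewrite /= rhoP.2 // mulmxBr !mulmxA [w *m rho y *m _]wB // [w *m rho x *m _]wB // subrr.
Qed.

Lemma rep_kernel_ideal L n (rho : g -> 'M[F]_n) : subalgebra L -> lie_rep L rho ->
  lie_ideal L (L `&` [set x | rho x = 0]).
Proof.
move=> aL rhoP; split.
- split=> [|a x y [Lx x0] [Ly y0]].
    by split; [apply: subspace0 aL.1 | apply: rep0 aL rhoP].
  split; first exact: aL.1.2.
  by rewrite /= rhoP.1 // x0 y0 scaler0 addr0.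
- by move=> x [].
- move=> x y Lx [Ly y0]; split; first exact: aL.2.
  by rewrite /= rhoP.2 // y0 mul0mx mulmx0 subrr.
Qed.

(** Faithfulness is obtained by restricting to a complement of the kernel, which is again
    perfect. *)
Lemma ss_trace0 L n (rho : g -> 'M[F]_n) : lie_semisimple L -> lie_rep L rho ->
  (forall x y, L x -> L y -> \tr (rho x *m rho y) = 0) ->
  forall x, L x -> rho x = 0.
Proof.
move=> ssL rhoP tr0; have [aL fL cL zL] := ssL.
have [K IK] := cL _ (rep_kernel_ideal aL rhoP); have [_ iK IK0 _] := IK.
have KL := ideal_sub iK.
have K0 : forall x, K x -> x = 0.
  apply: (@perfect_trace0 K n rho (ideal_subalgebra iK)).
  - exact: fdim_sub fL (ideal_subspace iK) KL.
  - exact: ss_ideal_perfect ssL iK.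
  - exact: rep_sub KL rhoP.
  - move=> x Kx x0; suff : (L `&` [set x | rho x = 0] `&` K) x by rewrite IK0.
    by split=> //; split=> //; apply: KL.
  - by move=> x y /KL Lx /KL; apply: tr0.
move=> x Lx; have [a [b [[La a0] /K0 -> ->]]] := ideal_sum_dec IK Lx.
by rewrite addr0.
Qed.

Lemma trace_radical_ideal L n (rho : g -> 'M[F]_n) : subalgebra L -> lie_rep L rho ->
  lie_ideal L [set x | L x /\ forall y, L y -> \tr (rho x *m rho y) = 0].
Proof.
move=> aL rhoP; split.
- split=> [|a x y [Lx x0] [Ly y0]].
    split=> [|y Ly]; first exact: subspace0 aL.1.
    by rewrite (rep0 aL rhoP) mul0mx linear0.
  split=> [|z Lz]; first exact: aL.1.2.
  by rewrite rhoP.1 // mulmxDl -scalemxAl linearP /= x0 // y0 // mulr0 addr0.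
- by move=> x [].
- move=> x y Lx [Ly y0]; split=> [|z Lz]; first exact: aL.2.
  have := y0 _ (aL.2 _ _ Lx Lz); rewrite !rhoP.2 // mulmxBr mulmxBl !linearB /=.
  rewrite !mulmxA => /eqP; rewrite subr_eq0 => /eqP E.
  by rewrite -[rho x *m _ *m _]mulmxA [X in _ - X]mxtrace_mulC E subrr.
Qed.

End SemisimpleAlgebras.

(** * Complete reducibility and derivations *)

Section Weyl.
Variables (F : numClosedFieldType) (g : lieAlgType F).
Implicit Types (L I K : set g) (x y : g).

Lemma trace_eig0 n (X : 'M[F]_n) :
  (forall c (v : 'rV_n), v != 0 -> v *m X = c *: v -> c = 0) -> \tr X = 0.
Proof.
case: n X => [|n] X ev0; first by rewrite /mxtrace big_ord0.
have [r rE] := closed_field_poly_normal (char_poly X).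
rewrite (monicP (char_poly_monic X)) scale1r in rE.
have r0 z : z \in r -> z = 0.
  move=> zr; have /eigenvalueP[v vX v0] : eigenvalue X z.
    by rewrite eigenvalue_root_char rE root_prod_XsubC.
  exact: ev0 v0 vX.
have /eqP := char_poly_trace X (ltn0Sn n); rewrite rE.
have -> : \prod_(z <- r) ('X - z%:P) = 'X^(size r).
  rewrite (eq_big_seq (fun=> 'X)) => [|z /r0 ->]; last by rewrite subr0.
  by rewrite big_const_seq count_predT iter_mulr mulr1.
have sr : size r = n.+1.
  by have := size_char_poly X; rewrite rE size_prod_XsubC => -[].
by rewrite coefXn sr /= ltn_eqF // eq_sym oppr_eq0 => /eqP.
Qed.

Section Casimir.
Variables (L K : set g) (n d : nat) (rho : g -> 'M[F]_n) (phi : {linear 'rV[F]_d -> g}).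
Hypotheses (aL : subalgebra L) (rhoP : lie_rep L rho) (iK : lie_ideal L K).
Hypotheses (injphi : injective phi) (Kphi : K = range phi).

Let b i := phi (delta_mx 0 i).
Definition trace_gram : 'M[F]_d := \matrix_(i, j) \tr (rho (b i) *m rho (b j)).
(** For [N] the inverse of [trace_gram] this is the Casimir operator; a free [N] lets [casimir_comm]
    turn commutation with [rho y] into a matrix identity on [N]. *)
Definition casimir (N : 'M[F]_d) : 'M[F]_n :=
  \sum_i \sum_j N i j *: (rho (b i) *m rho (b j)).

Let Kb i : K (b i). Proof. by rewrite Kphi; exists (delta_mx 0 i). Qed.
Let Lb i : L (b i). Proof. exact: ideal_sub iK _ (Kb i). Qed.

Lemma rep_phi r : rho (phi r) = \sum_i r 0 i *: rho (b i).
Proof.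
rewrite {1}[r]row_sum_delta linear_sum (rep_sum aL rhoP) => [|i _].
  by apply: eq_bigr => i _; rewrite linearZ /= (repZ aL rhoP) //; exact: Lb.
by rewrite linearZ /=; apply: (subspaceZ _ aL.1); exact: Lb.
Qed.

Let adm y := mxof phi (ad y).

Let rep_adm y i : L y -> rho (lie y (b i)) = \sum_j adm y i j *: rho (b j).
Proof.
move=> Ly; have adK v : K v -> K (ad y v) by case: iK => _ _; apply.
rewrite -[lie y _]/(ad y (phi _)) -(mxofP Kphi) // rep_phi; apply: eq_bigr => j _.
by rewrite -rowE mxE.
Qed.

Lemma gram_adm y : L y -> adm y *m trace_gram + trace_gram *m (adm y)^T = 0.
Proof.
move=> Ly; apply/matrixP => i k; rewrite !mxE.
have -> : \sum_j adm y i j * trace_gram j k = \tr (rho (lie y (b i)) *m rho (b k)).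
  rewrite rep_adm // mulmx_suml linear_sum; apply: eq_bigr => j _.
  by rewrite -scalemxAl linearZ /= [trace_gram _ _]mxE.
have -> : \sum_j trace_gram i j * (adm y)^T j k = \tr (rho (b i) *m rho (lie y (b k))).
  rewrite rep_adm // mulmx_sumr linear_sum; apply: eq_bigr => j _.
  by rewrite -scalemxAr linearZ /= [_^T _ _]mxE [trace_gram _ _]mxE mulrC.
rewrite !rhoP.2 // mulmxBl mulmxBr !linearB /= !mulmxA.
by rewrite -[rho y *m _ *m _]mulmxA [\tr (rho y *m _)]mxtrace_mulC addrA subrK subrr.
Qed.

Lemma casimir_comm N y : L y ->
  casimir N *m rho y - rho y *m casimir N = casimir (N *m adm y + (adm y)^T *m N).
Proof.
move=> Ly; have br i : rho (b i) *m rho y - rho y *m rho (b i) = \sum_j adm y i j *: rho (b j).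
  by rewrite -rep_adm // rhoP.2.
have -> : casimir (N *m adm y + (adm y)^T *m N) = casimir (N *m adm y) + casimir ((adm y)^T *m N).
  rewrite -big_split; apply: eq_bigr => i _; rewrite -big_split; apply: eq_bigr => j _.
  by rewrite mxE scalerDl.
have -> : casimir (N *m adm y) = \sum_i \sum_j N i j *:
    (rho (b i) *m (rho (b j) *m rho y - rho y *m rho (b j))).
  apply: eq_bigr => i _; under eq_bigr => j _ do rewrite mxE scaler_suml.
  rewrite exchange_big; apply: eq_bigr => j _; rewrite br mulmx_sumr scaler_sumr.
  by apply: eq_bigr => k _; rewrite -scalemxAr scalerA.
have -> : casimir ((adm y)^T *m N) = \sum_i \sum_j N i j *:
    ((rho (b i) *m rho y - rho y *m rho (b i)) *m rho (b j)).
  rewrite /casimir [LHS]exchange_big [RHS]exchange_big; apply: eq_bigr => j _.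
  under eq_bigr => i _ do rewrite mxE scaler_suml.
  rewrite exchange_big; apply: eq_bigr => k _; rewrite br mulmx_suml scaler_sumr.
  by apply: eq_bigr => i _; rewrite -scalemxAl scalerA mxE mulrC.
rewrite -big_split mulmx_suml mulmx_sumr -sumrB; apply: eq_bigr => i _.
rewrite -big_split mulmx_suml mulmx_sumr -sumrB; apply: eq_bigr => j _.
rewrite /= -scalemxAl -scalemxAr -scalerBr -scalerDr; congr (_ *: _).
by rewrite mulmxBr mulmxBl !mulmxA addrA subrK.
Qed.

Hypothesis Gu : trace_gram \in unitmx.

(** Multiplying the invariance identity [gram_adm] on both sides by the inverse Gram matrix gives
    the vanishing of the matrix in [casimir_comm]. *)
Lemma casimir_central y : L y ->
  casimir (invmx trace_gram) *m rho y = rho y *m casimir (invmx trace_gram).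
Proof.
move=> Ly; apply/eqP; rewrite -subr_eq0 casimir_comm //.
set G := trace_gram; have := gram_adm Ly.
move=> /(congr1 (fun M => invmx G *m M *m invmx G)).
rewrite mulmx0 mul0mx mulmxDr mulmxDl !mulmxA mulmxK // mulVmx // mul1mx => ->.
by apply/eqP; rewrite /casimir big1 // => i _; rewrite big1 // => j _; rewrite mxE scale0r.
Qed.

(** In characteristic zero this makes a nilpotent Casimir operator possible only for [K] of
    dimension zero. *)
Lemma trace_casimir : \tr (casimir (invmx trace_gram)) = d%:R.
Proof.
rewrite linear_sum -(mxtrace1 F d) -(mulVmx Gu) /mxtrace; apply: eq_bigr => i _.
rewrite linear_sum mxE; apply: eq_bigr => j _; rewrite linearZ /= mxtrace_mulC.
by rewrite [trace_gram _ _]mxE.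
Qed.

End Casimir.

(** A kernel vector of the Gram matrix is an element of [K] orthogonal to [K], and to the radical by
    definition, hence to [L]. It lies in the radical and in [K], so it is zero. *)
Lemma trace_gram_unit L K n d (rho : g -> 'M[F]_n) (phi : {linear 'rV[F]_d -> g}) :
  subalgebra L -> lie_rep L rho ->
  ideal_sum L [set x | L x /\ forall y, L y -> \tr (rho x *m rho y) = 0] K ->
  injective phi -> K = range phi -> trace_gram rho phi \in unitmx.
Proof.
move=> aL rhoP RK injphi Kphi.
have [_ iK RK0 _] := RK; have KL := ideal_sub iK.
rewrite -row_free_unit -kermx_eq0; apply/eqP/row_matrixP => i; rewrite row0.
apply: injphi; rewrite linear0; set r := row i _.
suff : ([set x | L x /\ forall y, L y -> \tr (rho x *m rho y) = 0] `&` K) (phi r).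
  by rewrite RK0.
have Kr : K (phi r) by rewrite Kphi; exists r.
split=> //; split=> [|y Ly]; first exact: KL.
have [a [b [[La a0] Kb ->]]] := ideal_sum_dec RK Ly.
rewrite -[b]scale1r addrC rhoP.1 //; last exact: KL.
rewrite mulmxDr linearD /= scale1r [X in _ + X]mxtrace_mulC a0 ?addr0; last exact: KL.
move: Kb; rewrite Kphi => -[s _ <-]; rewrite (rep_phi aL rhoP iK Kphi s) mulmx_sumr.
rewrite linear_sum big1 // => j _; rewrite -scalemxAr linearZ /=.
suff -> : \tr (rho (phi r) *m rho (phi (delta_mx 0 j))) = (r *m trace_gram rho phi) 0 j.
  have /sub_kermxP -> : (r <= kermx (trace_gram rho phi))%MS by apply: row_sub.
  by rewrite mxE mulr0.
rewrite (rep_phi aL rhoP iK Kphi r) mulmx_suml linear_sum mxE.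
by apply: eq_bigr => k _; rewrite -scalemxAl linearZ /= [trace_gram _ _ _ _]mxE.
Qed.

Lemma rV_functional n (f : 'cV[F]_n) (v : 'rV_n) (X : 'M[F]_n) c k :
  X *m f = 0 -> geig (mulmxr X) c k v -> c != 0 -> v *m f = 0.
Proof.
move=> Xf; elim: k v => [|k IHk] v; first by rewrite /geig /= => ->; rewrite mul0mx.
rewrite /geig iterSr => /IHk /[swap] c0 /(_ c0) /=; rewrite mulmxBl -mulmxA Xf mulmx0 sub0r -scalemxAl.
by move=> /eqP; rewrite oppr_eq0 scaler_eq0 (negPf c0) => /eqP.
Qed.

(* A minimal module on which [f] does not vanish carries a nilpotent Casimir
   operator, and the trace of that operator is the dimension of the part of [L]
   on which the trace form is nondegenerate. *)
Theorem ss_invariant L n (rho : g -> 'M[F]_n) (f : 'cV[F]_n) :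
  lie_semisimple L -> lie_rep L rho -> (forall x, L x -> rho x *m f = 0) -> f != 0 ->
  exists v : 'rV_n, (forall x, L x -> v *m rho x = 0) /\ v *m f != 0.
Proof.
move=> ssL; elim/ltn_ind: n => n IHn in rho f *; move=> rhoP rf f0.
have [aL fL cL zL] := ssL.
have [[M [Mst Mf rM]]|minM] := pselect (exists M : 'M[F]_n,
    [/\ forall x, L x -> (M *m rho x <= M)%MS, M *m f != 0 & (\rank M < n)%N]).
  have [B [fB BM]] : exists B : 'M[F]_(\rank M, n), row_free B /\ (B :=: M)%MS.
    by exists (row_base M); rewrite row_base_free; split=> //; apply: eq_row_base.
  have [rho' rhoB] : exists rho' : g -> 'M[F]_(\rank M),
      forall x, L x -> rho' x *m B = B *m rho x.
    exists (fun x => B *m rho x *m pinvmx B) => x Lx; rewrite mulmxKpV // BM.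
    have /submxP[D ->] : (B <= M)%MS by rewrite BM.
    by rewrite -mulmxA; apply: submx_trans (submxMl _ _) (Mst _ Lx).
  have Binj := row_free_inj fB.
  have [|||v [vL vf]] := IHn _ rM rho' (B *m f).
  - split=> [a x y Lx Ly|x y Lx Ly]; apply: Binj.
      rewrite rhoB ?mulmxDl -?scalemxAl ?rhoB //; last exact: aL.1.2.
      by rewrite rhoP.1 // mulmxDr scalemxAr.
    rewrite rhoB; last exact: aL.2.
    rewrite mulmxBl -!mulmxA !rhoB // !mulmxA !rhoB // rhoP.2 // mulmxBr !mulmxA //.
  - by move=> x Lx; rewrite mulmxA rhoB // -mulmxA rf // mulmx0.
  - apply: contraNneq Mf => Bf.
    have /submxP[D ->] : (M <= B)%MS by rewrite BM.
    by rewrite -mulmxA Bf mulmx0.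
  exists (v *m B); split; last by rewrite -mulmxA.
  by move=> x Lx; rewrite -mulmxA -rhoB // mulmxA vL // mul0mx.
have [K RK] := cL _ (trace_radical_ideal aL rhoP).
have [_ iK RK0 _] := RK; have KL := ideal_sub iK.
have [d [phi [injphi Kphi]]] := fdim_sub fL (ideal_subspace iK) KL.
have Gu := trace_gram_unit aL rhoP RK injphi Kphi.
pose C := casimir rho phi (invmx (trace_gram rho phi)).
have CL x : L x -> C *m rho x = rho x *m C by move=> Lx; apply: (casimir_central aL rhoP iK Kphi Gu Lx).
have Lphi i : L (phi (delta_mx 0 i)) by apply: KL; rewrite Kphi; exists (delta_mx 0 i).
have Cf : C *m f = 0.
  rewrite mulmx_suml big1 // => i _; rewrite mulmx_suml big1 // => j _.
  by rewrite -scalemxAl -mulmxA rf // mulmx0 scaler0.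
(* [M] is the generalized null space of [C]. As [C *m f = 0], the functional [f] vanishes on the
   other generalized eigenspaces, so it survives on [M], and minimality makes [M] everything. *)
have [|M MP] := @rV_subspace F n [set v | exists k, geig (mulmxr C) 0 k v].
  split=> [|a u v [k uk] [j vj]]; first by exists 0%N.
  exists (maxn k j); apply: (geig_linear _ _ _).2.
    exact: geig_le (leq_maxl _ _) uk.
  exact: geig_le (leq_maxr _ _) vj.
have Mst x : L x -> (M *m rho x <= M)%MS.
  move=> Lx; apply/row_subP => i; rewrite row_mul; apply/MP.
  have [k wk] := (MP (row i M)).2 (row_sub _ _); exists k; move: wk.
  elim: k (row i M) => [|k IHk] w; first by rewrite /geig /= => ->; rewrite mul0mx.
  rewrite /geig !iterSr => /IHk; rewrite /= !scale0r !subr0 => H.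
  by rewrite -mulmxA -CL // mulmxA.
have Mf : M *m f != 0.
  apply: contraNneq f0 => Mf; apply/eqP/row_matrixP => i; rewrite row0 rowE.
  have [m [s [u [_ -> uP]]]] := geig_dec_fdim (f := mulmxr C) (fdim_rV F n) (fun v _ => I)
     (I : [set: 'rV_n] (delta_mx 0 i)).
  rewrite mulmx_suml big1_seq // => c /= /uP[_ uc].
  have [c0|] := eqVneq c 0; last exact: rV_functional Cf uc.
  have /submxP[D ->] : (u c <= M)%MS by apply/MP; exists m; rewrite -c0.
  by rewrite -mulmxA Mf mulmx0.
have Mfull v : (v <= M)%MS.
  apply: submx_full; rewrite /row_full eqn_leq rank_leq_col leqNgt; apply/negP => rM.
  by apply: minM; exists M.
have d0 : d = 0%N.
  apply/eqP; rewrite -(pnatr_eq0 F) -(trace_casimir Gu) -/C trace_eig0 //.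
  move=> c v v0 vC; have [k vk] := (MP v).2 (Mfull _ v).
  apply/eqP; apply: contraNT v0 => c0; apply/eqP.
  have vc : geig (mulmxr C) c 1 v by apply/geig1.
  exact: geig_disj vc vk c0.
(* With [K = 0] the trace form vanishes on all of [L], so [L] acts by zero and every vector is
   invariant. *)
have rho0 : forall x, L x -> rho x = 0.
  apply: ss_trace0 ssL rhoP _ => x y Lx Ly.
  have [a [b [[La a0]]]] := ideal_sum_dec RK Lx.
  rewrite Kphi => -[r _ <-] ->; have -> : phi r = 0.
    suff -> : r = 0 by rewrite linear0.
    by apply/rowP => -[i lid]; exfalso; move: lid; rewrite d0.
  by rewrite addr0 a0.
have [i fi] : exists i, row i f != 0.
  apply: contrapT => nex; case/negP: f0; apply/eqP/row_matrixP => i; rewrite row0.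
  by apply: contrapT => fi; apply: nex; exists i; apply/eqP.
by exists (delta_mx 0 i); split=> [x Lx|]; rewrite ?rho0 ?mulmx0 // -rowE.
Qed.

End Weyl.

Section Modules.
Variables (F : numClosedFieldType) (g : lieAlgType F).
Implicit Types (L I K : set g) (x y : g).

Definition lie_rep_on (V : lmodType F) L (act : g -> {linear V -> V}) (M : set V) :=
  [/\ forall a x y v, L x -> L y -> M v -> act (a *: x + y) v = a *: act x v + act y v,
      forall x y v, L x -> L y -> M v ->
        act (lie x y) v = act x (act y v) - act y (act x v) &
      forall x v, L x -> M v -> M (act x v)].

Lemma rep_mxof (V : lmodType F) L (act : g -> {linear V -> V}) (M : set V)
    n (psi : {linear 'rV[F]_n -> V}) : subalgebra L ->
  lie_rep_on L act M -> injective psi -> M = range psi ->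
  lie_rep L (fun x => mxof psi (act x)).
Proof.
move=> aL [actP actL actM] inj Mpsi; have MP r : M (psi r) by rewrite Mpsi; exists r.
split=> [a x y Lx Ly|x y Lx Ly]; apply: (mx_phi_inj inj) => r.
  have Lxy : L (a *: x + y) by apply: aL.1.2.
  rewrite mulmxDr -scalemxAr !linearD linearZ /= !(mxofP Mpsi) => [|v|v|v]; last first.
  - exact: actM.
  - exact: actM.
  - exact: actM.
  by rewrite actP.
have Lxy : L (lie x y) by apply: aL.2.
rewrite mulmxBr !linearB !mulmxA /= !(mxofP Mpsi) => [|v|v|v|v|v]; try exact: actM.
by rewrite actL.
Qed.

Lemma ss_invariant_mod (V : lmodType F) L (act : g -> {linear V -> V}) (M : set V)
    (phi : {scalar V}) : lie_semisimple L -> fdim M -> lie_rep_on L act M ->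
  (forall x v, L x -> M v -> phi (act x v) = 0) -> (exists2 v, M v & phi v <> 0) ->
  exists v, [/\ M v, phi v <> 0 & forall x, L x -> act x v = 0].
Proof.
move=> ssL [n [psi [inj Mpsi]]] rep phi0 [v Mv phiv]; have [aL _ _ _] := ssL.
have MP r : M (psi r) by rewrite Mpsi; exists r.
pose f : 'cV[F]_n := \col_i phi (psi (delta_mx 0 i)).
have fE r : (r *m f) 0 0 = phi (psi r).
  rewrite [r in RHS]row_sum_delta !linear_sum mxE; apply: eq_bigr => i _.
  by rewrite mxE !linearZ.
have actP x r : L x -> psi (r *m mxof psi (act x)) = act x (psi r).
  by move=> Lx; rewrite (mxofP Mpsi) // => w; case: rep => _ _; apply.
have [|||w [wL wf]] := @ss_invariant F g L n (fun x => mxof psi (act x)) f ssL.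
- exact: rep_mxof rep inj Mpsi.
- move=> x Lx; apply/row_matrixP => i; rewrite rowE mulmxA row0.
  by apply/matrixP => a b; rewrite !ord1 fE actP // phi0 // mxE.
- move: Mv phiv; rewrite Mpsi => -[r _ <-] phir; apply/eqP => f0; apply: phir.
  by rewrite -fE f0 mulmx0 mxE.
exists (psi w); split=> // [phiw|x Lx]; last by rewrite -actP // wL // linear0.
case/negP: wf; apply/eqP/matrixP => a b.
by rewrite !ord1 fE phiw mxE.
Qed.

End Modules.

Section CommutatorAction.
Variables (F : fieldType) (n : nat).

(** The commutator of operators for matrices acting on rows from the right; with [A := rho x] it
    makes matrices a left module when [rho] satisfies [lie_rep]. *)
Definition mxcomm (A T : 'M[F]_n) := T *m A - A *m T.

Lemma mxcomm_linear A : linear (mxcomm A).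
Proof.
move=> a S T; rewrite /mxcomm mulmxDl mulmxDr -scalemxAl -scalemxAr scalerBr.
by rewrite opprD addrACA.
Qed.

Lemma mxcommJ A B T :
  mxcomm (B *m A - A *m B) T = mxcomm A (mxcomm B T) - mxcomm B (mxcomm A T).
Proof.
have E a b c d p q : (a - p - (q - d)) - (b - q - (p - c)) = (a - b) - (c - d) :> 'M[F]_n.
  have H u v w z : u - v - (w - z) = u + z - (v + w) :> 'M[F]_n by rewrite opprB addrACA -opprD.
  rewrite (H (a - p)) addrA subrK [q - d + _]addrC addrA subrK !opprB.
  by rewrite addrACA [RHS]addrACA [- c - b]addrC.
by rewrite /mxcomm !mulmxBr !mulmxBl !mulmxA E.
Qed.

HB.instance Definition _ A :=
  GRing.isLinear.Build F 'M[F]_n 'M[F]_n *:%R (mxcomm A) (mxcomm_linear A).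

End CommutatorAction.

(** * Diagonalizability in modules, and inner derivations *)

Section SemisimpleAction.
Variables (F : numClosedFieldType) (g : lieAlgType F).
Implicit Types (L I K : set g) (x y : g).

(* The span [E] of the eigenvectors of [x] is a submodule; an [L]-equivariant
   projection onto it, provided by Weyl's argument, has no kernel, since its
   kernel would contain a further eigenvector. *)
Theorem ss_diag (V : lmodType F) L (act : g -> {linear V -> V}) (M : set V) x :
  lie_semisimple L -> fdim M -> lie_rep_on L act M ->
  L x -> diag_on (ad x) L -> diag_on (act x) M.
Proof.
move=> ssL fM rep Lx dx; have [aL fL _ _] := ssL; have [actP actL actM] := rep.
have actxM v : M v -> M (act x v) by apply: actM.
have [n [psi [inj Mpsi]]] := fM; have sM := fdim_subspace fM.
have MP r : M (psi r) by rewrite Mpsi; exists r.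
pose rho y := mxof psi (act y).
have rhoP : lie_rep L rho := rep_mxof aL rep inj Mpsi.
have rhoE y r : L y -> psi (r *m rho y) = act y (psi r).
  by move=> Ly; rewrite (mxofP Mpsi) // => w; apply: actM.
pose S := lspan (eigs (act x) M).
have sS : subspace S := lspan_subspace _.
have SM : S `<=` M by apply: lspan_min => // v [].
(* Eigenvectors of [ad x] span [L], and such an eigenvector shifts the eigenvalue of [v]. *)
have SL y v : L y -> S v -> S (act y v).
  move=> Ly; move: v; apply: (@lspan_min _ _ _ [set v | S (act y v)]).
    split=> [|a u v /= Su Sv]; first by rewrite /= linear0; apply: subspace0.
    by rewrite linearP; apply: sS.2.
  move=> v [Mv [c xv]] /=; have := dx _ Ly.
  have : M v /\ act x v = c *: v by [].
  move: y Ly => _ _ [{}Mv {}xv] /lspan_sum[s [sP ->]].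
  have lins : forall r : seq (F * g), (forall z, z \in r -> eigs (ad x) L z.2) ->
      S (act (\sum_(z <- r) z.1 *: z.2) v).
    elim=> [_|z r IHr rP].
      have L0 := subspace0 aL.1; have := actP (-1) 0 0 v L0 L0 Mv.
      rewrite big_nil scaler0 addr0 scaleN1r addNr => ->; exact: subspace0.
    have [Lz [d xz]] : eigs (ad x) L z.2 by apply: rP; rewrite inE eqxx.
    have rP' w : w \in r -> eigs (ad x) L w.2 by move=> wr; apply: rP; rewrite inE wr orbT.
    rewrite big_cons actP //; last first.
      apply: subspace_sum_seq; first exact: aL.1.
      by move=> w /rP'[Lw _]; apply: (subspaceZ _ aL.1).
    apply: sS.2; last exact: IHr.
    apply: sub_lspan; split; first exact: actM.
    exists (c + d).
    have -> : act x (act z.2 v) = act (lie x z.2) v + act z.2 (act x v) by rewrite actL // subrK.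
    rewrite -/(ad x z.2) xz xv linearZ /= -[d *: z.2]addr0 actP //; last exact: subspace0 aL.1.
    have L0 := subspace0 aL.1; have := actP (-1) 0 0 v L0 L0 Mv.
    by rewrite scaler0 addr0 scaleN1r addNr => ->; rewrite addr0 scalerDl addrC.
  exact: lins.
have [E [EP _]] := fdimn_preim sS Mpsi SM.
have EL y : L y -> (E *m rho y <= E)%MS.
  move=> Ly; apply/row_subP => i; rewrite row_mul; apply/EP.
  by rewrite rhoE //; apply: SL => //; apply/EP/row_sub.
(* A nonzero kernel stable under [rho x] contains an eigenvector of [x], and [E] contains all of
   these. *)
have eigE (A : 'M[F]_n) (r : 'rV[F]_n) : r != 0 -> r *m A = 0 ->
    (forall s : 'rV[F]_n, s *m A = 0 -> s *m rho x *m A = 0) ->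
    exists s : 'rV[F]_n, [/\ s != 0, s *m A = 0 & (s <= E)%MS].
  move=> r0 rA Ax; pose N := psi @` [set s : 'rV[F]_n | s *m A = 0].
  have sN : subspace N.
    split=> [|a _ _ [s /= sA <-] [t /= tA <-]].
      by exists 0; rewrite /= ?mul0mx ?linear0.
    exists (a *: s + t); rewrite ?linearP //= mulmxDl -scalemxAl sA tA.
    by rewrite scaler0 addr0.
  have NM : N `<=` M by move=> _ [s _ <-].
  have fN := fdim_sub fM sN NM.
  have Nx v : N v -> N (act x v).
    by move=> [s /= sA <-]; exists (s *m rho x); rewrite /= ?Ax ?rhoE.
  have [||_ [c [[s /= sA <-] u0 xu]]] := exists_eig (v := psi r) fN Nx.
  - by exists r.
  - by move=> pr0; case/negP: r0; apply/eqP/inj; rewrite pr0 linear0.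
  exists s; split=> //; first by apply: contra_notN u0 => /eqP->; rewrite linear0.
  by apply/EP; apply: sub_lspan; split=> //; exists c.
suff Efull : (1%:M <= E)%MS.
  move=> v Mv; have [r _ <-] : range psi v by rewrite -Mpsi.
  suff : S (psi r) by []. 
  apply/EP; rewrite -[r]mulmx1; exact: mulmx_sub.
have [n0|n_gt0] := posnP n.
  by apply/row_subP => -[i lin]; exfalso; move: lin; rewrite n0.
have [e0 [e00 _ e0E]] : exists s : 'rV[F]_n, [/\ s != 0, s *m (0 : 'M[F]_n) = 0 & (s <= E)%MS].
  apply: (eigE 0 (delta_mx 0 (Ordinal n_gt0))); rewrite ?mulmx0 //.
    by apply/eqP => /rowP/(_ (Ordinal n_gt0))/eqP; rewrite !mxE !eqxx oner_eq0.
  by move=> s _; rewrite mulmx0.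
have [k e0k] : exists k, e0 0 k != 0.
  apply: contrapT => nex; case/negP: e00; apply/eqP/rowP => k; rewrite mxE.
  by apply: contrapT => ek; apply: nex; exists k; apply/eqP.
pose phi (T : 'M[F]_n) : F := (e0 *m T) 0 k.
have phiL : linear_for *%R phi.
  by move=> a S' T; rewrite /phi mulmxDr -scalemxAr !mxE.
pose phi' : {scalar 'M[F]_n} := HB.pack phi (GRing.isLinear.Build _ _ _ _ phi phiL).
(* [H] consists of the operators into [E] that are scalar on [E]. Commutators with [rho y] vanish on
   [E], so [phi], which reads off the scalar at a nonzero coordinate of [e0], vanishes on all images
   under [L]. *)
pose H := [set T : 'M[F]_n | (T <= E)%MS /\ exists a, E *m T = a *: E].
have sH : subspace H.
  split=> [|a S' T [SE [b Sb]] [TE [c Tc]]].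
    by split; [apply: sub0mx | exists 0; rewrite mulmx0 scale0r].
  split; first by apply: addmx_sub => //; apply: scalemx_sub.
  by exists (a * b + c); rewrite mulmxDr -scalemxAr Sb Tc scalerA scalerDl.
have H0 y T : L y -> H T -> E *m mxcomm (rho y) T = 0.
  move=> Ly [_ [a Ta]]; have /submxP[D ED] := EL _ Ly.
  by rewrite mulmxBr !mulmxA Ta -scalemxAl ED -mulmxA Ta -scalemxAr subrr.
have fT : fdim [set: 'M[F]_n].
  have -> : [set: 'M[F]_n] = range (@vec_mx F n n); last exact: fdim_range.
  by apply/seteqP; split=> // T _; exists (mxvec T); rewrite ?mxvecK.
have [||||T [[TE [a Ta]] phiT TL]] :=
    @ss_invariant_mod F g 'M[F]_n L (fun y => @mxcomm F n (rho y)) H phi' ssL.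
- exact: fdim_sub fT sH _.
- split=> [b y z T Ly Lz _|y z T Ly Lz _|y T Ly HT].
  + rewrite /= /mxcomm rhoP.1 // mulmxDr mulmxDl -scalemxAr -scalemxAl scalerBr.
    by rewrite opprD addrACA.
  + by rewrite /= rhoP.2 // mxcommJ.
  + split; last by exists 0; rewrite H0 // scale0r.
    have [TE _] := HT; apply: addmx_sub; last by rewrite eqmx_opp mulmx_sub.
    by have /submxP[D ->] := TE; rewrite -mulmxA mulmx_sub ?EL.
- move=> y T Ly HT; rewrite /= /phi; have /submxP[D ->] := e0E.
  by rewrite -mulmxA H0 // mulmx0 mxE.
- exists (pinvmx E *m E).
    by split; [apply: submxMl | exists 1; rewrite mulmxA mulmxKpV ?scale1r].
  by rewrite /= /phi mulmxA mulmxKpV //; apply/eqP.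
have a0 : a != 0.
  apply: contra_not_neq phiT => a0; rewrite /= /phi; have /submxP[D ->] := e0E.
  by rewrite -mulmxA Ta a0 scale0r mulmx0 mxE.
have Tinj (r : 'rV[F]_n) : r *m T = 0 -> r = 0.
  move=> rT; apply/eqP; apply: contraT => r0; have [|s [s0 sT sE]] := eigE T r r0 rT.
    move=> s sT; have /eqP := TL x Lx; rewrite subr_eq0 => /eqP Tx.
    by rewrite -mulmxA -Tx mulmxA sT mul0mx.
  have /submxP[D sD] := sE; move: sT; rewrite sD -mulmxA Ta -scalemxAr -sD => /eqP.
  by rewrite scaler_eq0 (negPf a0) (negPf s0).
have Tu : T \in unitmx.
  rewrite -row_free_unit -kermx_eq0; apply/eqP/row_matrixP => i; rewrite row0.
  by apply: Tinj; apply/sub_kermxP/row_sub.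
by rewrite -(mulVmx Tu); apply: mulmx_sub.
Qed.

(* A derivation [S] yields the module [L + F] with [x . (a, c) = ([x, a] - c S x, 0)],
   whose invariants represent [S] as an inner derivation. *)
Theorem ss_derivation L (S : {linear g -> g}) : lie_semisimple L ->
  (forall x, L x -> L (S x)) ->
  (forall x y, L x -> L y -> S (lie x y) = lie (S x) y + lie x (S y)) ->
  exists2 a, L a & forall x, L x -> S x = lie a x.
Proof.
move=> ssL SL SD; have [aL fL _ _] := ssL.
pose act0 x (v : g * F^o) : g * F^o := (lie x v.1 - v.2 *: S x, 0).
have actL x : linear (act0 x).
  move=> a [u c] [v d]; rewrite /act0 /=; apply/pair_equal_spec; split=> /=.
    rewrite linearPr /= -[a *: c]/(a * c) scalerBr scalerDl scalerA opprD.
    exact: addrACA.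
  by rewrite -[a *: 0]/(a * 0) mulr0 addr0.
pose act x : {linear (g * F^o)%type -> (g * F^o)%type} :=
  HB.pack (act0 x) (GRing.isLinear.Build _ _ _ _ (act0 x) (actL x)).
pose phi0 (v : g * F^o) : F := v.2.
have phiL : linear_for *%R phi0 by [].
pose phi : {scalar (g * F^o)%type} := HB.pack phi0 (GRing.isLinear.Build _ _ _ _ phi0 phiL).
pose M := [set v : g * F^o | L v.1].
have fM : fdim M.
  have [n [psi [_ Lpsi]]] := fL.
  pose f (r : 'rV[F]_(n + 1)) : g * F^o := (psi (lsubmx r), rsubmx r 0 0).
  have fL' : linear f.
    by move=> a u v; rewrite /f linearP linearP /= !mxE.
  pose f' : {linear 'rV[F]_(n + 1) -> (g * F^o)%type} :=
    HB.pack f (GRing.isLinear.Build _ _ _ _ f fL').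
  have -> : M = range f'; last exact: fdim_range.
  apply/seteqP; split=> [[u c] /=|_ [r _ <-] /=]; rewrite /M /= Lpsi; last by eexists.
  move=> [r _ <-]; exists (row_mx r c%:M) => //=.
  by rewrite /f row_mxKl row_mxKr !mxE eqxx.
have rep : lie_rep_on L act M.
  split=> [a x y [u c] Lx Ly _|x y [u c] Lx Ly _|x [u c] Lx Lu] /=.
  - apply/pair_equal_spec; split=> /=; last by rewrite -[a *: 0]/(a * 0) mulr0 addr0.
    by rewrite linearPl linearP scalerBr !scalerDr opprD !scalerA mulrC addrACA.
  - rewrite /act0 /=; apply/pair_equal_spec; split=> /=; last by rewrite subr0.
    rewrite !scale0r !subr0 !linearBr /= SD // [lie x (lie y u)]lieJ !linearZr_LR /=.
    rewrite [lie (S x) y]lieC scalerDr scalerN !opprB !opprD opprK.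
    by rewrite [RHS]addrAC [X in _ = X - _]addrACA subrr addr0 -addrA.
  - by rewrite /M /=; apply: (subspaceB aL.1); [apply: aL.2 | apply: (subspaceZ _ aL.1); apply: SL].
have [||[a c] [La /= c0 acL]] := ss_invariant_mod (phi := phi) ssL fM rep.
- by [].
- by exists (0, 1); [exact: subspace0 aL.1 | apply/eqP; rewrite oner_eq0].
(* Invariance of [(a, c)] reads [[x, a] = c S x], and [c] is not zero. *)
exists (- (c^-1 *: a)); first by apply: (subspaceN aL.1); apply: (subspaceZ _ aL.1).
move=> x Lx; have /pair_equal_spec[/eqP] := acL x Lx.
rewrite subr_eq0 => /eqP xa _; rewrite linearNl /= linearZl_LR /= [lie a x]lieC scalerN opprK xa.
by rewrite scalerA mulVf ?scale1r //; apply/eqP.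
Qed.

End SemisimpleAction.

(** * Cartan subalgebras of reductive algebras *)

Section CartanSubalgebras.
Variables (F : numClosedFieldType) (g : lieAlgType F).
Implicit Types (L I K m h l A B : set g) (x y : g).

(** An ideal of the complement [s] is an ideal of [m], because the center acts trivially; its
    complement in [m] is then cut down to [s]. *)
Lemma reductive_ss m : subalgebra m -> fdim m -> reductive m ->
  exists2 s, ideal_sum m (lie_center m) s & lie_semisimple s.
Proof.
move=> am fm rm; have [s ms] := rm _ (center_ideal am); exists s => //.
have [iz is_ zs0 _] := ms; have sM := ideal_sub is_; have ss := ideal_subspace is_.
split.
- exact: ideal_subalgebra is_.
- exact: fdim_sub fm ss sM.
- move=> I [sI Is sIs].
  have iI : lie_ideal m I.
    split=> [//|x /Is/sM //|x y mx Iy].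
    have [a [b [[_ az] sb ->]]] := ideal_sum_dec ms mx.
    by rewrite linearDl /= az ?add0r; [apply: sIs | apply/sM/Is].
  have [J IJ] := rm _ iI; have [_ [sJ Jm mJ] IJ0 _] := IJ.
  exists (J `&` s); split; first by split.
  + split; first exact: subspaceI.
      by move=> x [].
    move=> x y sx [Jy sy]; split; first by apply: mJ => //; apply: sM.
    by case: is_ => _ _; apply=> //; apply: sM.
  + apply/seteqP; split=> [x [Ix [Jx _]]|_ ->]; first by rewrite -IJ0.
    by split; [|split]; apply: subspace0.
  + apply/seteqP; split; first by apply: lspan_min => // x [/Is|[]].
    move=> v sv; have [a [b [Ia Jb vE]]] := ideal_sum_dec IJ (sM _ sv).
    rewrite vE; apply: (subspaceD (lspan_subspace _)); apply: sub_lspan; [by left | right].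
    split=> //; have -> : b = v - a by rewrite vE addrC addKr.
    by apply: (subspaceB ss) => //; apply: Is.
- apply/seteqP; split=> [x [sx xs]|_ ->]; last first.
    by split=> [|y _]; [apply: subspace0 | rewrite linear0l].
  suff : (lie_center m `&` s) x by rewrite zs0.
  split=> //; split; first exact: sM.
  move=> y my; have [a [b [za sb ->]]] := ideal_sum_dec ms my.
  by rewrite linearDr /= (xs b sb) addr0 lieC (ideal_sum_disj ms za sx) oppr0.
Qed.

Lemma nilpotent_ad h : lie_nilpotent h -> exists k, forall x y, h x -> h y -> iter k (ad x) y = 0.
Proof.
move=> [k hk]; exists k => x y hx hy; suff : iter k (lieprod h) h (iter k (ad x) y) by rewrite hk.
by elim: k {hk} => //= k IHk; apply: lieprod_mem.
Qed.

Lemma geig0_iter (V : lmodType F) (f : {linear V -> V}) k v : geig f 0 k v <-> iter k f v = 0.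
Proof.
rewrite /geig (_ : iter k _ v = iter k f v) //.
by apply: eq_iter => w; rewrite scale0r subr0.
Qed.

Lemma ad_geig x c d i j y z : geig (ad x) c i y -> geig (ad x) d j z ->
  geig (ad x) (c + d) (i + j) (lie y z).
Proof.
apply: (@geig_mul _ _ _ _ _ _ _ (@lie F g) setT setT) => //=.
- by move=> v _; rewrite linear0l.
- by move=> v _; rewrite linear0r.
- by move=> a u v _ _; rewrite linearBl /= linearZl_LR.
- by move=> a u v _ _; rewrite linearBr /= linearZr_LR.
- by move=> u v _ _; rewrite /ad lieJ.
Qed.

(* The Fitting decomposition of [m] under [h]. *)
Lemma cartan_complement m h : subalgebra m -> fdim m -> cartan m h ->
  exists B, [/\ subspace B, forall x y, h x -> B y -> B (lie x y), h `&` B = [set 0] &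
    forall v, m v -> exists a b, [/\ h a, B b & v = a + b]].
Proof.
move=> am fm [ah hm /nilpotent_ad[k0 hk0] selfn]; have sh := ah.1.
(* Descent on the dimension of an [h]-stable [A] containing [h] and having an [h]-stable complement
   [B], from [A = m] down to [A = h]. *)
pose P A := [/\ subspace A, h `<=` A, A `<=` m, forall x y, h x -> A y -> A (lie x y) &
  exists B, [/\ subspace B, forall x y, h x -> B y -> B (lie x y), A `&` B = [set 0] &
    forall v, m v -> exists a b, [/\ A a, B b & v = a + b]]].
suff : P h by case.
have Pm : P m.
  split=> //; [exact: am.1 | by move=> x y /hm; apply: am.2 |].
  exists [set 0]; split; first exact: subspace_set0.
  - by move=> x y _ ->; rewrite linear0r.
  - by apply/seteqP; split=> [v []|v ->] //; split=> //; apply: subspace0 am.1.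
  - by move=> v mv; exists v, 0; rewrite addr0.
suff minP n A : fdimn A n -> P A -> P h by have [n dm] := fm; apply: minP dm Pm.
elim/ltn_ind: n A => n IHn A dA PA.
have [sA hA Am hAA [B [sB hB AB0 AB]]] := PA.
have [hE|neAh] := pselect (h = A); first by move: PA; rewrite -hE.
have fA : fdim A by exists n.
(* If [h] acts nilpotently on [A], Engel modulo [h] gives an element outside [h] that normalizes
   [h], against self-normalization. *)
have [nilA|] := pselect (forall x v, h x -> A v -> exists k, iter k (ad x) v = 0).
  have [v0 Av0 nhv0] : exists2 v, A v & ~ h v.
    apply: contrapT => nex; apply: neAh; apply/seteqP; split=> // v Av.
    by apply: contrapT => nhv; apply: nex; exists v.
  have [||||||v [Av nhv hv]] := @engel _ g h (fdim_sub fm sh hm) ah _ g (@ad F g) A h v0 sA sh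
     _ _ _ _ _ Av0 nhv0.
  - by move=> x y hx hy; exists k0; apply: hk0.
  - by move=> a x y v _ _ _; rewrite /= /ad linearPl.
  - by move=> x y v _ _ _; rewrite /= /ad [in RHS]lieJ addrK.
  - exact: hAA.
  - by move=> x v; apply: ah.2.
  - by move=> x v hx Av; have [k kv] := nilA x v hx Av; exists k; rewrite kv; apply: subspace0.
  case: nhv; rewrite -selfn; split; first exact: Am.
  by move=> y hy; rewrite lieC; apply: (subspaceN sh); apply: hv.
move=> /existsNP[x /existsNP[v1 /not_implyP[hx /not_implyP[Av1 nv1]]]].
have Ax v : A v -> A (ad x v) by apply: hAA.
(* Fitting components of [A] under a non-nilpotent [ad x]: [A0] is the smaller candidate and [A1]
   joins the complement. Polynomials not vanishing at [0] are coprime to powers of [X], so the two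
   meet in zero. *)
pose A0 := [set v | A v /\ exists k, geig (ad x) 0 k v].
pose A1 := [set v | A v /\ exists2 p : {poly F}, ~~ root p 0 & pact (ad x) p v = 0].
have sA0 : subspace A0.
  split=> [|a u v [Au [i ui]] [Av [j vj]]].
    by split; [apply: subspace0 | exists 0%N].
  split; first exact: sA.2.
  exists (maxn i j); apply: (geig_linear _ _ _).2.
    exact: geig_le (leq_maxl _ _) ui.
  exact: geig_le (leq_maxr _ _) vj.
have sA1 : subspace A1.
  split=> [|a u v [Au [p p0 up]] [Av [q q0 vq]]].
    by split; [apply: subspace0 | exists 1; rewrite ?root1 ?linear0].
  split; first exact: sA.2.
  exists (p * q); first by rewrite rootM negb_or p0.
  rewrite linearP /= (_ : pact _ _ u = 0) ?scaler0 ?add0r.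
    by rewrite pactM vq linear0.
  by rewrite pactM pact_comm up linear0.
have A01 v : A0 v -> A1 v -> v = 0.
  move=> [_ [k /geigE kv]] [_ [p p0 pv]]; apply: pact_coprime kv pv.
  by rewrite coprimep_expl // coprimep_sym coprimep_XsubC.
have geigA1 c k v : A v -> c != 0 -> geig (ad x) c k v -> A1 v.
  move=> Av c0 cv; split=> //; exists (('X - c%:P) ^+ k); last exact/geigE.
  by rewrite rootE horner_exp hornerXsubC sub0r expf_neq0 ?oppr_eq0.
have hgeig y : h y -> geig (ad x) 0 k0 y by move=> hy; apply/geig0_iter/hk0.
have dec v : A v -> exists (i : nat) s (u : F -> g), [/\ uniq s, v = \sum_(c <- s) u c &
    forall c, c \in s -> A (u c) /\ geig (ad x) c i (u c)].
  exact: geig_dec_fdim.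
have hA0 y v : h y -> A0 v -> A0 (lie y v).
  move=> hy [Av [k kv]]; split; first exact: hAA.
  by exists (k0 + k)%N; rewrite -[0]addr0; apply: ad_geig => //; apply: hgeig.
have hA1 y v : h y -> A1 v -> A1 (lie y v).
  move=> hy [Av [p p0 pv]]; have [i [s [us sA']]] := fdim_ann fA Ax.
  have [e eP] := geig_dec (ad x) i us; have [vE ev] := eP v (sA' _ Av).
  rewrite vE linear_sumr; apply: (subspace_sum_seq sA1) => c cs.
  have Ac : A (pact (ad x) (e c) v) by apply: pact_stable.
  have [c0|c0] := eqVneq c 0.
    have -> : pact (ad x) (e c) v = 0.
      apply: A01; split=> //; first by exists i; rewrite -c0; apply: ev.
      by exists p => //; rewrite pact_comm pv linear0.
    by rewrite linear0r; apply: subspace0.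
  apply: (geigA1 c (k0 + i)%N) => //; first exact: hAA.
  by have := ad_geig (hgeig y hy) (ev c cs); rewrite add0r.
have A0A : A0 `<=` A by move=> v [].
have [|i lt_in dA0] := fdimn_proper dA sA0 A0A.
  by move=> A0E; case: nv1; move: Av1; rewrite -A0E => -[_ [k /geig0_iter]]; exists k.
apply: (IHn i lt_in A0 dA0); split=> //.
- by move=> y hy; split; [apply: hA | exists k0; apply: hgeig].
- by move=> v /A0A/Am.
exists [set v | exists a b, [/\ A1 a, B b & v = a + b]]; split.
- split=> [|c _ _ [a [b [Aa Bb ->]]] [a' [b' [Aa' Bb' ->]]]].
    by exists 0, 0; rewrite addr0; split=> //; apply: subspace0.
  exists (c *: a + a'), (c *: b + b').
  by split; [apply: sA1.2 | apply: sB.2 | rewrite scalerDr addrACA].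
- move=> y _ hy [a [b [Aa Bb ->]]]; exists (lie y a), (lie y b).
  by split; [apply: hA1 | apply: hB | rewrite linearDr].
- apply/seteqP; split=> [v [A0v [a [b [A1a Bb vE]]]]|_ ->]; last first.
    split; first exact: subspace0.
    by exists 0, 0; rewrite addr0; split=> //; apply: subspace0.
  have b0 : b = 0.
    suff : (A `&` B) b by rewrite AB0.
    split=> //; have -> : b = v - a by rewrite vE addrC addKr.
    by apply: (subspaceB sA); [apply: A0A | case: A1a].
  by apply: A01 => //; rewrite vE b0 addr0.
- move=> v /AB[a [b [Aa Bb ->]]]; have [i' [s [u [us -> uP]]]] := dec a Aa.
  rewrite (bigID (pred1 0)) /=; set a0 := \sum_(_ <- _ | _) _; set a1 := \sum_(_ <- _ | _) _.
  exists a0, (a1 + b); split; last by rewrite addrA.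
    rewrite /a0 big_seq_cond; apply: (@subspace_sum _ _ A0) =>[|]; [exact: sA0|] => c /andP[cs /eqP c0].
    by have [Au uc] := uP c cs; split=> //; exists i'; rewrite -c0.
  exists a1, b; split=> //.
  rewrite /a1 big_seq_cond; apply: (@subspace_sum _ _ A1) =>[|]; [exact: sA1|] => c /andP[cs c0].
  by have [Au uc] := uP c cs; apply: geigA1 uc.
Qed.

(** The row space of the transpose is the annihilator of the left kernel: one inclusion is immediate
    and the ranks agree. *)
Lemma sub_trmx_kermx n (A : 'M[F]_n) (r : 'rV[F]_n) :
  (forall c : 'rV_n, c *m A = 0 -> c *m r^T = 0) -> (r <= A^T)%MS.
Proof.
move=> rA; have AK : (A^T <= kermx (kermx A)^T)%MS.
  by apply/sub_kermxP; rewrite -trmx_mul mulmx_ker trmx0.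
have := mxrank_leqif_sup AK; rewrite mxrank_ker !mxrank_tr mxrank_ker.
rewrite subKn ?rank_leq_row // => -[_ /esym]; rewrite eqxx => KA.
apply: submx_trans KA; apply/sub_kermxP.
apply: trmx_inj; rewrite trmx_mul trmxK trmx0; apply/row_matrixP => i.
by rewrite row_mul row0 rA //; apply/sub_kermxP/row_sub.
Qed.

Lemma iter_mulmxr n (X : 'M[F]_n) k (v : 'rV_n) : iter k (mulmxr X) v = v *m X ^+ k.
Proof. by elim: k => [|k IHk]; rewrite ?expr0 ?mulmx1 // exprSr mulmxA -IHk. Qed.

Lemma trace_comm_nil n (X N : 'M[F]_n) k : X *m N = N *m X -> N ^+ k = 0 ->
  \tr (X *m N) = 0.
Proof.
move=> XN Nk; apply: trace_eig0 => c v v0 vXN.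
have vk : v *m (X *m N) ^+ k = c ^+ k *: v.
  elim: k {Nk} => [|k IHk]; first by rewrite !expr0 mulmx1 scale1r.
  by rewrite exprSr mulmxA IHk -scalemxAl vXN scalerA exprSr.
have := vk; rewrite (exprMn_comm k (XN : GRing.comm X N)) Nk mulr0 mulmx0 => /esym/eqP.
rewrite scaler_eq0 (negPf v0) orbF expf_eq0 => /andP[_ /eqP//].
Qed.

(* A nonzero ad-nilpotent [n] of [s] is orthogonal to its centralizer, hence
   lies in the image of [ad n]. *)
Lemma ss_nilpotent_image s n : lie_semisimple s -> s n ->
  (exists k, forall x, s x -> iter k (ad n) x = 0) -> exists2 u, s u & lie n u = n.
Proof.
move=> ss sn [k nk]; have [a_s fs _ zs] := ss; have [d [psi [inj Spsi]]] := fs.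
have rep : lie_rep_on s (@ad F g) s.
  split=> [a x y v _ _ _|x y v _ _ _|x v]; last exact: a_s.2.
    by rewrite /= /ad linearPl.
  by rewrite /= /ad [in RHS]lieJ addrK.
have rhoP := rep_mxof a_s rep inj Spsi; set rho := fun x => _ in rhoP.
have rhoE x r : s x -> psi (r *m rho x) = lie x (psi r).
  by move=> sx; rewrite (mxofP Spsi) // => v; apply: a_s.2.
have sE r : s (psi r) by rewrite Spsi; exists r.
pose R := [set x | s x /\ forall y, s y -> \tr (rho x *m rho y) = 0].
have iR : lie_ideal s R := trace_radical_ideal a_s rhoP.
have Rs : R `<=` s by move=> x [].
have rinj x : s x -> rho x = 0 -> x = 0.
  move=> sx x0; suff : lie_center s x by rewrite zs.
  split=> // y; rewrite [in s y]Spsi => -[r _ <-].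
  by rewrite -rhoE // x0 mulmx0 linear0.
(* The Killing form is nondegenerate: its radical is a perfect ideal acting faithfully with
   vanishing traces. *)
have R0 : forall x, R x -> x = 0.
  apply: (@perfect_trace0 F g R d rho (ideal_subalgebra iR)).
  - exact: fdim_sub fs (ideal_subspace iR) Rs.
  - exact: ss_ideal_perfect ss iR.
  - exact: rep_sub Rs rhoP.
  - by move=> x /Rs; apply: rinj.
  - by move=> x y [_ x0] /Rs; apply: x0.
have Rsum : ideal_sum s R s.
  split=> //; first exact: idealT.
    apply/seteqP; split=> [x [/R0//]|_ ->].
    by split; [apply: subspace0 (ideal_subspace iR) | apply: subspace0 a_s.1].
  apply/seteqP; split; first by apply: lspan_min => [|x [/Rs|]//]; exact: a_s.1.
  by move=> x sx; apply: sub_lspan; right.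
have Gu := trace_gram_unit a_s rhoP Rsum inj Spsi.
have GA := gram_adm a_s rhoP (idealT a_s) Spsi sn.
rewrite -/(rho n) in GA; set G := trace_gram rho psi in Gu GA.
have [r _ rn] : range psi n by rewrite -Spsi.
have Nk : rho n ^+ k = 0.
  apply/row_matrixP => i; rewrite rowE row0 -iter_mulmxr; apply: inj.
  rewrite linear0 -[RHS](nk _ (sE (delta_mx 0 i))).
  by elim: k {nk} => //= k IHk; rewrite rhoE // IHk.
(* The left kernel of [rho n] is the centralizer of [n], where the trace form against [n] vanishes.
   So [r *m G^T] lies in the row space of the transpose of [rho n], which [GA] turns into the image
   of [ad n]. *)
have rG : (r *m G^T <= (rho n)^T)%MS.
  apply: sub_trmx_kermx => c cn; have ncom : lie n (psi c) = 0 by rewrite -rhoE // cn linear0.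
  have nX : rho (psi c) *m rho n = rho n *m rho (psi c).
    have /eqP := rhoP.2 _ _ (sE c) sn; rewrite lieC ncom oppr0 (rep0 a_s rhoP) eq_sym subr_eq0.
    by move=> /eqP.
  apply/matrixP => i j; rewrite !ord1 [RHS]mxE -(trace_comm_nil nX Nk) -rn.
  rewrite (rep_phi a_s rhoP (idealT a_s) Spsi c) (rep_phi a_s rhoP (idealT a_s) Spsi r).
  rewrite mulmx_suml linear_sum mxE; apply: eq_bigr => a _.
  rewrite trmx_mul trmxK mxE -scalemxAl linearZ /=; congr (_ * _).
  rewrite mulmx_sumr linear_sum; apply: eq_bigr => b _.
  by rewrite -scalemxAr linearZ /= [G _ _]mxE [r^T _ _]mxE mulrC.
have Gsym : G^T = G by apply/matrixP => i j; rewrite !mxE mxtrace_mulC.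
move: rG; rewrite Gsym => /submxP[D rD]; exists (psi (- (D *m invmx G))); first exact: sE.
rewrite -rhoE // -[RHS]rn; congr (psi _).
have -> : r = D *m (rho n)^T *m invmx G by rewrite -rD mulmxK.
have := congr1 (fun M => invmx G *m M *m invmx G) GA.
rewrite mulmx0 mul0mx mulmxDr mulmxDl !mulmxA mulmxK // mulVmx // mul1mx => /eqP.
by rewrite addr_eq0 mulNmx -!mulmxA => /eqP->; rewrite mulmxN opprK.
Qed.

(* The semisimple part of [ad y] is [ad] of some [z] in [h], so that [y - z] is an
   ad-nilpotent element [n] of [h]; if [lie n u = n], then [u] may be chosen in [h],
   which is nilpotent, so that [n = 0]. *)
Theorem cartan_diag m h y : subalgebra m -> fdim m -> reductive m -> cartan m h ->
  h y -> diag_on (ad y) m.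
Proof.
move=> am fm rm cmh hy; have [ah hm nh selfn] := cmh; have sh := ah.1.
have [s ms ss] := reductive_ss am fm rm; have [iz is_ zs0 _] := ms.
have [a_s fs _ zs] := ss; have sm := ideal_sub is_.
have zh z : lie_center m z -> h z.
  move=> [mz zm]; rewrite -selfn; split=> // w /hm mw; rewrite zm //.
  exact: subspace0.
have [z [y1 [cz sy1 yE]]] := ideal_sum_dec ms (hm _ hy).
have hy1 : h y1.
  have -> : y1 = y - z by rewrite yE addrC addKr.
  by apply: subspaceB => //; apply: zh.
have ady v : m v -> ad y v = ad y1 v.
  by move=> mv; rewrite /ad yE linearDl /= cz.2 ?add0r.
have adys v : s v -> s (ad y1 v) by apply: a_s.2.
have [i [r [ur rs]]] := fdim_ann fs adys.
have [q qP] := spec_calculus (ad y1) i id ur; have [S SE] : exists S : {linear g -> g}, forall v, S v = pact (ad y1) q v.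
  by exists (pact (ad y1) q).
have Ss v : s v -> s (S v) by rewrite SE; apply: pact_stable => //; apply: a_s.1.
have dec v : s v -> exists (i : nat) r (u : F -> g), [/\ uniq r, v = \sum_(c <- r) u c &
    forall c, c \in r -> s (u c) /\ geig (ad y1) c i (u c)].
  exact: geig_dec_fdim.
have Sgeig c k v : s v -> geig (ad y1) c k v -> S v = c *: v.
  by move=> sv; rewrite SE; apply: qP; apply: rs.
(* Eigenvalues of [ad y1] add under the bracket, so [S] is a derivation. *)
have SD v w : s v -> s w -> S (lie v w) = lie (S v) w + lie v (S w).
  move=> /dec[j [l [u [_ -> uP]]]] /dec[j' [l' [u' [_ -> u'P]]]].
  rewrite !linear_sumlz ![S (\sum_(_ <- l) _)]linear_sum /=.
  rewrite !linear_sumlz -big_split /=.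
  apply: eq_big_seq => c /uP[sc uc].
  rewrite !linear_sumr ![S (\sum_(_ <- l') _)]linear_sum /= !linear_sumr -big_split /=; apply: eq_big_seq => d /u'P[sd ud].
  rewrite (Sgeig _ _ _ sc uc) (Sgeig _ _ _ sd ud) linearZl_LR linearZr_LR /= -scalerDl.
  by apply: Sgeig (ad_geig uc ud); apply: a_s.2.
have [t st St] := ss_derivation ss Ss SD.
have [k0 hk0] := nilpotent_ad nh.
(* On [h] the map [ad y1] is nilpotent, so [S] vanishes on the [s]-components of [h]. Thus [t]
   commutes with [h], and self-normalization puts it there. *)
have ht : h t.
  rewrite -selfn; split=> [|w hw]; first exact: sm.
  have [zw [w1 [czw sw1 wE]]] := ideal_sum_dec ms (hm _ hw).
  have hw1 : h w1.
    have -> : w1 = w - zw by rewrite wE addrC addKr.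
    by apply: subspaceB => //; apply: zh.
  have -> : lie t w = 0; last exact: subspace0.
  rewrite wE linearDr /= [lie t zw]lieC czw.2 ?oppr0 ?add0r; last exact: sm.
  rewrite -St // (Sgeig 0 k0) ?scale0r //.
  by apply/geig0_iter/hk0.
pose n := y1 - t; have hn : h n by apply: subspaceB.
have sn : s n by apply: (subspaceB a_s.1).
have nk : exists k, forall x, s x -> iter k (ad n) x = 0.
  have adn c j u : s u -> geig (ad y1) c j u -> iter j (ad n) u = 0.
    elim: j u => // j IHj u su cu; have nu : ad n u = ad y1 u - c *: u.
      by rewrite -(Sgeig _ _ _ su cu) St // /ad linearBl.
    rewrite iterSr nu; apply: IHj; last by move: cu; rewrite /geig iterSr.
    by apply: (subspaceB a_s.1); [apply: adys | apply: (subspaceZ _ a_s.1)].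
  exists i => x sx; have [e eP] := geig_dec (ad y1) i ur; have [xE ex] := eP x (rs _ sx).
  apply/geig0_iter; rewrite xE; apply: subspace_sum_seq => [|c cr]; first exact: geig_linear.
  by apply/geig0_iter/(adn c); [apply: pact_stable => //; apply: a_s.1 | apply: ex].
have [u su nu] := ss_nilpotent_image ss sn nk.
have n0 : n = 0.
  (* The component [a] of [u] in [h] still satisfies [[n, a] = n], because [[n, b]] lies in [h] and
     in [B]. Then [ad a] acts on [n] by [-1] and is nilpotent on [h]. *)
  have [B [sB hB hB0 hBm]] := cartan_complement am fm cmh.
  have [a [b [ha Bb uE]]] := hBm u (sm _ su).
  have nb : lie n b = 0.
    suff : (h `&` B) (lie n b) by rewrite hB0.
    split; last exact: hB.
    have -> : lie n b = n - lie n a by rewrite -{2}nu uE linearDr /= addrC addKr.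
    by apply: subspaceB => //; apply: ah.2.
  have na : ad a n = - n by rewrite /ad lieC -{2}nu uE linearDr /= nb addr0.
  have : iter k0 (ad a) n = 0 by apply: hk0.
  have -> : iter k0 (ad a) n = (-1) ^+ k0 *: n.
    elim: k0 {hk0} => [|k IHk]; first by rewrite scale1r.
    by rewrite /= IHk linearZ /= na scalerN -scaleNr exprS mulN1r.
  by move=> /eqP; rewrite scaler_eq0 signr_eq0 /= => /eqP.
have y1t : y1 = t by apply/eqP; rewrite -subr_eq0 -/n n0.
move=> v /(ideal_sum_dec ms)[a [b [ca sb ->]]].
apply: (subspaceD (lspan_subspace _)).
  apply: sub_lspan; split; first by case: ca.
  exists 0; rewrite scale0r /= ady; last by case: ca.
  by rewrite /ad lieC ca.2 ?oppr0 //; apply: sm.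
have [j [l [w [_ -> wP]]]] := dec b sb.
apply: subspace_sum_seq => [|c /wP[sc wc]]; first exact: lspan_subspace.
apply: sub_lspan; split; first exact: sm.
exists c; rewrite /= ady; last exact: sm.
by rewrite -(Sgeig _ _ _ sc wc) St // /ad y1t.
Qed.

Theorem root_inclusion_diag l m hm x : subalgebra l -> fdim l -> reductive l ->
  subalgebra m -> fdim m -> reductive m -> l `<=` m -> cartan m hm -> cartan l (l `&` hm) ->
  l x -> diag_on (ad x) l -> diag_on (ad x) m.
Proof.
move=> al fl rl am fm rm lm cm cl lx dx.
have [s ls ss] := reductive_ss al fl rl; have [a_s fs _ _] := ss.
have [iz is_ _ _] := ls; have sl := ideal_sub is_.
have [z [x1 [cz sx1 xE]]] := ideal_sum_dec ls lx.
have zl y : l y -> lie z y = 0 by case: cz => _; apply.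
have hz : hm z.
  have [_ _ _ selfn] := cl; suff : (l `&` hm) z by case.
  rewrite -selfn; split; first by case: cz.
  move=> y [ly hy]; rewrite zl //; split; apply: subspace0; first exact: al.1.
  by case: cm => -[].
have dz := cartan_diag am fm rm cm hz.
have adx y : l y -> ad x y = ad x1 y by move=> ly; rewrite /ad xE linearDl /= zl ?add0r.
have dx1 : diag_on (ad x1) s.
  have : diag_on (ad x) s.
    apply: (diag_sub dx sl a_s.1) => v sv; rewrite /= adx; last exact: sl.
    exact: a_s.2.
  move=> dxs v /dxs; apply: lspan_le => u [su [c uc]]; split=> //; exists c.
  by rewrite -uc /= adx //; apply: sl.
have mx1 := lm _ (sl _ sx1); have mz : m z by apply: lm; case: cz.
have rep : lie_rep_on s (@ad F g) m.
  split=> [a u v w _ _ _|u v w _ _ _|u v su]; last by apply: am.2; apply/lm/sl.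
    by rewrite /= /ad linearPl.
  by rewrite /= /ad [in RHS]lieJ addrK.
apply: (diag_comb (f1 := ad z) (f2 := ad x1) (a := 1) am.1) => // [v|v|v|v|].
- exact: am.2.
- exact: am.2.
- by move=> _; rewrite scale1r /= /ad xE linearDl.
- by move=> _; rewrite /= /ad lieJ zl ?linear0l ?add0r //; apply: sl.
- exact: ss_diag ss fm rep sx1 dx1.
Qed.

End CartanSubalgebras.

(** * Semisimple elements and diagonalizability on the whole algebra *)

Section Exhaustion.
Variables (F : numClosedFieldType) (g : lieAlgType F) (gs hs : nat -> set g).
Hypothesis gP : root_exhaustion gs hs.

Lemma exhaustion_le i j : (i <= j)%N -> gs i `<=` gs j.
Proof.
case: gP => _ _ inc _ _; elim: j => [|j IHj]; first by rewrite leqn0 => /eqP->.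
rewrite leq_eqVlt ltnS => /predU1P[->//|/IHj ij]; apply: subset_trans ij _.
by case: (inc j).
Qed.

Theorem semisimple_diag x : semisimple gs x <-> diag_on (ad x) [set: g].
Proof.
have [fin car inc _ cov] := gP; split=> [[i [gx dx]]|dx]; last first.
  have [i _ gx] : (\bigcup_i gs i) x by rewrite cov.
  exists i; split=> //; have [ai _ _] := fin i.
  by apply: (diag_sub dx) => // [|v]; [exact: ai.1 | apply: ai.2].
have dxk k : diag_on (ad x) (gs (i + k)%N).
  elim: k => [|k IHk]; first by rewrite addn0.
  have [al fl rl] := fin (i + k)%N; have [am fm rm] := fin (i + k).+1.
  have [lm cm cl _] := inc (i + k)%N; rewrite addnS.
  apply: root_inclusion_diag cm cl _ IHk => //; try exact: findim_fdim.
  exact: exhaustion_le (leq_addr _ _) _ gx.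
move=> v _; have [j _ gv] : (\bigcup_i gs i) v by rewrite cov.
have := dxk j v (exhaustion_le (leq_addl _ _) gv).
by apply: lspan_le => u [_ [c uc]]; split=> //; exists c.
Qed.

End Exhaustion.

Section SubLmodule.
Variables (K : fieldType) (T : lmodType K) (S : set T).
Hypothesis sS : subspace S.

(* The proof is an argument so that the canonical instances can refer to it. *)
Definition mem_subspace of subspace S : {pred T} := [pred x | `[< S x >]].

Lemma mem_subspace_closed : submod_closed (mem_subspace sS).
Proof.
split=> [|a u v]; rewrite !inE; first exact: subspace0 sS.
exact: sS.2.
Qed.

HB.instance Definition _ :=
  GRing.isSubmodClosed.Build K T (mem_subspace sS) mem_subspace_closed.
Definition sublmod := {x : T | x \in mem_subspace sS}.
HB.instance Definition _ := SubChoice.on sublmod.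
HB.instance Definition _ := [SubChoice_isSubLmodule of sublmod by <:].

End SubLmodule.

(** * Tensors and the natural modules *)

Section TensorSpan.
Variables (K : fieldType) (V W T : lmodType K) (tens : {bilinear V -> W -> T}).
Hypothesis tensP : tensor_product tens.

(* The universal map into the span of the pure tensors, composed with the
   inclusion, is the identity by uniqueness. *)
Lemma tensor_span : lspan [set z | exists v w, z = tens v w] = [set: T].
Proof.
set S := lspan _; have sS : subspace S := lspan_subspace _.
have St v w : tens v w \in mem_subspace sS by rewrite inE; apply: sub_lspan; exists v, w.
pose f v w : sublmod sS := Sub (tens v w) (St v w).
have fP : bilinear_for *:%R *:%R f.
  split=> [w a u v|v a u w]; apply: val_inj; rewrite [RHS]linearP !SubK.
    by rewrite linearPl.
  by rewrite linearPr.
pose f' : {bilinear V -> W -> sublmod sS} :=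
  HB.pack f (bilinear_isBilinear.Build K V W (sublmod sS) *:%R *:%R f fP).
have [phi [phiE _]] := tensP f'.
have [psi [_ psiU]] := tensP tens.
apply/seteqP; split=> // z _.
have -> : z = \val (phi z).
  rewrite -[LHS]/(idfun z) (psiU idfun) //.
  by rewrite -(psiU (val \o phi)) // => v w; rewrite /= phiE.
by have := valP (phi z); rewrite inE.
Qed.

End TensorSpan.

Lemma iota0_index n : iota 0 n = index_iota 0 n.
Proof. by rewrite /index_iota subn0. Qed.

Section DualVectors.
Variables (F : fieldType) (V W : lmodType F) (p : {bilinear V -> W -> F | *%R & *%R}).

(** If the rows of values [p v (f i)] did not fill the space, a column of [cokermx M] would give a
    combination of the [f i] orthogonal to every [v], hence zero. *)
Lemma dual_vectors n (f : 'I_n -> W) : (forall w, (forall v, p v w = 0) -> w = 0) ->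
  (forall c : 'I_n -> F, \sum_i c i *: f i = 0 -> forall i, c i = 0) ->
  forall j, exists u, forall i, p u (f i) = (i == j)%:R.
Proof.
move=> nd free j; have [|M MP] := @rV_subspace F n [set r | exists u, forall i, r 0 i = p u (f i)].
  split=> [|a r r' [u ru] [u' ru']].
    by exists 0 => i; rewrite mxE linear0l.
  by exists (a *: u + u') => i; rewrite linearPl !mxE ru ru'.
suff : ((delta_mx 0 j : 'rV[F]_n) <= M)%MS.
  by move=> dM; have [u uP] := (MP _).2 dM; exists u => i; rewrite -uP mxE eqxx.
apply: submx_full; rewrite -cokermx_eq0; apply/eqP/matrixP => i k; rewrite [RHS]mxE.
apply: (free (fun i => cokermx M i k) _ i); apply: nd => v.
have /submxP[D rD] : (\row_i p v (f i) <= M)%MS by apply/MP; exists v => l; rewrite mxE.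
 rewrite linear_sumr.
transitivity ((\row_i p v (f i) *m cokermx M) 0 k); last first.
  by rewrite rD -mulmxA mulmx_coker mulmx0 mxE.
by rewrite mxE; apply: eq_bigr => l _; rewrite linearZr_LR /= mxE mulrC.
Qed.

Lemma lfree_ord (f : nat -> W) n : lfree f ->
  forall c : 'I_n -> F, \sum_i c i *: f i = 0 -> forall i, c i = 0.
Proof.
move=> ff c c0 i; pose c' k := if insub k is Some j then c j else 0.
have c'E j : c' (val j) = c j by rewrite /c' valK.
rewrite -c'E; apply: (ff (iota 0 n) c' (iota_uniq _ _)); last by rewrite mem_iota /=.
rewrite iota0_index big_mkord -[RHS]c0.
by apply: eq_bigr => j _; rewrite c'E.
Qed.

End DualVectors.

Section TensorSums.
Variables (F : fieldType) (V W T : lmodType F) (tens : {bilinear V -> W -> T}).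
Variable p : {bilinear V -> W -> F | *%R & *%R}.

(** Lists of pure tensors represent elements of [gl], far from uniquely. Traces and natural actions
    are computed on lists; [sl_tsum] and [act_tsum] connect them with [gl] and [g]. *)
Definition tensor_sum (s : seq (V * W)) := \sum_(c <- s) tens c.1 c.2.
Definition tensor_trace (s : seq (V * W)) : F := \sum_(c <- s) p c.1 c.2.
Definition tensor_act (s : seq (V * W)) (u : V) : V := \sum_(c <- s) p u c.2 *: c.1.
Definition tensor_acts (s : seq (V * W)) (z : W) : W := - \sum_(c <- s) p c.1 z *: c.2.

Lemma tsum_comb a s1 s2 :
  tensor_sum ([seq (a *: c.1, c.2) | c <- s1] ++ s2) = a *: tensor_sum s1 + tensor_sum s2.
Proof.
rewrite /tensor_sum big_cat big_map scaler_sumr; congr (_ + _).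
by apply: eq_bigr => c _; rewrite linearZl_LR.
Qed.

Lemma tsum_ex : tensor_product tens -> forall a, exists s, a = tensor_sum s.
Proof.
move=> tP a; have : lspan [set z | exists v w, z = tens v w] a by rewrite tensor_span.
move: a; apply: (@lspan_min _ _ _ [set a | exists s, a = tensor_sum s]).
  split=> [|a _ _ [s ->] [s' ->]]; first by exists [::]; rewrite /tensor_sum big_nil.
  by exists ([seq (a *: c.1, c.2) | c <- s] ++ s'); rewrite tsum_comb.
by move=> _ [v [w ->]]; exists [:: (v, w)]; rewrite /tensor_sum big_seq1.
Qed.

(** Independent right factors let dual vectors read off the left ones. Zero left factors pad two
    such sums to a common length. *)
Lemma tsum_basis (f : nat -> W) : tensor_product tens -> lbasis f [set: W] ->
  forall a, exists n (v : nat -> V), a = tensor_sum [seq (v i, f i) | i <- iota 0 n].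
Proof.
move=> tP [_ fW] a.
pose A := [set a | exists n (v : nat -> V), a = \sum_(i <- iota 0 n) tens (v i) (f i)].
have pad n (v : nat -> V) m : (n <= m)%N -> exists v', 
    \sum_(i <- iota 0 n) tens (v i) (f i) = \sum_(i <- iota 0 m) tens (v' i) (f i).
  move=> nm; exists (fun i => if (i < n)%N then v i else 0).
  rewrite !iota0_index.
  rewrite [RHS](big_cat_nat _ nm) //= [X in _ = _ + X]big1_seq ?addr0.
    by apply: eq_big_nat => i /andP[_ ->].
  move=> i; rewrite /= mem_index_iota => /andP[ni _].
  by rewrite ltnNge ni /= linear0l.
have sA : subspace A.
  split=> [|c _ _ [n [v ->]] [m [w ->]]].
    by exists 0%N, (fun=> 0); rewrite big_nil.
  have [v' ->] := pad n v (maxn n m) (leq_maxl _ _).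
  have [w' ->] := pad m w (maxn n m) (leq_maxr _ _).
  exists (maxn n m), (fun i => c *: v' i + w' i).
  by rewrite scaler_sumr -big_split; apply: eq_bigr => i _; rewrite linearPl.
suff [n [v ->]] : A a by exists n, v; rewrite /tensor_sum big_map.
have : lspan [set z | exists v w, z = tens v w] a by rewrite tensor_span.
move: a; apply: lspan_min => // _ [v [w ->]].
have : lspan (range f) w by rewrite fW.
move: w; apply: (@lspan_min _ _ _ [set w | A (tens v w)]).
  by split=> [|c w w' Aw Aw']; rewrite /= ?linear0r ?linearPr; [apply: subspace0 | apply: sA.2].
move=> _ [k _ <-]; exists k.+1, (fun i => if i == k then v else 0).
rewrite iota0_index big_nat_recr //= eqxx big1_seq ?add0r // => i.
by rewrite /= mem_index_iota => /andP[_ ik]; rewrite ltn_eqF ?linear0l.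
Qed.

Definition nfree (vs : seq V) := forall c : nat -> F,
  \sum_(i < size vs) c i *: vs`_i = 0 -> forall i, (i < size vs)%N -> c i = 0.

(** A dependent left factor is removed by distributing its right factor over the others, so the
    remaining left factors are among the given ones and keep [P]. *)
Lemma tsum_nfree (P : set V) s : (forall c, c \in s -> P c.1) ->
  exists s', [/\ tensor_sum s' = tensor_sum s, forall c, c \in s' -> P c.1 & nfree (map fst s')].
Proof.
elim: s => [|x s IHs] sP; first by exists [::]; split=> // c _ i.
have [|s' [s's s'P frees']] := IHs; first by move=> c cs; apply: sP; rewrite inE cs orbT.
have [[d xd]|nd] := pselect (exists d : nat -> F, x.1 = \sum_(i < size s') d i *: (map fst s')`_i).
  pose s2 := [seq ((nth (0, 0) s' i).1, (nth (0, 0) s' i).2 + d i *: x.2) | i <- iota 0 (size s')].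
  have fs2 : map fst s2 = map fst s'.
    rewrite -map_comp -[RHS](mkseq_nth 0) size_map; apply/eq_in_map => i.
    by rewrite mem_iota => /andP[_ ilt] /=; rewrite (nth_map (0, 0)).
  exists s2; split; last by rewrite fs2.
  - rewrite /tensor_sum big_map big_cons xd linear_sumlz addrC.
    rewrite -/(tensor_sum s) -s's /tensor_sum [X in X + _](big_nth (0, 0)) big_mkord -big_split /=.
    rewrite iota0_index big_mkord; apply: eq_bigr => i _.
    by rewrite linearDr /= linearZl_LR linearZr_LR /= (nth_map (0, 0)).
  - move=> c /mapP[k]; rewrite mem_iota => /andP[_ ilt] -> /=.
    by apply: s'P; apply: mem_nth.
exists (x :: s'); split.
- by rewrite /tensor_sum !big_cons -/(tensor_sum s') s's.
- by move=> c; rewrite inE => /predU1P[->|/s'P//]; apply: sP; rewrite inE eqxx.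
move=> c; rewrite /= big_ord_recl /= size_map => cx.
have c0 : c 0%N = 0.
  apply/eqP; apply: contrapT => /negP c0; apply: nd.
  exists (fun i => - ((c 0%N)^-1 * c i.+1)).
  have /eqP := cx; rewrite addr_eq0 => /eqP /(congr1 (fun v => (c 0%N)^-1 *: v)).
  rewrite scalerA mulVf // scale1r => ->; rewrite scalerN scaler_sumr -sumrN.
  by apply: eq_bigr => i _; rewrite scalerA scaleNr.
case=> [//|i]; rewrite ltnS => ilt.
apply: (frees' (fun i => c i.+1)); last by rewrite size_map.
by move: cx; rewrite c0 scale0r add0r size_map.
Qed.

Lemma tsum_refine (A : set V) (B : set W) s : (forall a v, A v -> A (a *: v)) ->
  (forall c, c \in s -> lspan A c.1 /\ lspan B c.2) ->
  exists s', tensor_sum s' = tensor_sum s /\ forall c, c \in s' -> A c.1 /\ B c.2.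
Proof.
move=> AZ; pose Q a := exists s', tensor_sum s' = a /\ forall c, c \in s' -> A c.1 /\ B c.2.
have sQ : subspace Q.
  split=> [|a _ _ [s1 [<- P1]] [s2 [<- P2]]]; first by exists [::]; rewrite /tensor_sum big_nil.
  exists ([seq (a *: c.1, c.2) | c <- s1] ++ s2); rewrite tsum_comb; split=> // c.
  rewrite mem_cat => /orP[/mapP[d /P1[Ad Bd] ->]|/P2//].
  by split=> //; apply: AZ.
have Qt v w : lspan A v -> lspan B w -> Q (tens v w).
  move=> Av Bw; move: w Bw; apply: (@lspan_min _ _ _ [set w | Q (tens v w)]).
    split=> [|c u w]; rewrite /= ?linear0r ?linearPr; first exact: subspace0 sQ.
    exact: sQ.2.
  move=> w Bw; move: v Av; apply: (@lspan_min _ _ _ [set v | Q (tens v w)]).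
    split=> [|c u v]; rewrite /= ?linear0l ?linearPl; first exact: subspace0 sQ.
    exact: sQ.2.
  move=> v Av; exists [:: (v, w)]; rewrite /tensor_sum big_seq1; split=> // c.
  by rewrite inE => /eqP->.
move=> sP; suff : Q (tensor_sum s) by [].
by apply: (subspace_sum_seq sQ) => c /sP[? ?]; apply: Qt.
Qed.

End TensorSums.

Section Natural.
Variables (F : numClosedFieldType) (V W : lmodType F).
Variable p : {bilinear V -> W -> F | *%R & *%R}.
Variables (gl g : lieAlgType F) (tens : {bilinear V -> W -> gl}).
Variables (iota : gl -> g) (J : set g).
Variables (act : {bilinear g -> V -> V}) (acts : {bilinear g -> W -> W}).
Hypothesis (dimW : countably_infinite_dim W).
Hypotheses (pnd : nondegenerate p) (glP : is_gl p tens).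
Hypotheses (iotaP : sl_summand iota J) (actP : natural_modules p tens iota J act acts).

Local Notation tsum := (tensor_sum tens).
Local Notation ttrace := (tensor_trace p).
Local Notation tact := (tensor_act p).
Local Notation tacts := (tensor_acts p).

Definition slg : set g := iota @` sl_of gl.

Lemma nondeg_l v : v <> 0 -> exists w, p v w = 1.
Proof.
move=> v0; have [w pw] : exists w, p v w <> 0.
  by apply: contrapT => nex; apply: v0; apply: pnd.1 => w; apply: contrapT => pw; apply: nex; exists w.
by exists ((p v w)^-1 *: w); rewrite linearZr_LR /= mulVf //; apply/eqP.
Qed.

Lemma nondeg_r w : w <> 0 -> exists v, p v w = 1.
Proof.
move=> w0; have [v pv] : exists v, p v w <> 0.
  by apply: contrapT => nex; apply: w0; apply: pnd.2 => v; apply: contrapT => pv; apply: nex; exists v.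
by exists ((p v w)^-1 *: v); rewrite linearZl_LR /= mulVf //; apply/eqP.
Qed.

Lemma dual_pair : exists (u : 'I_2 -> V) (f : 'I_2 -> W), forall i j, p (u i) (f j) = (j == i)%:R.
Proof.
have [f [ff _]] := dimW.
have uP i := dual_vectors pnd.2 (@lfree_ord _ _ f 2 ff) i.
have [u uE] := choice uP.
by exists u, (fun i : 'I_2 => f i) => i j; rewrite uE.
Qed.

Lemma tens_mul v w v' w' :
  lie (tens v w) (tens v' w') = p v' w *: tens v w' - p v w' *: tens v' w.
Proof. by have [_ [mul [mulE lieE]]] := glP; rewrite lieE !mulE. Qed.

Lemma sl_tens v w v0 w0 : p v0 w0 = 1 -> sl_of gl (tens v w - p v w *: tens v0 w0).
Proof.
by move=> p1; rewrite -[tens v w]scale1r -p1 -tens_mul; apply: lieprod_mem.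
Qed.

Lemma sl_subspace : subspace (sl_of gl). Proof. exact: lspan_subspace. Qed.

Lemma trace_ex : exists tr : gl -> F, (forall a x y, tr (a *: x + y) = a * tr x + tr y) /\
  forall v w, tr (tens v w) = p v w.
Proof.
have [tP _] := glP; pose q v w : F^o := p v w.
have qP : bilinear_for *:%R *:%R q.
  by split=> [w a u v|v a u w]; rewrite /q ?linearPl ?linearPr.
pose q' : {bilinear V -> W -> F^o} :=
  HB.pack q (bilinear_isBilinear.Build F V W F^o *:%R *:%R q qP).
have [tr [trE _]] := tP F^o q'.
by exists tr; split=> // a x y; rewrite linearP.
Qed.

(** Traces of commutators vanish; conversely, a traceless sum is unchanged when each tensor is
    corrected by a multiple of one fixed tensor, and the corrected tensors are commutators by
    [sl_tens]. *)
Lemma sl_tsum s : sl_of gl (tsum s) <-> ttrace s = 0.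
Proof.
have [tP [mul [mulE lieE]]] := glP; have [tr [trL trE]] := trace_ex.
have tr0 : tr 0 = 0 by have := trL (-1) 0 0; rewrite scaler0 addr0 mulN1r addNr.
have trN x : tr (- x) = - tr x by rewrite -[- x]addr0 -scaleN1r trL tr0 addr0 mulN1r.
have trs s' : tr (tsum s') = ttrace s'.
  elim: s' => [|c s' IHs]; first by rewrite /tensor_sum /tensor_trace !big_nil.
  rewrite /tensor_sum /tensor_trace !big_cons -[tens _ _]scale1r trL mul1r trE.
  by congr (_ + _); apply: IHs.
have trmul x y : tr (mul x y) = tr (mul y x).
  have [s1 ->] := tsum_ex tP x; have [s2 ->] := tsum_ex tP y.
  elim: s1 => [|c s1 IH1]; first by rewrite /tensor_sum big_nil linear0l linear0r.
  have cons c' s' : tsum (c' :: s') = 1 *: tens c'.1 c'.2 + tsum s'.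
    by rewrite /tensor_sum big_cons scale1r.
  rewrite cons linearPl linearPr !trL IH1; congr (_ * _ + _).
  elim: s2 {IH1} => [|c' s2 IH2]; first by rewrite /tensor_sum big_nil linear0l linear0r.
  rewrite cons linearPl linearPr !trL IH2; congr (_ * _ + _).
  rewrite !mulE -[_ *: _]addr0 trL -[in RHS](addr0 (_ *: _)) trL tr0 !addr0 !trE.
  by rewrite mulrC.
split=> [sls|].
  rewrite -trs; move: (tsum s) sls; apply: (@lspan_min _ _ _ [set x | tr x = 0]).
    by split=> [//|a x y /= x0 y0]; rewrite trL x0 y0 mulr0 addr0.
  move=> _ [x [y [_ _ ->]]]; rewrite /= lieE -[mul x y]scale1r trL trN trmul mul1r.
  by rewrite subrr.
have [u [f uf]] := dual_pair; have p1 : p (u 0) (f 0) = 1 by rewrite uf.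
have -> : tsum s = \sum_(c <- s) (tens c.1 c.2 - p c.1 c.2 *: tens (u 0) (f 0)) +
    ttrace s *: tens (u 0) (f 0).
  by rewrite sumrB -scaler_suml subrK.
move=> ->; rewrite scale0r addr0; apply: subspace_sum; first exact: sl_subspace.
by move=> c _; apply: sl_tens.
Qed.

Lemma sl_nil v w : p v w = 0 -> sl_of gl (tens v w).
Proof.
move=> pvw; have : sl_of gl (tsum [:: (v, w)]).
  by apply/sl_tsum; rewrite /tensor_trace big_seq1.
by rewrite /tensor_sum big_seq1.
Qed.

Lemma sl_ex a : sl_of gl a -> exists2 s, a = tsum s & ttrace s = 0.
Proof.
move=> sla; have [s aE] := tsum_ex glP.1 a.
by exists s => //; apply/sl_tsum; rewrite -aE.
Qed.

(** Isotropic tensors lie in [sl_of gl] one by one, so [iota] can be applied to each of them. *)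
Lemma sl_span_nil : sl_of gl `<=` lspan [set z | exists v w, p v w = 0 /\ z = tens v w].
Proof.
set N := lspan _; have sN : subspace N := lspan_subspace _.
have Nt v w : p v w = 0 -> N (tens v w) by move=> pvw; apply: sub_lspan; exists v, w.
have [u [f uf]] := dual_pair; have p1 : p (u 0) (f 0) = 1 by rewrite uf.
set v0 := u 0 in p1 *; set w0 := f 0 in p1 *.
(* The tensor of [v + v0] and [w - c *: w0] is isotropic, and its expansion is the wanted difference
   up to isotropic mixed terms. *)
have N1 v w : p v w0 = 0 -> p v0 w = 0 -> N (tens v w - p v w *: tens v0 w0).
  move=> pv pw; set c := p v w.
  have -> : tens v w - c *: tens v0 w0 =
      tens (v + v0) (w - c *: w0) + c *: tens v w0 - tens v0 w.
    rewrite linearDl /= !linearBr /= !linearZr_LR /=.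
    have E (A B C D : gl) : A - B + (C - D) + B - C = A - D.
      by rewrite [A - B + _]addrC -[_ + B]addrA subrK addrAC [C - D]addrC addrK addrC.
    by rewrite E.
  apply: (subspaceB sN); [apply: (subspaceD sN); [|apply: (subspaceZ _ sN)] |]; apply: Nt => //.
  rewrite linearDl /= !linearBr /= !linearZr_LR /= pv pw p1.
  by rewrite mulr0 mulr1 subr0 sub0r subrr.
have N2 v w a b : p v w0 = 0 -> p v0 w = 0 ->
    N (tens (v + a *: v0) (w + b *: w0) - p (v + a *: v0) (w + b *: w0) *: tens v0 w0).
  move=> pv pw.
  have -> : tens (v + a *: v0) (w + b *: w0) - p (v + a *: v0) (w + b *: w0) *: tens v0 w0
      = (tens v w - p v w *: tens v0 w0) + (b *: tens v w0 + a *: tens v0 w).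
    rewrite !linearDl /= !linearDr /= !linearZl_LR /= !linearZr_LR /= pv pw p1.
    rewrite !mulr0 addr0 add0r mulr1 scalerDl opprD -scalerA.
    have E (A B C D P : gl) : A + B + (C + D) - P - D = A - P + (B + C).
      by rewrite addrAC addrA addrK -[A + B + C]addrA addrAC.
    by rewrite addrA E.
  apply: (subspaceD sN); first exact: N1.
  by apply: (subspaceD sN); apply: (subspaceZ _ sN); apply: Nt.
move=> a /sl_ex[s -> trs].
have -> : tsum s = \sum_(c <- s) (tens c.1 c.2 - p c.1 c.2 *: tens v0 w0).
  by rewrite sumrB -scaler_suml -/(tensor_trace p s) trs scale0r subr0.
apply: subspace_sum => // -[v w] _ /=.
have := N2 (v - p v w0 *: v0) (w - p v0 w *: w0) (p v w0) (p v0 w).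
rewrite !subrK; apply.
- by rewrite linearBl /= linearZl_LR /= p1 mulr1 subrr.
- by rewrite linearBr /= linearZr_LR /= p1 mulr1 subrr.
Qed.

Let iota_lin := iotaP.1.

Lemma iotaD a x y : sl_of gl x -> sl_of gl y -> iota (a *: x + y) = a *: iota x + iota y.
Proof. by case: iota_lin => H _ _; apply: H. Qed.

Lemma iota0 : iota 0 = 0.
Proof.
have s0 := subspace0 sl_subspace; have := iotaD (-1) s0 s0.
by rewrite scaler0 addr0 scaleN1r addNr.
Qed.

Lemma slg_subspace : subspace slg.
Proof.
split=> [|a _ _ [x sx <-] [y sy <-]]; first by exists 0; [exact: subspace0 sl_subspace | exact: iota0].
by exists (a *: x + y); [exact: sl_subspace.2 | rewrite iotaD].
Qed.

Lemma slg_ex x : slg x -> exists2 s, x = iota (tsum s) & ttrace s = 0.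
Proof. by move=> [a /sl_ex[s -> trs] <-]; exists s. Qed.

Lemma slg_tsum s : ttrace s = 0 -> slg (iota (tsum s)).
Proof. by move=> trs; exists (tsum s) => //; apply/sl_tsum. Qed.

Lemma act_tsum s : ttrace s = 0 ->
  (forall u, act (iota (tsum s)) u = tact s u) /\ (forall z, acts (iota (tsum s)) z = tacts s z).
Proof.
move=> trs; have [_ nat _ _] := actP.
have sE : tsum s = \sum_(i < size s) tens (nth (0, 0) s i).1 (nth (0, 0) s i).2.
  by rewrite /tensor_sum (big_nth (0, 0)) big_mkord.
have [|nV nW] := nat (size s) (fun i => (nth (0, 0) s i).1) (fun i => (nth (0, 0) s i).2).
  by rewrite -sE; apply/sl_tsum.
split=> [u|z]; rewrite sE ?nV ?nW /tensor_act /tensor_acts (big_nth (0, 0)) big_mkord //.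
Qed.

Let invariant x v w : p (act x v) w = - p v (acts x w).
Proof. by have [_ _ _ inv] := actP; apply/eqP; rewrite -addr_eq0 inv. Qed.

Let actL x y m : act (lie x y) m = act x (act y m) - act y (act x m).
Proof. by have [[H _] _ _ _] := actP; apply: H. Qed.

Let actsL x y m : acts (lie x y) m = acts x (acts y m) - acts y (acts x m).
Proof. by have [[_ H] _ _ _] := actP; apply: H. Qed.

(** Write [y] with independent right factors; a vector dual to the [j]-th one is sent to the [j]-th
    left factor. *)
Lemma slg_faithful y : slg y -> (forall u, act y u = 0) -> y = 0.
Proof.
move=> [a sla <-] a0; have [f fB] := dimW; have [n [v aE]] := tsum_basis glP.1 fB a.
rewrite aE in sla a0 *; have trs := (sl_tsum _).1 sla.
have vj (j : 'I_n) : v j = 0.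
  have [u uP] := dual_vectors pnd.2 (lfree_ord fB.1) j.
  have := a0 u; rewrite (act_tsum trs).1 /tensor_act big_map iota0_index big_mkord.
  rewrite (bigD1 j) //= uP eqxx scale1r big1 ?addr0 // => i ij.
  by rewrite uP (negPf ij) scale0r.
rewrite /tensor_sum big_map iota0_index big_mkord big1 ?iota0 // => i _.
by rewrite /= vj linear0l.
Qed.

Lemma slg_comm x y : slg (lie x y) -> (forall u, act x (act y u) = act y (act x u)) -> lie x y = 0.
Proof. by move=> sl xy; apply: slg_faithful => // u; rewrite actL xy subrr. Qed.

(** As in an [sl2] triple, a nonzero isotropic [tens v w] is an eigenvector of value [2] of
    [tens v w' - tens v' w], hence a multiple of a bracket. *)
Lemma slg_perfect : slg `<=` lieprod slg slg.
Proof.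
suff H : sl_of gl `<=` sl_of gl `&` [set a | lieprod slg slg (iota a)].
  by move=> _ [a sa <-]; case: (H _ sa).
have sP : subspace (lieprod slg slg) := lspan_subspace _.
move=> a /sl_span_nil; move: a; apply: lspan_min.
  split=> [|a x y [sx Px] [sy Py]].
    by split; [exact: subspace0 sl_subspace | rewrite /= iota0; exact: subspace0 sP].
  by split; [exact: sl_subspace.2 | rewrite /= iotaD //; exact: sP.2].
move=> _ [v [w [pvw ->]]]; have sn := sl_nil pvw; split=> //=.
have [->|v0] := pselect (v = 0); first by rewrite linear0l iota0; exact: subspace0 sP.
have [->|w0] := pselect (w = 0); first by rewrite linear0r iota0; exact: subspace0 sP.
have [w' pw'] := nondeg_l v0; have [v' pv'] := nondeg_r w0.
pose h := tens v w' - tens v' w.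
have sh : sl_of gl h.
  have : sl_of gl (tsum [:: (v, w'); (- v', w)]).
    by apply/sl_tsum; rewrite /tensor_trace big_cons big_seq1 /= linearNl /= pw' pv' subrr.
  by rewrite /tensor_sum big_cons big_seq1 /= linearNl.
have hn : lie h (tens v w) = 2%:R *: tens v w.
  rewrite /h linearBl /= !tens_mul pvw pw' pv' !scale0r !scale1r subr0 sub0r opprK.
  by rewrite -mulr2n scaler_nat.
have -> : iota (tens v w) = 2%:R^-1 *: lie (iota h) (iota (tens v w)).
  have [_ brk _] := iota_lin; rewrite -brk // hn -[2%:R *: _]addr0 iotaD //; last exact: subspace0 sl_subspace.
  by rewrite iota0 addr0 scalerA mulVf ?scale1r // pnatr_eq0.
by apply: (subspaceZ _ sP); apply: lieprod_mem; [exists h | exists (tens v w)].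
Qed.

(** [slg] is given as an ideal of [[g, g]] only. It is perfect, and the Jacobi identity rewrites
    [[x, [y, z]]] through [[x, y]] and [[x, z]], which lie in [[g, g]]. *)
Lemma slg_ideal x y : slg y -> slg (lie x y).
Proof.
have [_ [[_ slD Dsl] _ _ _]] := iotaP.
have D z w : lieprod [set: g] [set: g] (lie z w) by apply: lieprod_mem.
move=> /slg_perfect; move: y; apply: (@lspan_min _ _ _ [set y | slg (lie x y)]).
  split=> [|a y z sy sz]; rewrite /= ?linear0r ?linearPr; first exact: subspace0 slg_subspace.
  exact: slg_subspace.2.
move=> _ [y [z [sy sz ->]]]; rewrite /= lieJ; apply: (subspaceD slg_subspace).
  by apply: Dsl.
by rewrite lieC; apply: (subspaceN slg_subspace); apply: Dsl.
Qed.

Lemma slg_fdim y : slg y -> fdim (range (act y)) /\ fdim (range (acts y)).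
Proof.
move=> /slg_ex[s -> trs]; split.
- apply: (@fdim_sub _ _ (lspan [set` map fst s])).
  + by apply: findim_fdim; exists (map fst s).
  + split=> [|a _ _ [u _ <-] [v _ <-]]; first by exists 0; rewrite ?linear0.
    by exists (a *: u + v); rewrite ?linearP.
  + move=> _ [u _ <-]; rewrite (act_tsum trs).1; apply: subspace_sum_seq.
      exact: lspan_subspace.
    move=> c cs; apply: (subspaceZ _ (lspan_subspace _)); apply: sub_lspan.
    by apply/mapP; exists c.
- apply: (@fdim_sub _ _ (lspan [set` map snd s])).
  + by apply: findim_fdim; exists (map snd s).
  + split=> [|a _ _ [u _ <-] [v _ <-]]; first by exists 0; rewrite ?linear0.
    by exists (a *: u + v); rewrite ?linearP.
  + move=> _ [u _ <-]; rewrite (act_tsum trs).2; apply: (subspaceN (lspan_subspace _)).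
    apply: subspace_sum_seq; first exact: lspan_subspace.
    move=> c cs; apply: (subspaceZ _ (lspan_subspace _)); apply: sub_lspan.
    by apply/mapP; exists c.
Qed.

(* The span [E] of the eigenvectors of [x] is stable under [slg], which is spanned
   by eigenvectors of [ad x]; and the image of such an eigenvector is a
   finite-dimensional [x]-stable subspace, so that [E] is not zero. *)
Lemma eigenspan_stable (M : lmodType F) (a : {bilinear g -> M -> M}) x y v :
  (forall x y m, a (lie x y) m = a x (a y m) - a y (a x m)) ->
  diag_on (ad x) [set: g] ->
  lspan (eigs (a x) setT) v -> lspan (eigs (a x) setT) (a y v).
Proof.
move=> aL dx; have sE : subspace (lspan (eigs (a x) setT)) := lspan_subspace _.
move: v; apply: (@lspan_min _ _ _ [set v | lspan (eigs (a x) setT) (a y v)]).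
  split=> [|c u v]; rewrite /= ?linear0r ?linearPr; first exact: subspace0 sE.
  exact: sE.2.
move=> v [_ [c xv]] /=; move: y (dx y I).
apply: (@lspan_min _ _ _ [set y | lspan (eigs (a x) setT) (a y v)]).
  split=> [|d y z]; rewrite /= ?linear0l ?linearPl; first exact: subspace0 sE.
  exact: sE.2.
move=> y [_ [d xy]] /=; apply: sub_lspan; split=> //; exists (d + c) => /=.
have -> : a x (a y v) = a (lie x y) v + a y (a x v) by rewrite aL subrK.
by rewrite -/(ad x y) xy xv linearZl_LR linearZr_LR /= scalerDl.
Qed.

Lemma eigenspan_nonzero (M : lmodType F) (a : {bilinear g -> M -> M}) x :
  (forall x y m, a (lie x y) m = a x (a y m) - a y (a x m)) ->
  (forall y, slg y -> fdim (range (a y))) -> (exists y u, slg y /\ a y u <> 0) ->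
  diag_on (ad x) [set: g] -> exists e, e <> 0 /\ lspan (eigs (a x) setT) e.
Proof.
move=> aL fa [y0 [u0 [sy0 yu0]]] dx.
have dxs : diag_on (ad x) slg.
  by apply: (diag_sub dx) => // [|v]; [exact: slg_subspace | apply: slg_ideal].
have [y [c [u [sy xy yu]]]] : exists y c u, [/\ slg y, ad x y = c *: y & a y u <> 0].
  apply: contrapT => nex; apply: yu0; move: (dxs _ sy0) => {sy0}; move: y0.
  apply: (@lspan_min _ _ _ [set y | a y u0 = 0]).
    by split=> [|d y z]; rewrite /= ?linear0l ?linearPl // => -> ->; rewrite scaler0 addr0.
  move=> y [sy [c xy]] /=; apply: contrapT => yu.
  by apply: nex; exists y, c, u0.
have [|||e [d [_ e0 xe]]] := @exists_eig _ _ (a x) (range (a y)) (a y u) (fa _ sy).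
- move=> _ [v _ <-]; exists (a x v + c *: v) => //=.
  rewrite linearDr /= linearZr_LR /=.
  have /eqP := aL x y v; rewrite -/(ad x y) xy linearZl_LR /= eq_sym subr_eq => /eqP->.
  by rewrite addrC.
- by exists u.
- exact: yu.
by exists e; split=> //; apply: sub_lspan; split=> //; exists d.
Qed.

(** An isotropic tensor of [v] and [w] carries [e] to [v] when [w] vanishes on [v] but not on [e];
    only proportional vectors admit no such [w]. *)
Lemma separate_l v e : v <> 0 -> e <> 0 ->
  (exists w, p v w = 0 /\ p e w = 1) \/ exists c, v = c *: e.
Proof.
move=> v0 e0; have [w1 vw1] := nondeg_l v0.
have [[w ew]|nex] := pselect (exists w, p e (w - p v w *: w1) <> 0).
  left; set z := w - _ in ew; exists ((p e z)^-1 *: z).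
  have vz : p v z = 0 by rewrite /z linearBr /= linearZr_LR /= vw1 mulr1 subrr.
  by rewrite !linearZr_LR /= vz mulr0 mulVf //; apply/eqP.
right; have eE : e = p e w1 *: v.
  apply/eqP; rewrite -subr_eq0; apply/eqP/pnd.1 => w.
  have : p e (w - p v w *: w1) = 0 by apply: contrapT => ew; apply: nex; exists w.
  by rewrite linearBr linearBl /= linearZr_LR linearZl_LR /= mulrC.
have c0 : p e w1 != 0 by apply: contra_not_neq e0 => c0; rewrite eE c0 scale0r.
by exists (p e w1)^-1; rewrite {2}eE scalerA mulVf // scale1r.
Qed.

Lemma separate_r w e : w <> 0 -> e <> 0 ->
  (exists v, p v w = 0 /\ p v e = 1) \/ exists c, w = c *: e.
Proof.
move=> w0 e0; have [v1 vw1] := nondeg_r w0.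
have [[v ew]|nex] := pselect (exists v, p (v - p v w *: v1) e <> 0).
  left; set z := v - _ in ew; exists ((p z e)^-1 *: z).
  have vz : p z w = 0 by rewrite /z linearBl /= linearZl_LR /= vw1 mulr1 subrr.
  by rewrite !linearZl_LR /= vz mulr0 mulVf //; apply/eqP.
right; have eE : e = p v1 e *: w.
  apply/eqP; rewrite -subr_eq0; apply/eqP/pnd.2 => v.
  have : p (v - p v w *: v1) e = 0 by apply: contrapT => ew; apply: nex; exists v.
  by rewrite linearBl linearBr /= linearZr_LR linearZl_LR /= mulrC.
have c0 : p v1 e != 0 by apply: contra_not_neq e0 => c0; rewrite eE c0 scale0r.
by exists (p v1 e)^-1; rewrite {2}eE scalerA mulVf // scale1r.
Qed.

Lemma act_nil v w u : p v w = 0 -> act (iota (tens v w)) u = p u w *: v.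
Proof.
move=> pvw; have trs : ttrace [:: (v, w)] = 0 by rewrite /tensor_trace big_seq1.
by have := (act_tsum trs).1 u; rewrite /tensor_sum /tensor_act !big_seq1.
Qed.

Lemma acts_nil v w z : p v w = 0 -> acts (iota (tens v w)) z = - (p v z *: w).
Proof.
move=> pvw; have trs : ttrace [:: (v, w)] = 0 by rewrite /tensor_trace big_seq1.
by have := (act_tsum trs).2 z; rewrite /tensor_sum /tensor_acts !big_seq1.
Qed.

Lemma slg_nil v w : p v w = 0 -> slg (iota (tens v w)).
Proof. by move=> pvw; exists (tens v w) => //; apply: sl_nil. Qed.

Theorem diag_act x : diag_on (ad x) [set: g] ->
  diag_on (act x) [set: V] /\ diag_on (acts x) [set: W].
Proof.
move=> dx; have [u [f uf]] := dual_pair.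
have p01 : p (u 0) (f 1) = 0 by rewrite uf.
have [u1 f0] : u 1 <> 0 /\ f 0 <> 0.
  by split=> E; [have := uf 1 1 | have := uf 0 0]; rewrite E ?linear0l ?linear0r eqxx;
    move=> /esym/eqP; rewrite oner_eq0.
have [u0 f1] : u 0 <> 0 /\ f 1 <> 0.
  by split=> E; [have := uf 0 0 | have := uf 1 1]; rewrite E ?linear0l ?linear0r eqxx;
    move=> /esym/eqP; rewrite oner_eq0.
split=> v _.
- have sE : subspace (lspan (eigs (act x) setT)) := lspan_subspace _.
  have [v0|v0] := pselect (v = 0); first by rewrite v0; exact: subspace0 sE.
  have [||e [e0 Ee]] := @eigenspan_nonzero V act x actL _ _ dx.
  + by move=> y /slg_fdim[].
  + exists (iota (tens (u 0) (f 1))), (u 1); rewrite act_nil // uf eqxx scale1r.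
    by split=> //; apply: slg_nil.
  have [[w [vw ew]]|[c ->]] := separate_l v0 e0; last exact: (subspaceZ _ sE).
  by have := eigenspan_stable (iota (tens v w)) actL dx Ee; rewrite act_nil // ew scale1r.
- have sE : subspace (lspan (eigs (acts x) setT)) := lspan_subspace _.
  have [v0|v0] := pselect (v = 0); first by rewrite v0; exact: subspace0 sE.
  have [||e [e0 Ee]] := @eigenspan_nonzero W acts x actsL _ _ dx.
  + by move=> y /slg_fdim[].
  + exists (iota (tens (u 0) (f 1))), (f 0); rewrite acts_nil // uf eqxx scale1r.
    split; first exact: slg_nil.
    by move=> /eqP; rewrite oppr_eq0 => /eqP.
  have [[w [vw ew]]|[c ->]] := separate_r v0 e0; last exact: (subspaceZ _ sE).
  have := eigenspan_stable (iota (tens w v)) actsL dx Ee; rewrite acts_nil // ew scale1r.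
  by move=> /(subspaceN sE); rewrite opprK.
Qed.

Lemma lie_tens x v w a b : p v w = 0 -> act x v = a *: v -> acts x w = b *: w ->
  lie x (iota (tens v w)) = (a + b) *: iota (tens v w).
Proof.
move=> pvw xv xw; have sn := slg_nil pvw; apply/eqP; rewrite -subr_eq0; apply/eqP.
apply: slg_faithful => [|u].
  apply: (subspaceB slg_subspace); first exact: slg_ideal.
  exact: (subspaceZ _ slg_subspace).
rewrite linearBl /= linearZl_LR /= actL !act_nil // linearZr_LR /= xv invariant xw.
by rewrite linearZr_LR /= scaleNr opprK !scalerA mulrDl scalerDl [p u w * a]mulrC subrr.
Qed.

Lemma lie_tsum0 x s : ttrace s = 0 ->
  (forall c, c \in s -> exists a, act x c.1 = a *: c.1 /\ acts x c.2 = - a *: c.2) ->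
  lie x (iota (tsum s)) = 0.
Proof.
move=> trs sP; apply: slg_comm => [|u]; first exact/slg_ideal/slg_tsum.
rewrite !(act_tsum trs).1 /tensor_act linear_sumr; apply: eq_big_seq => c /sP[a [x1 x2]].
by rewrite linearZr_LR /= x1 invariant x2 linearZr_LR /= mulNr opprK scalerA mulrC.
Qed.

(** Split into tensors of eigenvectors. A non-isotropic one has opposite eigenvalues by invariance;
    the sum of all tensors with opposite eigenvalues is traceless and commutes with [y], and the
    others are isotropic, hence eigenvectors one by one. *)
Lemma act_diag_slg y : diag_on (act y) [set: V] -> diag_on (acts y) [set: W] ->
  diag_on (ad y) slg.
Proof.
move=> d1 d2 _ /slg_ex[s0 -> tr0]; set E := lspan _; have sE : subspace E := lspan_subspace _.
pose A := [set v | exists a, act y v = a *: v]; pose B := [set w | exists b, acts y w = b *: w].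
have [||s [ss0 sAB]] := @tsum_refine _ _ _ _ tens A B s0.
- by move=> a v [b yv]; exists (b); rewrite linearZr_LR /= yv !scalerA mulrC.
- move=> c _; split; [have := d1 c.1 I | have := d2 c.2 I]; apply: lspan_le => v;
    by move=> [_ [a va]]; exists a.
rewrite -ss0.
have {}tr0 : ttrace s = 0 by apply/sl_tsum; rewrite ss0; apply/sl_tsum.
pose P (c : V * W) := `[< exists a, act y c.1 = a *: c.1 /\ acts y c.2 = - a *: c.2 >].
have nP c : c \in s -> ~~ P c -> p c.1 c.2 = 0.
  move=> /sAB[[a ya] [b yb]]; apply: contraNeq => pc; apply/asboolP; exists a; split=> //.
  have := invariant y c.1 c.2; rewrite ya yb linearZl_LR linearZr_LR /= -mulNr => /(mulIf pc) ->.
  by rewrite opprK.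
have trn s' : {subset s' <= s} -> ttrace [seq c <- s' | ~~ P c] = 0.
  move=> ss'; rewrite /tensor_trace big_filter big_seq_cond big1 // => c /andP[cs Pc].
  by apply: nP => //; apply: ss'.
have trP : ttrace [seq c <- s | P c] = 0.
  have := trn s (fun _ => id); move: tr0; rewrite /tensor_trace (bigID P) /= !big_filter.
  by move=> /[swap] ->; rewrite addr0.
have -> : tsum s = 1 *: tsum [seq c <- s | P c] + tsum [seq c <- s | ~~ P c].
  by rewrite scale1r /tensor_sum (bigID P) /= !big_filter.
rewrite iotaD; try by apply/sl_tsum; rewrite // trn.
rewrite scale1r; apply: (subspaceD sE).
  apply: sub_lspan; split; first exact: slg_tsum.
  exists 0; rewrite scale0r; apply: lie_tsum0 => // c.
  by rewrite mem_filter => /andP[/asboolP].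
have : {subset s <= s} by [].
elim: {-2}s => [|c s' IHs] sub.
  by rewrite /tensor_sum big_nil iota0; exact: subspace0 sE.
have sub' : {subset s' <= s} by move=> d ds; apply: sub; rewrite inE ds orbT.
rewrite /=; case: ifP => [Pc|_]; last exact: IHs.
have cs : c \in s by apply: sub; rewrite inE eqxx.
have pc := nP c cs Pc.
rewrite /tensor_sum big_cons -[tens c.1 c.2]scale1r iotaD; first last.
- by apply/sl_tsum; apply: trn.
- exact: sl_nil.
rewrite scale1r; apply: (subspaceD sE); last exact: IHs.
have [[a ya] [b yb]] := sAB c cs.
apply: sub_lspan; split; first exact: slg_nil.
by exists (a + b); apply: lie_tens.
Qed.

(* [z] is corrected by eigenvectors so that [y, z] commutes with [y]; as [y] acts
   diagonalizably on [V], this forces [y, z] to act by zero. *)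
Theorem act_diag y : slg y -> diag_on (act y) [set: V] -> diag_on (acts y) [set: W] ->
  diag_on (ad y) [set: g].
Proof.
move=> sy d1 d2 z _; have dy := act_diag_slg d1 d2.
set E := lspan _; have sE : subspace E := lspan_subspace _.
have syz : slg (ad y z) by rewrite /ad lieC; apply: (subspaceN slg_subspace); apply: slg_ideal.
have [s [u [us yz uP]]] := diag_eig_dec dy syz slg_subspace (fun v => @slg_ideal y v).
pose z' := z - \sum_(c <- s | c != 0) c^-1 *: u c.
have Esum : E (\sum_(c <- s | c != 0) c^-1 *: u c).
  rewrite big_seq_cond; apply: subspace_sum => // c /andP[cs _].
  apply: (subspaceZ _ sE); apply: sub_lspan; split=> //; exists c.
  by have [_ ->] := uP c cs.
have yS : ad y (\sum_(c <- s | c != 0) c^-1 *: u c) = \sum_(c <- s | c != 0) u c.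
  rewrite linear_sum big_seq_cond [RHS]big_seq_cond; apply: eq_bigr => c /andP[cs c0].
  by rewrite linearZ /=; have [_ ->] := uP c cs; rewrite scalerA mulVf // scale1r.
have yz' : ad y z' = \sum_(c <- s | c == 0) u c.
  by rewrite /z' linearB /= yS yz (bigID (pred1 0)) /= addrK.
have yyz' : ad y (ad y z') = 0.
  rewrite yz' big_seq_cond linear_sum big1 // => c /andP[cs /eqP c0].
  by have [_ ->] := uP c cs; rewrite c0 scale0r.
have yz0 : ad y z' = 0.
  apply: slg_faithful.
    by rewrite yz' big_seq_cond; apply: subspace_sum; [exact: slg_subspace|move=> c /andP[/uP[]]].
  move=> v; have := d1 v I; move: v; apply: (@lspan_min _ _ _ [set v | act (ad y z') v = 0]).
    by split=> [|a v w]; rewrite /= ?linear0r ?linearPr // => -> ->; rewrite scaler0 addr0.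
  move=> v [_ [c yv]] /=.
  have E1 : act (ad y z') v = act y (act z' v) - c *: act z' v.
    by rewrite /ad actL yv linearZr_LR.
  have g2 : geig (act y) c 2 (act z' v).
    rewrite /geig /= -E1; have := actL y (ad y z') v.
    by rewrite -/(ad y (ad y z')) yyz' linear0l yv linearZr_LR.
  by rewrite E1 (diag_geig d1 I g2) subrr.
have -> : z = z' + \sum_(c <- s | c != 0) c^-1 *: u c by rewrite subrK.
apply: (subspaceD sE) => //; apply: sub_lspan; split=> //.
by exists 0; rewrite scale0r.
Qed.

Lemma tact_family (T : eqType) (r : seq T) (vv : T -> V) (ww : T -> W) (k : T -> F) i :
  uniq r -> i \in r -> (forall i j, i \in r -> j \in r -> p (vv i) (ww j) = (i == j)%:R) ->
  tact [seq (k i *: vv i, ww i) | i <- r] (vv i) = k i *: vv i /\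
  tacts [seq (k i *: vv i, ww i) | i <- r] (ww i) = - k i *: ww i.
Proof.
move=> ur ir vw; rewrite /tensor_act /tensor_acts !big_map.
rewrite (bigD1_seq i) // [X in _ /\ - X = _](bigD1_seq i) //= !vw // eqxx scale1r.
rewrite linearZl_LR /= vw // eqxx mulr1 !big1_seq ?addr0 ?scaleNr //.
- by move=> j /andP[ij jr]; rewrite linearZl_LR /= vw // (negPf ij) mulr0 scale0r.
- by move=> j /andP[ij jr]; rewrite vw // eq_sym (negPf ij) scale0r.
Qed.

(** By [act_diag] only [V] and [W] matter. There the given vectors are eigenvectors, and a vector
    minus its projection onto their span is killed. *)
Theorem diag_family (T : eqType) (r : seq T) (vv : T -> V) (ww : T -> W) (k : T -> F) :
  uniq r -> (forall i j, i \in r -> j \in r -> p (vv i) (ww j) = (i == j)%:R) ->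
  ttrace [seq (k i *: vv i, ww i) | i <- r] = 0 ->
  diag_on (ad (iota (tsum [seq (k i *: vv i, ww i) | i <- r]))) [set: g].
Proof.
move=> ur vw trs; set s := map _ r in trs *; set y := iota _.
have [aV aW] := act_tsum trs; rewrite -/y in aV aW.
apply: act_diag; first exact: slg_tsum.
- move=> u _; set E := lspan _; have sE : subspace E := lspan_subspace _.
  have EV i : i \in r -> E (vv i).
    move=> ir; apply: sub_lspan; split=> //; exists (k i).
    by rewrite /= aV; case: (tact_family k ur ir vw).
  have Es : E (\sum_(i <- r) p u (ww i) *: vv i).
    by apply: (subspace_sum_seq sE) => i ir; apply: (subspaceZ _ sE); apply: EV.
  rewrite -[u](subrK (\sum_(i <- r) p u (ww i) *: vv i)); apply: (subspaceD sE) => //.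
  apply: sub_lspan; split=> //; exists 0.
  rewrite scale0r linearB /= linear_sumr /= [X in X - _]aV /tensor_act big_map -sumrB big1_seq //.
  move=> i /= ir; rewrite linearZr_LR /= aV; have [-> _] := tact_family k ur ir vw.
  by rewrite !scalerA mulrC subrr.
- move=> z _; set E := lspan _; have sE : subspace E := lspan_subspace _.
  have EW i : i \in r -> E (ww i).
    move=> ir; apply: sub_lspan; split=> //; exists (- k i).
    by rewrite /= aW; case: (tact_family k ur ir vw).
  have Es : E (\sum_(i <- r) p (vv i) z *: ww i).
    by apply: (subspace_sum_seq sE) => i ir; apply: (subspaceZ _ sE); apply: EW.
  rewrite -[z](subrK (\sum_(i <- r) p (vv i) z *: ww i)); apply: (subspaceD sE) => //.
  apply: sub_lspan; split=> //; exists 0.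
  rewrite scale0r linearB /= linear_sumr /= [X in X - _]aW /tensor_acts big_map -sumrN -sumrB big1_seq //.
  move=> i /= ir; rewrite linearZr_LR /= aW; have [_ ->] := tact_family k ur ir vw.
  by rewrite linearZl_LR /= scalerA mulrN scaleNr opprK mulrC addNr.
Qed.

(** The element [v (x) w - v' (x) w']: for dual pairs it is [diag(1, -1)] on the span of [v] and
    [v'], and zero on the vectors orthogonal to [w] and [w']. *)
Definition two_pairs v w v' w' := iota (tsum [:: (v, w); (- v', w')]).

Lemma two_pairsP v w v' w' : p v w = 1 -> p v' w' = 1 -> p v w' = 0 -> p v' w = 0 ->
  [/\ slg (two_pairs v w v' w'), diag_on (ad (two_pairs v w v' w')) [set: g],
    forall u, act (two_pairs v w v' w') u = p u w *: v - p u w' *: v' &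
    forall z, acts (two_pairs v w v' w') z = p v' z *: w' - p v z *: w].
Proof.
move=> p1 p2 p3 p4; have trs : ttrace [:: (v, w); (- v', w')] = 0.
  by rewrite /tensor_trace big_cons big_seq1 /= linearNl /= p1 p2 subrr.
have [aV aW] := act_tsum trs; split.
- exact: slg_tsum.
- pose vv (b : bool) := if b then v else v'; pose ww (b : bool) := if b then w else w'.
  pose k (b : bool) : F := if b then 1 else -1.
  have sE : [:: (v, w); (- v', w')] = [seq (k i *: vv i, ww i) | i <- [:: true; false]].
    by rewrite /= scale1r scaleN1r.
  rewrite /two_pairs sE; apply: diag_family => //; last by rewrite -sE.
  by move=> [] [] _ _.
- by move=> u; rewrite aV /tensor_act big_cons big_seq1 /= scalerN.
- move=> z; rewrite aW /tensor_acts big_cons big_seq1 /= linearNl /= scaleNr.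
  by rewrite opprD opprK addrC.
Qed.

Lemma has_dim1P (U : lmodType F) (A : set U) :
  has_dim A 1 <-> exists2 v, v <> 0 & A = [set u | exists c, u = c *: v].
Proof.
split=> [[e [fe <-]]|[v v0 ->]].
  exists (e 0).
    move=> e0; have := fe [:: 0] (fun=> 1) isT; rewrite big_seq1 e0 scaler0.
    by move=> /(_ erefl 0 (mem_head _ _))/eqP; rewrite oner_eq0.
  apply/seteqP; split=> [|_ [c ->]]; last first.
    by apply: (subspaceZ _ (lspan_subspace _)); apply: sub_lspan; exists 0.
  apply: lspan_min => [|_ [j _ <-]]; last by exists 1; rewrite scale1r [j]ord1.
  split=> [|a _ _ [c ->] [d ->]]; first by exists 0; rewrite scale0r.
  by exists (a * c + d); rewrite scalerDl scalerA.
exists (fun=> v); split.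
  move=> s c us sv j js; have sE : s = [:: j].
    case: s us js {sv} => [//|k [|l s]] us js; first by rewrite [k]ord1 [j]ord1.
    by move: us; rewrite /= [k]ord1 [l]ord1 inE eqxx.
  move: sv; rewrite sE big_seq1 => /eqP; rewrite scaler_eq0 => /orP[/eqP//|/eqP].
  by move=> /v0.
apply/seteqP; split=> [|_ [c ->]]; last first.
  by apply: (subspaceZ _ (lspan_subspace _)); apply: sub_lspan; exists 0.
apply: lspan_min => [|_ [j _ <-]]; last by exists 1; rewrite scale1r.
split=> [|a _ _ [c ->] [d ->]]; first by exists 0; rewrite scale0r.
by exists (a * c + d); rewrite scalerDl scalerA.
Qed.

Lemma tensor_sub_ex (A : set V) (B : set W) a : (forall c v, A v -> A (c *: v)) ->
  tensor_sub tens A B a -> exists s, a = tsum s /\ forall c, c \in s -> A c.1 /\ B c.2.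
Proof.
move=> AZ; move: a; apply: (@lspan_min _ _ _
    [set a | exists s, a = tsum s /\ forall c, c \in s -> A c.1 /\ B c.2]).
  split=> [|a _ _ [s1 [-> P1]] [s2 [-> P2]]]; first by exists [::]; rewrite /tensor_sum big_nil.
  exists ([seq (a *: c.1, c.2) | c <- s1] ++ s2); rewrite tsum_comb; split=> // c.
  rewrite mem_cat => /orP[/mapP[d /P1[Ad Bd] ->]|/P2//].
  by split=> //; apply: AZ.
move=> _ [v [w [Av Bw ->]]]; exists [:: (v, w)]; rewrite /tensor_sum big_seq1; split=> // c.
by rewrite inE => /eqP->.
Qed.

Lemma sum_pad (T : eqType) (r r1 : seq T) (U : lmodType F) (k : T -> F) (f : T -> U) :
  uniq r -> uniq r1 -> {subset r1 <= r} ->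
  \sum_(i <- r) (if i \in r1 then k i else 0) *: f i = \sum_(i <- r1) k i *: f i.
Proof.
move=> ur ur1 r1r; rewrite (eq_bigr (fun i => if i \in r1 then k i *: f i else 0)).
  rewrite -big_mkcond -big_filter; apply: perm_big; apply: uniq_perm => //.
    exact: filter_uniq.
  by move=> i; rewrite mem_filter andb_idr //; apply: r1r.
by move=> i _; case: ifP; rewrite ?scale0r.
Qed.

Lemma lines_span (T : eqType) (X : set T) (A : T -> set V) (B : T -> set W)
    (vv : T -> V) (ww : T -> W) a :
  (forall i, X i -> A i = [set u | exists c, u = c *: vv i]) ->
  (forall i, X i -> B i = [set u | exists c, u = c *: ww i]) ->
  lspan (\bigcup_(i in X) tensor_sub tens (A i) (B i)) a ->
  exists r k, [/\ uniq r, forall i, i \in r -> X i & a = tsum [seq (k i *: vv i, ww i) | i <- r]].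
Proof.
move=> AE BE; pose Q a := exists (r : seq T) (k : T -> F), [/\ uniq r, forall i, i \in r -> X i &
  a = \sum_(i <- r) k i *: tens (vv i) (ww i)].
have sQ : subspace Q.
  split=> [|c _ _ [r1 [k1 [u1 X1 ->]]] [r2 [k2 [u2 X2 ->]]]].
    by exists [::], (fun=> 0); rewrite big_nil.
  have ur := undup_uniq (r1 ++ r2).
  have sub1 : {subset r1 <= undup (r1 ++ r2)} by move=> j jr; rewrite mem_undup mem_cat jr.
  have sub2 : {subset r2 <= undup (r1 ++ r2)} by move=> j jr; rewrite mem_undup mem_cat jr orbT.
  exists (undup (r1 ++ r2)), (fun i => c * (if i \in r1 then k1 i else 0)
    + (if i \in r2 then k2 i else 0)); split=> //.
    by move=> j; rewrite mem_undup mem_cat => /orP[/X1|/X2].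
  rewrite -(sum_pad k1 _ ur u1 sub1) -(sum_pad k2 _ ur u2 sub2) scaler_sumr -big_split /=.
  by apply: eq_bigr => j _; rewrite scalerDl scalerA.
suff QA : lspan (\bigcup_(i in X) tensor_sub tens (A i) (B i)) `<=` Q.
  move=> /QA[r [k [ur Xr ->]]]; exists r, k; split=> //.
  by rewrite /tensor_sum big_map; apply: eq_bigr => j _; rewrite linearZl_LR.
apply: lspan_min => // x [j Xj]; move: x; apply: lspan_min => // _ [v [w [Av Bw ->]]].
move: Av Bw; rewrite AE // BE // => -[c ->] [d ->].
exists [:: j], (fun=> c * d); split=> //; first by move=> l; rewrite inE => /eqP->.
by rewrite big_seq1 linearZl_LR linearZr_LR /= scalerA.
Qed.

(** * Maximal toral subalgebras *)

Section Toral.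
Variable t : set g.
Hypotheses (at_ : subalgebra t) (dt : forall x, t x -> diag_on (ad x) [set: g]).

(** If [y] in [t] satisfies [[x, y] = c y], then [ad y] applied twice kills [x]; as [ad y] is
    diagonalizable, applying it once already does. *)
Lemma toral_abelian x y : t x -> t y -> lie x y = 0.
Proof.
move=> tx ty; have dx : diag_on (ad x) t.
  by apply: (diag_sub (dt tx)) => // [|v]; [exact: at_.1 | exact: at_.2].
move: y {ty} (dx y ty); apply: (@lspan_min _ _ _ [set y | lie x y = 0]).
  by split=> [|a u v]; rewrite /= ?linear0r ?linearPr //= => -> ->; rewrite scaler0 addr0.
move=> y [ty [c xy]] /=; have yx : ad y x = - c *: y.
  by rewrite /ad lieC -/(ad x y) xy scaleNr.
have : geig (ad y) 0 2 x.
  by apply/geig0_iter; rewrite /= yx linearZ /= /ad liexx scaler0.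
move=> /(diag_geig (dt ty) I) /=; rewrite scale0r /ad => yx0; by rewrite lieC yx0 oppr0.
Qed.

Lemma weight_spaceE (M : lmodType F) (a : {bilinear g -> M -> M}) alpha :
  (forall x, t x -> diag_on (a x) [set: M]) ->
  weight_space a t alpha = [set v | forall x, t x -> a x v = alpha x *: v].
Proof.
move=> da; apply/seteqP; split=> v.
  by move=> [k [_ vk]] x tx; apply: (diag_geig (da x tx) I (k := k)); apply: vk.
by move=> va; exists 1%N; split=> // x tx /=; rewrite va // subrr.
Qed.

Lemma joint_weight (M : lmodType F) (a : {bilinear g -> M -> M}) v : v <> 0 ->
  (forall x, t x -> exists c, a x v = c *: v) ->
  exists alpha, dual t alpha /\ forall x, t x -> a x v = alpha x *: v.
Proof.
move=> v0 ev; have [al alP] : exists al : g -> F,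
    forall x, (t x -> a x v = al x *: v) /\ (~ t x -> al x = 0).
  suff H x : exists c : F, (t x -> a x v = c *: v) /\ (~ t x -> c = 0).
    by have [al alP] := choice H; exists al.
  have [tx|ntx] := pselect (t x); last by exists 0; split.
  by have [c cE] := ev x tx; exists c; split.
exists al; split; last by move=> x; case: (alP x).
split=> [c x y tx ty|x]; last by case: (alP x).
have txy : t (c *: x + y) by apply: at_.1.2.
have := (alP (c *: x + y)).1 txy; rewrite linearPl (alP x).1 // (alP y).1 //.
rewrite scalerA -scalerDl => /eqP; rewrite -subr_eq0 -scalerBl scaler_eq0.
by move=> /orP[|/eqP//]; rewrite subr_eq0 => /eqP.
Qed.

Lemma joint_weight_span (M : lmodType F) (a : {bilinear g -> M -> M}) (A : set M) :
  (forall x y m, a (lie x y) m = a x (a y m) - a y (a x m)) ->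
  (forall x, t x -> diag_on (a x) [set: M]) -> fdim A ->
  (forall x v, t x -> A v -> A (a x v)) ->
  A `<=` lspan [set v | A v /\ exists alpha, dual t alpha /\ weight_space a t alpha v].
Proof.
move=> aL da fA aA v Av; have sA := fdim_subspace fA.
have := @joint_eig _ _ g t (fun x => a x) A fA aA _ _ v Av.
have fdA x : t x -> diag_on (a x) A.
  by move=> tx; apply: diag_sub (da x tx) _ sA _ => // w; apply: aA.
have comm x y w : t x -> t y -> A w -> a x (a y w) = a y (a x w).
  by move=> tx ty _; apply/eqP; rewrite -subr_eq0 -aL toral_abelian // linear0l.
move=> /(_ fdA comm); apply: lspan_min; first exact: lspan_subspace.
move=> w [Aw wt]; have [->|w0] := pselect (w = 0); first exact: subspace0 (lspan_subspace _).
have [al [dal wal]] := joint_weight w0 wt.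
by apply: sub_lspan; split=> //; exists al; rewrite weight_spaceE.
Qed.

Lemma dt_act x : t x -> diag_on (act x) [set: V]. Proof. by move=> /dt/diag_act[]. Qed.
Lemma dt_acts x : t x -> diag_on (acts x) [set: W]. Proof. by move=> /dt/diag_act[]. Qed.

Lemma nfree_neq0 (vs : seq V) v : nfree vs -> v \in vs -> v <> 0.
Proof.
move=> fvs vv v0; have iv : (index v vs < size vs)%N by rewrite index_mem.
have H : \sum_(k < size vs) ((k : nat) == index v vs)%:R *: vs`_k = 0 :> V.
  rewrite big1 // => k _.
  by case: eqP => [->|_]; rewrite ?scale0r // nth_index // v0 scaler0.
have /eqP := fvs (fun k => (k == index v vs)%:R) H (index v vs) iv.
by rewrite eqxx oner_eq0.
Qed.

(* The components of [y] along a basis of weight vectors of its image. *)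
Theorem commutant_dec y : slg y -> (forall x, t x -> lie x y = 0) ->
  exists s, [/\ y = iota (tsum s), ttrace s = 0 & forall c, c \in s ->
    exists al, [/\ dual t al, weight_space act t al c.1, weight_space acts t (\- al) c.2,
      range (act y) c.1 & c.1 <> 0]].
Proof.
move=> sy ty; have [fM _] := slg_fdim sy; set M := range (act y) in fM.
have comm x u : t x -> act x (act y u) = act y (act x u).
  by move=> tx; apply/eqP; rewrite -subr_eq0 -actL ty // linear0l.
have Mst x v : t x -> M v -> M (act x v).
  by move=> tx [u _ <-]; exists (act x u) => //; rewrite comm.
pose A := [set v | M v /\ exists al, dual t al /\ weight_space act t al v].
have MA : M `<=` lspan A := joint_weight_span actL dt_act fM Mst.
have [s0 [sl0 s0y s0M]] : exists s,
    [/\ sl_of gl (tsum s), y = iota (tsum s) & forall c, c \in s -> M c.1].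
  move: sy => [a sla ay]; have [f fB] := dimW; have [n [v aE]] := tsum_basis glP.1 fB a.
  rewrite aE in sla ay; have trs := (sl_tsum _).1 sla.
  exists [seq (v i, f i) | i <- seq.iota 0 n].
  split; [exact: sla | by rewrite ay | move=> c /mapP[j]].
  rewrite mem_iota => /andP[_ jn] -> /=.
  have [u uP] := dual_vectors pnd.2 (lfree_ord fB.1) (Ordinal jn).
  exists u => //; rewrite -ay (act_tsum trs).1 /tensor_act big_map iota0_index big_mkord.
  rewrite (bigD1 (Ordinal jn)) //= (uP (Ordinal jn)) eqxx scale1r big1 ?addr0 // => i ij.
  by rewrite uP (negPf ij) scale0r.
have AZ a v : A v -> A (a *: v).
  move=> [Mv [al [dal wal]]]; split; first exact: (subspaceZ _ (fdim_subspace fM)).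
  exists al; split=> //; rewrite weight_spaceE /= in wal *; last exact: dt_act.
  by move=> x tx; rewrite linearZr_LR /= wal // !scalerA mulrC.
have [c /s0M Mc|s1 [s10 s1A]] := @tsum_refine _ _ _ _ tens A setT s0 AZ.
  by split; [exact: MA | exact: sub_lspan].
have [c /s1A[]//|s [ss1 sA fs]] := @tsum_nfree _ _ _ _ tens A s1.
have ys : y = iota (tsum s) by rewrite ss1 s10.
have trs : ttrace s = 0.
  by apply/sl_tsum; rewrite ss1 s10.
have [e eP] : exists e : V * W -> g -> F, forall c, c \in s ->
    dual t (e c) /\ forall x, t x -> act x c.1 = e c x *: c.1.
  suff H c : exists al : g -> F, c \in s -> dual t al /\ forall x, t x -> act x c.1 = al x *: c.1.
    by have [e eP] := choice H; exists e.
  have [cs|cs] := boolP (c \in s); last by exists (fun=> 0).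
  have [_ [al [dal wal]]] := sA c cs; exists al => _; split=> //.
  by rewrite weight_spaceE in wal; last exact: dt_act.
(* Both orders of [x] and [y] agree on every [u]; independence of the left factors isolates each
   coefficient, so each right factor has the opposite weight. *)
have e2 c x : c \in s -> t x -> acts x c.2 = - e c x *: c.2.
  move=> cs tx; apply/eqP; rewrite -subr_eq0 scaleNr opprK; apply/eqP/pnd.2 => u.
  have ic : (index c s < size (map fst s))%N by rewrite size_map index_mem.
  pose d k := p u (acts x (nth (0, 0) s k).2 + e (nth (0, 0) s k) x *: (nth (0, 0) s k).2).
  have := fs d _ _ ic; rewrite /d nth_index //; apply; rewrite size_map.
  have /eqP := comm x u tx; rewrite -subr_eq0 ys !(act_tsum trs).1 /tensor_act => /eqP.
  rewrite linear_sumr -sumrB (big_nth (0, 0)) big_mkord => E; rewrite -[RHS]E.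
  apply: eq_bigr => k _; set c' := nth _ s k; have cs' : c' \in s by apply: mem_nth.
  rewrite (nth_map (0, 0)) // -/c' linearZr_LR /= (eP c' cs').2 // invariant scaleNr opprK.
  by rewrite linearDr linearZr_LR /= scalerDl addrC scalerA mulrC.
exists s; split=> // c cs; exists (e c); have [dc wc] := eP c cs; split=> //.
- by rewrite weight_spaceE //; exact: dt_act.
- by rewrite weight_spaceE; [move=> x tx; rewrite e2 | exact: dt_acts].
- by case: (sA c cs).
- by apply: nfree_neq0 fs _; apply: map_f.
Qed.

Let wV a := weight_space act t a.
Let wW a := weight_space acts t a.

Lemma wVE a : wV a = [set v | forall x, t x -> act x v = a x *: v].
Proof. by rewrite /wV weight_spaceE //; exact: dt_act. Qed.

Lemma wWE a : wW a = [set v | forall x, t x -> acts x v = a x *: v].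
Proof. by rewrite /wW weight_spaceE //; exact: dt_acts. Qed.

Lemma pair_weight a b v w : dual t a -> dual t b -> wV a v -> wW b w -> p v w <> 0 -> b = \- a.
Proof.
rewrite wVE wWE => -[_ a0] [_ b0] va wb vw; apply/funext => x /=.
have [tx|ntx] := pselect (t x); last by rewrite a0 // b0 // oppr0.
have := invariant x v w; rewrite va // wb // linearZl_LR linearZr_LR /= -mulNr.
by move=> /mulIf -> //; [rewrite opprK | apply/eqP].
Qed.

Lemma dual_opp a : dual t a -> dual t (\- a).
Proof.
move=> [aL a0]; split=> [c u v tu tv|u ntu] /=; last by rewrite a0 // oppr0.
by rewrite aL // opprD mulrN.
Qed.

Lemma pair_weight_opp a b v w : dual t a -> dual t b -> wV a v -> wW (\- b) w ->
  p v w <> 0 -> b = a.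
Proof.
move=> da db va wb vw; have E := pair_weight da (dual_opp db) va wb vw.
by apply/funext => x; apply: oppr_inj; exact: (congr1 (fun f => f x) E).
Qed.

Lemma weight_lie v w a : wV a v -> wW (\- a) w -> forall x, t x ->
  exists c, act x v = c *: v /\ acts x w = - c *: w.
Proof. by rewrite wVE wWE => va wa x tx; exists (a x); rewrite va // wa. Qed.

Let V' := locally_finite_part act t.
Let W' := locally_finite_part acts t.

Lemma locally_finite_span (M : lmodType F) (a : {bilinear g -> M -> M}) :
  (forall x y m, a (lie x y) m = a x (a y m) - a y (a x m)) ->
  (forall x, t x -> diag_on (a x) [set: M]) ->
  locally_finite_part a t `<=` lspan [set v | exists al, dual t al /\ weight_space a t al v].
Proof.
move=> aL da; apply: lspan_min; first exact: lspan_subspace.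
move=> v [A [Av fA tA]]; have := joint_weight_span aL da (findim_fdim fA) tA Av.
by apply: lspan_le => u [].
Qed.

Lemma weight_locally_finite (M : lmodType F) (a : {bilinear g -> M -> M}) al v :
  (forall x, t x -> diag_on (a x) [set: M]) ->
  weight_space a t al v -> locally_finite_part a t v.
Proof.
move=> da; rewrite weight_spaceE // => va; apply: sub_lspan; exists (lspan [set` [:: v]]); split.
- by apply: sub_lspan; rewrite /= inE.
- by exists [:: v].
move=> x u tx; move: u; set E := lspan _; have sE : subspace E := lspan_subspace _.
apply: (@lspan_min _ _ _ [set u | E (a x u)]).
  split=> [|c u w]; rewrite /= ?linear0r ?linearPr; first exact: subspace0 sE.
  exact: sE.2.
move=> u /=; rewrite inE => /eqP->; rewrite va //; apply: (subspaceZ _ sE).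
by apply: sub_lspan; rewrite /= inE.
Qed.

(** [q] is the pairing with the given pair projected out. If it vanished on weight vectors, it would
    vanish on [V'] and [W'], where [p x z = p x w * p v z] would have rank at most one. *)
Lemma second_pair a v w : dual t a -> wV a v -> wW (\- a) w -> p v w = 1 ->
  rank_ge p V' W' 2 -> exists b v' w', [/\ dual t b, wV b v', wW (\- b) w' &
    [/\ p v' w' = 1, p v w' = 0 & p v' w = 0]].
Proof.
move=> da va wa vw [vs [vsV vsI]].
pose q x z := p x z - p x w * p v z.
have [[b [c [x [z [[db dc] xb zc qxz]]]]]|nq] := pselect (exists b c x z,
    [/\ dual t b /\ dual t c, wV b x, wW c z & q x z <> 0]).
  (* The projection keeps the weight: [p x w <> 0] forces [x] to have the weight of [v]. *)
  pose v' := x - p x w *: v; pose w' := z - p v z *: w.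
  have wb : wV b v'.
    have [xw|xw] := pselect (p x w = 0); first by rewrite /v' xw scale0r subr0.
    have ab := pair_weight_opp db da xb wa xw; rewrite -ab in xb *.
    rewrite wVE in xb va *; move=> y ty; rewrite linearBr linearZr_LR /= xb // va //.
    by rewrite scalerBr !scalerA mulrC.
  have wc : wW c w'.
    have [xw|xw] := pselect (p v z = 0); first by rewrite /w' xw scale0r subr0.
    have ab := pair_weight da dc va zc xw; rewrite ab in zc *.
    rewrite wWE in zc wa *; move=> y ty; rewrite linearBr linearZr_LR /= zc // wa //.
    by rewrite scalerBr !scalerA mulrC.
  have vw' : p v w' = 0 by rewrite /w' linearBr linearZr_LR /= vw mulr1 subrr.
  have v'w : p v' w = 0 by rewrite /v' linearBl linearZl_LR /= vw mulr1 subrr.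
  have v'w' : p v' w' = q x z.
    by rewrite {1}/v' linearBl linearZl_LR /= vw' mulr0 subr0 /w' linearBr linearZr_LR /= mulrC.
  have v'w'0 : p v' w' <> 0 by rewrite v'w'.
  have cb := pair_weight db dc wb wc v'w'0; rewrite cb in wc.
  exists b, v', ((p v' w')^-1 *: w'); split=> //.
    rewrite wWE in wc *; move=> y ty; rewrite linearZr_LR /= wc //.
    by rewrite !scalerA mulrC.
  by rewrite !linearZr_LR /= vw' mulr0 mulVf //; apply/eqP.
have q0 x z : V' x -> W' z -> q x z = 0.
  move=> /(locally_finite_span actL dt_act) Vx /(locally_finite_span actsL dt_acts) Wz.
  move: x Vx; apply: (@lspan_min _ _ _ [set x | q x z = 0]).
    split=> [|c x y]; rewrite /= /q ?linear0l ?mul0r ?subr0 // !linearPl /=.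
    move=> x0 y0; rewrite mulrDl opprD addrACA -mulrA -mulrBr.
    by rewrite [_ - _]x0 [p y z - _]y0 mulr0 addr0.
  move=> x [b [db xb]]; move: z Wz; apply: (@lspan_min _ _ _ [set z | q x z = 0]).
    split=> [|c z y]; rewrite /= /q ?linear0r ?mulr0 ?subr0 // !linearPr /=.
    move=> x0 y0; rewrite mulrDr opprD addrACA mulrCA -mulrBr.
    by rewrite [_ - _]x0 [p x y - _]y0 mulr0 addr0.
  move=> z [c [dc zc]] /=; apply: contrapT => qxz.
  by apply: nq; exists b, c, x, z.
have qE x z : V' x -> W' z -> p x z = p x w * p v z.
  by move=> Vx Wz; apply/eqP; rewrite -subr_eq0; apply/eqP/q0.
have ex2 (f : 'I_2 -> F) : \sum_i f i *: vs i = f 0 *: vs 0 + f 1 *: vs 1.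
  by rewrite !big_ord_recl big_ord0 addr0; congr (_ + f _ *: vs _); apply/val_inj.
(* This combination of [vs 0] and [vs 1] pairs to zero with [w], hence by [qE] with all of [W'].
   Independence gives [p (vs 1) w = 0], and then [vs 1] alone pairs to zero with [W']. *)
pose c (j : 'I_2) : F := if j == 0 then p (vs 1) w else - p (vs 0) w.
have c0 : p (vs 1) w = 0.
  apply: (vsI c _ 0) => z Wz; rewrite ex2 linearDl !linearZl_LR /= (qE (vs 0) z) // (qE (vs 1) z) // /c eqxx /=.
  by ring.
suff : 1 = 0 :> F by move/eqP; rewrite oner_eq0.
apply: (vsI (fun j => (j == 1)%:R) _ 1) => z Wz.
by rewrite ex2 linearDl !linearZl_LR /= (qE (vs 1) z) // c0 !(mul0r, mulr0, addr0).
Qed.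

Lemma weightZ (M : lmodType F) (a : {bilinear g -> M -> M}) al c v :
  (forall x, t x -> diag_on (a x) [set: M]) ->
  weight_space a t al v -> weight_space a t al (c *: v).
Proof.
move=> da; rewrite weight_spaceE // => va x tx.
by rewrite linearZr_LR /= va // !scalerA mulrC.
Qed.

Hypothesis tmax : forall y, diag_on (ad y) [set: g] -> (forall x, t x -> lie x y = 0) -> t y.

Lemma two_pairs_toral a b v w v' w' : wV a v -> wW (\- a) w -> wV b v' -> wW (\- b) w' ->
  p v w = 1 -> p v' w' = 1 -> p v w' = 0 -> p v' w = 0 -> t (two_pairs v w v' w').
Proof.
move=> va wa vb wb p1 p2 p3 p4; have [sy dy _ _] := two_pairsP p1 p2 p3 p4.
apply: tmax dy _ => x tx; apply: lie_tsum0.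
  by rewrite /tensor_trace big_cons big_seq1 /= linearNl /= p1 p2 subrr.
move=> c; rewrite !inE => /orP[|] /eqP -> /=; first exact: weight_lie va wa x tx.
have [d [xv xw]] := weight_lie vb wb tx; exists d; split=> //.
by rewrite linearNr /= xv scalerN.
Qed.

Lemma weight_line a v w : dual t a -> wV a v -> wW (\- a) w -> p v w = 1 ->
  rank_ge p V' W' 2 ->
  [/\ wV a = [set u | exists c, u = c *: v], wW (\- a) = [set u | exists c, u = c *: w] &
    a <> (fun=> 0)].
Proof.
move=> da va wa vw rk; have [b [v' [w' [db vb wb [v'w' vw' v'w]]]]] := second_pair da va wa vw rk.
have ty := two_pairs_toral va wa vb wb vw v'w' vw' v'w.
have [_ _ yV yW] := two_pairsP vw v'w' vw' v'w; set y := two_pairs v w v' w' in ty yV yW.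
have v0 : v <> 0 by move=> v0; move: vw; rewrite v0 linear0l => /esym/eqP; rewrite oner_eq0.
have ay : a y = 1.
  have := va; rewrite wVE => /(_ y ty); rewrite yV vw vw' scale1r scale0r subr0 => /eqP.
  by rewrite -subr_eq0 -{1}[v]scale1r -scalerBl scaler_eq0 subr_eq0 => /orP[/eqP|/eqP/v0].
have two z : z = - z :> F -> z = 0.
  move=> /eqP; rewrite -addr_eq0 -mulr2n -mulr_natr mulf_eq0 pnatr_eq0 orbF => /eqP//.
split.
- apply/seteqP; split=> [u|_ [c ->]]; last by apply: weightZ va; exact: dt_act.
  move=> ua; have := ua; rewrite wVE => /(_ y ty); rewrite yV ay scale1r => uE.
  (* Pairing [u = (p u w) v - (p u w') v'] with [w'] gives [p u w' = - p u w']. *)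
  have uw' : p u w' = 0.
    by apply: two; rewrite -{1}uE linearBl !linearZl_LR /= vw' v'w' mulr0 sub0r mulr1.
  by exists (p u w); rewrite -[LHS]uE uw' scale0r subr0.
- apply/seteqP; split=> [u|_ [c ->]]; last by apply: weightZ wa; exact: dt_acts.
  move=> ua; have := ua; rewrite wWE => /(_ y ty); rewrite yW /= ay scaleN1r => uE.
  have uw' : p v' u = 0.
    apply: oppr_inj; rewrite oppr0; apply: two; rewrite -[in LHS]linearNr -uE.
    by rewrite linearBr !linearZr_LR /= v'w v'w' mulr0 subr0 mulr1 opprK.
  by exists (p v u); rewrite -[LHS]opprK -uE uw' scale0r sub0r opprK.
- by move=> a0; move: ay; rewrite a0 => /esym/eqP; rewrite oner_eq0.
Qed.

Lemma normalize_pair a b : ~ zero_on p (wV a) (wW b) ->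
  exists v w, [/\ wV a v, wW b w & p v w = 1].
Proof.
move=> nz; apply: contrapT => nex; apply: nz => v w va wb; apply: contrapT => vw; apply: nex.
exists v, ((p v w)^-1 *: w); split=> //; first by apply: weightZ wb; exact: dt_acts.
by rewrite linearZr_LR /= mulVf //; apply/eqP.
Qed.

Theorem toral_pairing_weights a b : dual t a -> dual t b -> ~ zero_on p (wV a) (wW b) ->
  b = \- a /\ (rank_ge p V' W' 2 -> has_dim (wV a) 1 /\ has_dim (wW (\- a)) 1).
Proof.
move=> da db /normalize_pair[v [w [va wb vw]]].
have vw0 : p v w <> 0 by rewrite vw; apply/eqP; rewrite oner_eq0.
have ba := pair_weight da db va wb vw0; split=> // rk; rewrite ba in wb.
have [wv ww _] := weight_line da va wb vw rk; split; apply/has_dim1P.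
  by exists v => // v0; apply: vw0; rewrite v0 linear0l.
by exists w => // w0; apply: vw0; rewrite w0 linear0r.
Qed.

(** A centralizing [c] is a sum of tensors of opposite weights. One of them moves [v] only if its
    right factor pairs with [v], which forces weight [-a] and contradicts isotropy; likewise for
    [w]. So [c] kills both factors. *)
Theorem toral_isotropic_center a : dual t a -> zero_on p (wV a) (wW (\- a)) ->
  tensor_sub tens (wV a) (wW (\- a)) `<=` sl_of gl /\
  iota @` tensor_sub tens (wV a) (wW (\- a)) `<=` lie_center (centralizer slg t).
Proof.
move=> da z0; set Z := centralizer slg t.
have sZ : subspace (lie_center Z).
  split=> [|c x y [[sx tx] xZ] [[sy ty] yZ]].
    split; last by move=> y _; rewrite linear0l.
    by split; [exact: subspace0 slg_subspace | move=> y _; rewrite linear0l].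
  split; last by move=> z Zz; rewrite linearPl /= xZ // yZ // scaler0 addr0.
  split; first exact: slg_subspace.2.
  by move=> z tz; rewrite linearPl /= tx // ty // scaler0 addr0.
suff H : tensor_sub tens (wV a) (wW (\- a)) `<=`
    sl_of gl `&` [set z | lie_center Z (iota z)].
  by split=> [z /H[]|_ [z /H[_ cz] <-]].
apply: lspan_min.
  split=> [|c x y [sx cx] [sy cy]].
    by split; [exact: subspace0 sl_subspace | rewrite /= iota0; exact: subspace0 sZ].
  by split; [exact: sl_subspace.2 | rewrite /= iotaD //; exact: sZ.2].
move=> _ [v [w [va wa ->]]]; have vw : p v w = 0 by apply: z0.
split; first exact: sl_nil.
split=> [|c [sc tc]].
  split=> [|x tx]; first exact: slg_nil.
  have [d [xv xw]] := weight_lie va wa tx.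
  by rewrite lieC (lie_tens vw xv xw) subrr scale0r oppr0.
have tc' x : t x -> lie x c = 0 by move=> tx; rewrite lieC tc // oppr0.
have [s [cE trs sP]] := commutant_dec sc tc'.
have cv : act c v = 0 *: v.
  rewrite scale0r cE (act_tsum trs).1 /tensor_act big1_seq // => d /= /sP[al [dal v1 w1 _ _]].
  suff -> : p v d.2 = 0 by rewrite scale0r.
  apply: contrapT => vd; apply: (vd); apply: z0 => //.
  by rewrite -(pair_weight_opp da dal va w1 vd).
have cw : acts c w = 0 *: w.
  rewrite scale0r cE (act_tsum trs).2 /tensor_acts big1_seq ?oppr0 // => d /= /sP[al [dal v1 w1 _ _]].
  suff -> : p d.1 w = 0 by rewrite scale0r.
  apply: contrapT => vd; apply: (vd); apply: z0 => //.
  by rewrite (pair_weight_opp dal da v1 wa vd).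
by rewrite lieC (lie_tens vw cv cw) addr0 scale0r oppr0.
Qed.

Lemma dual0 : dual t (fun=> 0). Proof. by split=> [c u v _ _|//]; rewrite mulr0 addr0. Qed.

Lemma opp_weight0 : \- (fun=> 0 : F) = (fun=> 0) :> (g -> F).
Proof. by apply/funext => x /=; rewrite oppr0. Qed.

Theorem toral_zero_weight_isotropic : rank_ge p V' W' 2 -> zero_on p (wV (fun=> 0)) (wW (fun=> 0)).
Proof.
move=> rk; apply: contrapT => /normalize_pair[v [w [v0 w0 vw]]].
by rewrite -opp_weight0 in w0; have [_ _ []] := weight_line dual0 v0 w0 vw rk.
Qed.

(** Vectors of weight zero are locally finite, so rank two on them would give rank two on [V'] and
    [W'], where weight zero is isotropic. *)
Theorem toral_zero_weight_rank : has_rank p (wV (fun=> 0)) (wW (fun=> 0)) 0 \/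
  has_rank p (wV (fun=> 0)) (wW (fun=> 0)) 1.
Proof.
have n2 : ~ rank_ge p (wV (fun=> 0)) (wW (fun=> 0)) 2.
  move=> [vs [vsV vsI]]; suff : 1 = 0 :> F by move/eqP; rewrite oner_eq0.
  have rk : rank_ge p V' W' 2.
    exists vs; split=> [j|c cz]; first by apply: weight_locally_finite (vsV j); exact: dt_act.
    apply: vsI => w w0; apply: cz; apply: weight_locally_finite w0; exact: dt_acts.
  apply: (vsI (fun=> 1) _ 0) => w w0.
  rewrite linear_sumlz big1 // => j _; rewrite linearZl_LR /= mul1r.
  exact: (toral_zero_weight_isotropic rk).
have [r1|r0] := pselect (rank_ge p (wV (fun=> 0)) (wW (fun=> 0)) 1); [right | left]; split=> //.
exists (fun=> 0); split=> [[]//|c _ []//].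
Qed.

(** The left factors of such a [y] have weight zero and [y] lies in [t], so [y] kills its own image
    in [V]; being diagonalizable, it acts by zero. *)
Theorem toral_zero_weight_disjoint :
  iota @` (tensor_sub tens (wV (fun=> 0)) (wW (fun=> 0)) `&` sl_of gl) `&` t = [set 0].
Proof.
apply/seteqP; split=> [y [[a [Ta sla] ay] ty]|_ ->]; last first.
  split; last exact: subspace0 at_.1.
  exists 0; last exact: iota0.
  by split; [exact: subspace0 (lspan_subspace _) | exact: subspace0 sl_subspace].
have [|s [aE sP]] := tensor_sub_ex _ Ta.
  by move=> c v; apply: weightZ; exact: dt_act.
rewrite aE in sla ay; have trs := (sl_tsum _).1 sla.
apply: slg_faithful => [|u]; first by rewrite -ay; exact: slg_tsum.
suff yy : act y (act y u) = 0.
  have : geig (act y) 0 2 u by apply/geig0_iter.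
  by move=> /(diag_geig (dt_act ty) I) /= ->; rewrite scale0r.
rewrite -{2}ay (act_tsum trs).1 /tensor_act linear_sumr big1_seq // => c /= /sP[c0 _].
by rewrite wVE in c0; rewrite linearZr_LR /= c0 // scale0r scaler0.
Qed.

Lemma commutant_locally_finite c : slg c -> (forall x, t x -> lie x c = 0) ->
  exists s, [/\ c = iota (tsum s), ttrace s = 0 & forall d, d \in s -> V' d.1 /\ W' d.2].
Proof.
move=> sc tc; have [s [cE trs sP]] := commutant_dec sc tc; exists s; split=> // d /sP.
move=> [al [_ v1 w1 _ _]]; split.
  by apply: weight_locally_finite v1; exact: dt_act.
by apply: weight_locally_finite w1; exact: dt_acts.
Qed.

Lemma minor0 v1 v2 w1 w2 : ~ rank_ge p V' W' 2 -> V' v1 -> V' v2 -> W' w1 -> W' w2 ->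
  p v1 w1 * p v2 w2 = p v1 w2 * p v2 w1.
Proof.
move=> rk Vv1 Vv2 Ww1 Ww2; apply: contrapT => m0; apply: rk.
exists (fun j : 'I_2 => if j == 0 then v1 else v2); split=> [j|c cw]; first by case: ifP.
have ex2 w : p (\sum_i c i *: (if i == 0 then v1 else v2)) w = c 0 * p v1 w + c 1 * p v2 w.
  rewrite !big_ord_recl big_ord0 addr0 linearDl !linearZl_LR /=.
  by congr (_ * _ + c _ * _); apply/val_inj.
have E1 := cw _ Ww1; have E2 := cw _ Ww2; rewrite !ex2 in E1 E2.
have m : p v1 w1 * p v2 w2 - p v1 w2 * p v2 w1 != 0 by rewrite subr_eq0; apply/eqP.
have c0 : c 0 = 0.
  apply: (mulIf m); rewrite mul0r.
  have -> : c 0 * (p v1 w1 * p v2 w2 - p v1 w2 * p v2 w1) =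
     (c 0 * p v1 w1 + c 1 * p v2 w1) * p v2 w2 - (c 0 * p v1 w2 + c 1 * p v2 w2) * p v2 w1.
    by ring.
  by rewrite E1 E2 !mul0r subrr.
have c1 : c 1 = 0.
  apply: (mulIf m); rewrite mul0r.
  have -> : c 1 * (p v1 w1 * p v2 w2 - p v1 w2 * p v2 w1) =
     p v1 w1 * (c 0 * p v1 w2 + c 1 * p v2 w2) - p v1 w2 * (c 0 * p v1 w1 + c 1 * p v2 w1).
    by ring.
  by rewrite E1 E2 !mulr0 subrr.
by move=> j; have [->|->] : j = 0 \/ j = 1;
  [case: j => [[|[|//]] lt2]; [left|right]; apply/val_inj | rewrite c0 | rewrite c1].
Qed.

(* For tensors over a form of rank at most one, [c d e = tr(d) c e]. *)
Lemma triple_product s1 s2 s3 u : ~ rank_ge p V' W' 2 ->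
  (forall d, d \in s1 -> V' d.1 /\ W' d.2) -> (forall d, d \in s2 -> V' d.1 /\ W' d.2) ->
  (forall d, d \in s3 -> V' d.1 /\ W' d.2) -> ttrace s2 = 0 ->
  tact s1 (tact s2 (tact s3 u)) = 0.
Proof.
move=> rk P1 P2 P3 tr2; rewrite /tensor_act big1_seq // => c /= /P1[Vc Wc].
suff -> : p (\sum_(d <- s2) p (\sum_(e <- s3) p u e.2 *: e.1) d.2 *: d.1) c.2 = 0.
  by rewrite scale0r.
rewrite linear_sumlz.
under eq_bigr => d _ do rewrite linearZl_LR /= linear_sumlz mulr_suml.
rewrite exchange_big big1_seq //= => e /P3[Ve We].
transitivity (p u e.2 * p e.1 c.2 * ttrace s2); last by rewrite tr2 mulr0.
rewrite /tensor_trace mulr_sumr; apply: eq_big_seq => d /P2[Vd Wd].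
by rewrite linearZl_LR /= -!mulrA; congr (_ * _); rewrite (minor0 rk) // mulrC.
Qed.

(** The two products are compared term by term: a nonzero pairing forces equal weights, and on the
    resulting weight lines the two terms coincide. *)
Lemma commutant_abelian c d : rank_ge p V' W' 2 -> slg c -> slg d ->
  (forall x, t x -> lie x c = 0) -> (forall x, t x -> lie x d = 0) -> lie c d = 0.
Proof.
move=> rk sc sd tc td.
have [s [cE trs sP]] := commutant_dec sc tc; have [s' [dE trs' sP']] := commutant_dec sd td.
apply: slg_comm => [|u]; first exact: slg_ideal.
rewrite cE dE !(act_tsum trs').1 !(act_tsum trs).1 /tensor_act.
rewrite (eq_bigr (fun i => \sum_(j <- s') (p u j.2 * p j.1 i.2) *: i.1)); last first.
  move=> i _; rewrite linear_sumlz scaler_suml; apply: eq_bigr => j _.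
  by rewrite linearZl_LR.
rewrite [RHS](eq_bigr (fun j => \sum_(i <- s) (p u i.2 * p i.1 j.2) *: j.1)); last first.
  move=> j _; rewrite linear_sumlz scaler_suml; apply: eq_bigr => i _.
  by rewrite linearZl_LR.
rewrite [RHS]exchange_big; apply: eq_big_seq => i /sP[a [da vi wi _ _]].
apply: eq_big_seq => j /sP'[b [db vj wj _ _]].
have key e f a' b' : dual t a' -> dual t b' -> wV a' e.1 -> wW (\- a') e.2 ->
    wV b' f.1 -> wW (\- b') f.2 -> p f.1 e.2 <> 0 ->
    (p u f.2 * p f.1 e.2) *: e.1 = (p u e.2 * p e.1 f.2) *: f.1.
  move=> da' db' ve we vf wf fe; have ab := pair_weight_opp db' da' vf we fe; rewrite ab in ve we.
  pose w := (p f.1 e.2)^-1 *: e.2; have fe0 : p f.1 e.2 != 0 by apply/eqP.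
  have ww : wW (\- b') w by apply: weightZ we; exact: dt_acts.
  have fw : p f.1 w = 1 by rewrite linearZr_LR /= mulVf.
  have [lv lw _] := weight_line db' vf ww fw rk.
  have [k ek] : exists k, e.1 = k *: f.1 by move: ve; rewrite lv.
  have [l el] : exists l, f.2 = l *: w by move: wf; rewrite lw.
  rewrite el ek linearZl_LR !linearZr_LR /= scalerA; congr (_ *: _).
  by field.
have [ji|ji] := pselect (p j.1 i.2 = 0); last exact: key da db vi wi vj wj ji.
have [ij|ij] := pselect (p i.1 j.2 = 0); first by rewrite ji ij !mulr0 !scale0r.
exact/esym/(key j i b a).
Qed.

Theorem toral_centralizer_nilpotent : lieprod (lieprod (centralizer slg t) (centralizer slg t))
  (centralizer slg t) = [set 0].
Proof.
set Z := centralizer slg t.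
have ZP c : Z c -> slg c /\ forall x, t x -> lie x c = 0.
  by move=> [sc tc]; split=> // x tx; rewrite lieC tc // oppr0.
apply/seteqP; split; last by move=> _ ->; exact: subspace0 (lspan_subspace _).
apply: lieprod_sub; first exact: subspace_set0.
move=> cd e Zcd /ZP[se te]; move: cd Zcd.
apply: (@lspan_min _ _ _ [set y | lie y e = 0]).
  by split=> [|k x y]; rewrite /= ?linear0l ?linearPl //= => -> ->; rewrite scaler0 addr0.
move=> _ [c [d [/ZP[sc tc] /ZP[sd td] ->]]] /=.
have [rk|rk] := pselect (rank_ge p V' W' 2).
  by rewrite (commutant_abelian rk sc sd tc td) linear0l.
have [s1 [c1 tr1 P1]] := commutant_locally_finite sc tc.
have [s2 [d2 tr2 P2]] := commutant_locally_finite sd td.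
have [s3 [e3 tr3 P3]] := commutant_locally_finite se te.
apply: slg_faithful => [|u]; first exact: slg_ideal.
rewrite !actL c1 d2 e3 !(act_tsum tr1).1 !(act_tsum tr2).1 !(act_tsum tr3).1.
have lin s z z' : tact s (z - z') = tact s z - tact s z'.
  rewrite /tensor_act -sumrB; apply: eq_bigr => i _.
  by rewrite linearBl scalerBl.
by rewrite lin !(triple_product _ rk) // !subrr.
Qed.

Let X := supp act t `\ (fun=> 0).

Lemma weight_neq0 (M : lmodType F) (a : {bilinear g -> M -> M}) al :
  (forall x, t x -> diag_on (a x) [set: M]) ->
  weight_space a t al <> [set 0] -> exists2 v, v <> 0 & weight_space a t al v.
Proof.
move=> da n0; apply: contrapT => nex; apply: n0; apply/seteqP; split=> [v av|_ ->].
  by apply: contrapT => v0; apply: nex; exists v.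
by rewrite weight_spaceE // => x tx; rewrite linear0r scaler0.
Qed.

Lemma weight_supp al v : dual t al -> wV al v -> v <> 0 -> supp act t al.
Proof. by move=> dal va v0; split=> // va0; apply: v0; move: va; rewrite /wV va0. Qed.

Lemma dual_neq0 a : dual t a -> a <> (fun=> 0) -> exists2 x, t x & a x <> 0.
Proof.
move=> [_ a0] an0; apply: contrapT => nex; apply: an0; apply/funext => x.
have [tx|] := pselect (t x); last exact: a0.
by apply: contrapT => ax; apply: nex; exists x.
Qed.

Definition weight_sum := lspan (\bigcup_(a in X) tensor_sub tens (wV a) (wW (\- a))).

(* The zero weight does not contribute to [y]: on a vector of weight zero in its
   image, [y] acts by zero. *)
Lemma commutant_sub y : zero_on p (wV (fun=> 0)) (wW (fun=> 0)) -> slg y ->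
  diag_on (ad y) [set: g] -> (forall x, t x -> lie x y = 0) ->
  (iota @` (sl_of gl `&` weight_sum)) y.
Proof.
move=> z0 sy dy ty; have [s [yE trs sP]] := commutant_dec sy ty.
exists (tsum s) => //; split; first exact/sl_tsum.
apply: subspace_sum_seq => [|c cs]; first exact: lspan_subspace.
have [al [dal v1 w1 [u _ uc] c0]] := sP c cs; apply: sub_lspan.
suff al0 : al <> (fun=> 0).
  exists al; first by split=> //; exact: weight_supp v1 c0.
  by apply: sub_lspan; exists c.1, c.2.
move=> al0; apply: c0; have yc : act y c.1 = 0.
  rewrite yE (act_tsum trs).1 /tensor_act big1_seq // => d /= /sP[be [dbe v2 w2 _ _]].
  suff -> : p c.1 d.2 = 0 by rewrite scale0r.
  apply: contrapT => pcd; move: (w2); rewrite (pair_weight_opp dal dbe v1 w2 pcd) al0 opp_weight0 => w20.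
  by apply: pcd; apply: z0 => //; rewrite -al0.
have : geig (act y) 0 2 u by apply/geig0_iter; rewrite /= uc.
by rewrite -uc => /(diag_geig (diag_act dy).1 I) /= ->; rewrite scale0r.
Qed.

Lemma weight_sum_lie a x : sl_of gl a -> weight_sum a -> t x -> lie x (iota a) = 0.
Proof.
move=> sla Xa tx.
suff [s [aE sP]] : exists s, a = tsum s /\ forall c, c \in s ->
    exists b, act x c.1 = b *: c.1 /\ acts x c.2 = - b *: c.2.
  by rewrite aE in sla *; apply: lie_tsum0 sP; apply/sl_tsum.
move: a Xa {sla}; apply: lspan_min.
  split=> [|a _ _ [s1 [-> P1]] [s2 [-> P2]]]; first by exists [::]; rewrite /tensor_sum big_nil.
  exists ([seq (a *: c.1, c.2) | c <- s1] ++ s2); rewrite tsum_comb; split=> // c.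
  rewrite mem_cat => /orP[/mapP[d /P1[b [x1 x2]] ->]|/P2//].
  by exists b; rewrite linearZr_LR /= x1 !scalerA mulrC.
move=> z [al [[dal _] _] az]; have [|s [zE sP]] := tensor_sub_ex _ az.
  by move=> c v; apply: weightZ; exact: dt_act.
by exists s; split=> // c /sP[v1 w1]; apply: weight_lie v1 w1 x tx.
Qed.

(** * Maximal toral subalgebras when the algebra is [sl(V, W)] itself *)

Section WholeAlgebra.
Hypothesis slT : slg = [set: g].

(** Otherwise every [y] in [t] has zero cube on [V] by [triple_product], hence vanishes; but then
    maximality puts a nonzero [two_pairs] element in [t]. *)
Lemma toral_rank2 : rank_ge p V' W' 2.
Proof.
apply: contrapT => rk.
have t0 y : t y -> y = 0.
  move=> ty; have sy : slg y by rewrite slT.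
  have cy x : t x -> lie x y = 0 by move=> tx; apply: toral_abelian.
  have [s [yE trs sP]] := commutant_locally_finite sy cy.
  apply: slg_faithful => // u.
  have : geig (act y) 0 3 u.
    by apply/geig0_iter; rewrite /= yE !(act_tsum trs).1 (triple_product _ rk).
  by move=> /(diag_geig (dt_act ty) I) /= ->; rewrite scale0r.
have [u [f uf]] := dual_pair.
have [||||sy dy yV _] := @two_pairsP (u 0) (f 0) (u 1) (f 1); rewrite ?uf //.
have y0 : two_pairs (u 0) (f 0) (u 1) (f 1) = 0.
  by apply/t0/tmax => // x /t0 ->; rewrite linear0l.
have := yV (u 0); rewrite y0 linear0l !uf eqxx scale1r scale0r subr0 => u0.
by have := uf 0 0; rewrite -u0 linear0l eqxx => /esym/eqP; rewrite oner_eq0.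
Qed.

(** Some [y] in [t] has [a y <> 0]. If the two weight spaces did not pair, every tensor of [y] would
    kill [v], against [act y v = a y *: v]. *)
Lemma supp_pair a : X a -> exists v w, [/\ wV a v, wW (\- a) w & p v w = 1].
Proof.
move=> [[da va] a0]; have [v v0 av] := weight_neq0 dt_act va.
have [y ty ay] := dual_neq0 da a0.
have sy : slg y by rewrite slT.
have cy x : t x -> lie x y = 0 by move=> tx; apply: toral_abelian.
have [s [yE trs sP]] := commutant_dec sy cy.
apply: normalize_pair => z0; have := av; rewrite (weight_spaceE _ dt_act) => /(_ y ty).
rewrite {1}yE (act_tsum trs).1 /tensor_act big1_seq => [/esym/eqP|c /= /sP[al [dal v1 w1 _ _]]].
  by rewrite scaler_eq0 => /orP[/eqP|/eqP].
suff -> : p v c.2 = 0 by rewrite scale0r.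
apply: contrapT => vc; apply: (vc); apply: z0 => //.
by rewrite -(pair_weight_opp da dal av w1 vc).
Qed.

Lemma supps_pair b : supp acts t b -> \- b <> (fun=> 0) ->
  exists v w, [/\ wV (\- b) v, wW b w & p v w = 1].
Proof.
move=> [db wb] b0; have [w w0 bw] := weight_neq0 dt_acts wb.
have [y ty /= /eqP by0] := dual_neq0 (dual_opp db) b0; rewrite oppr_eq0 in by0.
have sy : slg y by rewrite slT.
have cy x : t x -> lie x y = 0 by move=> tx; apply: toral_abelian.
have [s [yE trs sP]] := commutant_dec sy cy.
apply: normalize_pair => z0; have := bw; rewrite (weight_spaceE _ dt_acts) => /(_ y ty).
rewrite {1}yE (act_tsum trs).2 /tensor_acts big1_seq ?oppr0 => [/esym/eqP|c /= /sP[al [dal v1 w1 _ _]]].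
  by rewrite scaler_eq0 (negPf by0) => /eqP.
suff -> : p c.1 w = 0 by rewrite scale0r.
apply: contrapT => vc; apply: (vc); apply: z0 => //.
have -> : \- b = al; last by [].
by rewrite (pair_weight dal db v1 bw vc); apply/funext => x /=; rewrite opprK.
Qed.

Lemma pair_neq0 v w : p v w = 1 -> v <> 0 /\ w <> 0.
Proof.
move=> vw; split=> E; move: vw; rewrite E ?linear0l ?linear0r => /esym/eqP;
  by rewrite oner_eq0.
Qed.

Theorem toral_weight_dims : X = [set \- b | b in supp acts t] `\ (fun=> 0) /\
  forall a, X a -> has_dim (wV a) 1 /\ has_dim (wW (\- a)) 1.
Proof.
split.
- apply/seteqP; split=> [a Xa|_ [[b sb <-] b0]].
    have [v [w [va wa vw]]] := supp_pair Xa; have [[da _] a0] := Xa.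
    split=> //; exists (\- a); last by apply/funext => x /=; rewrite opprK.
    split; first exact: dual_opp.
    by move=> w0; have [_] := pair_neq0 vw; apply; move: wa; rewrite /wW w0.
  have [v [w [vb wb vw]]] := supps_pair sb b0; split=> //.
  by have [v0 _] := pair_neq0 vw; apply: weight_supp vb v0; apply: dual_opp; case: sb.
- move=> a Xa; have [v [w [va wa vw]]] := supp_pair Xa; have [[da _] a0] := Xa.
  apply: (toral_pairing_weights da (dual_opp da) _).2; last exact: toral_rank2.
  by move=> z0; have := z0 _ _ va wa; rewrite vw => /eqP; rewrite oner_eq0.
Qed.

(** For the inclusion into [t], dual bases of the weight lines bring any element into the form of
    [diag_family]; it commutes with [t], so maximality applies. *)
Theorem toral_weight_sumE : t = iota @` (sl_of gl `&` weight_sum).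
Proof.
have z0 := toral_zero_weight_isotropic toral_rank2.
apply/seteqP; split=> [y ty|_ [a [sla Xa] <-]].
  by apply: commutant_sub => //; [rewrite slT | exact: dt | move=> x tx; exact: toral_abelian].
apply: tmax; last by move=> x tx; apply: weight_sum_lie.
have [vv [ww vwP]] : exists (vv : (g -> F) -> V) (ww : (g -> F) -> W), forall al, X al ->
    [/\ wV al (vv al), wW (\- al) (ww al) & p (vv al) (ww al) = 1].
  suff H al : exists vw : V * W, X al -> [/\ wV al vw.1, wW (\- al) vw.2 & p vw.1 vw.2 = 1].
    by have [f fP] := choice H; exists (fun al => (f al).1), (fun al => (f al).2).
  have [Xal|nX] := pselect (X al); last by exists (0, 0).
  by have [v [w H]] := supp_pair Xal; exists (v, w).
have lines al : X al -> wV al = [set u | exists c, u = c *: vv al] /\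
    wW (\- al) = [set u | exists c, u = c *: ww al].
  move=> Xal; have [va wa vw] := vwP al Xal; have [[dal _] _] := Xal.
  by have [-> ->] := weight_line dal va wa vw toral_rank2.
have [al /lines[]//|al /lines[]//|r [k [ur Xr aE]]] := lines_span (vv := vv) (ww := ww) _ _ Xa.
rewrite aE in sla *; apply: diag_family => //; last exact/sl_tsum.
move=> i j /Xr Xi /Xr Xj; have [vi _ vwi] := vwP i Xi; have [_ wj _] := vwP j Xj.
have [<-//|ij] := eqVneq i j; apply: contrapT => pij; case/eqP: ij.
by apply/esym/(pair_weight_opp _ _ vi wj pij); [case: Xi => -[] | case: Xj => -[]].
Qed.

End WholeAlgebra.

End Toral.

(** Here weight vectors are not known to be eigenvectors. [geig_mul] with the zero operator on
    scalars still applies: a power of [b x - a x] annihilates [p v w]. *)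
Lemma gweight_pair t a b v w : dual t a -> dual t b -> weight_space act t a v ->
  weight_space acts t (\- b) w -> p v w <> 0 -> a = b.
Proof.
move=> [_ a0] [_ b0] [i [_ vi]] [j [_ wj]] vw; apply/funext => x.
have [tx|ntx] := pselect (t x); last by rewrite a0 // b0.
have : geig (\0 : {linear F^o -> F^o}) (a x + - b x) (i + j) (p v w).
  apply: (@geig_mul F V W F^o (act x) (acts x) _ (fun v w => p v w : F^o) setT setT _ _ _ _ _ _ _ _ _ _ _ _ _ v w I I (vi x tx) (wj x tx)) => //.
  - by move=> z _; rewrite linear0l.
  - by move=> u _; rewrite linear0r.
  - by move=> c u z _ _; rewrite linearBl linearZl_LR.
  - by move=> c u z _ _; rewrite linearBr linearZr_LR.
  - by move=> u z _ _ /=; rewrite invariant addNr.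
have it n c (z : F) : iter n (fun u : F^o => \0 u - c *: u) z = (- c) ^+ n * z.
  by elim: n => [|n IHn]; rewrite ?mul1r // iterS IHn /= sub0r -scaleNr exprS -mulrA.
rewrite /geig it => /eqP; rewrite mulf_eq0 (negPf (introN eqP vw)) orbF expf_eq0 oppr_eq0.
by move=> /andP[_]; rewrite subr_eq0 => /eqP.
Qed.

(** * From the weight data back to maximality *)

Section Converse.
Variable t : set g.
Hypotheses (slT : slg = [set: g]) (at_ : subalgebra t).
Let X := supp act t `\ (fun=> 0).
Hypothesis z0 : zero_on p (weight_space act t (fun=> 0)) (weight_space acts t (fun=> 0)).
Hypothesis dimX : forall a, X a ->
  has_dim (weight_space act t a) 1 /\ has_dim (weight_space acts t (\- a)) 1.
Hypothesis tE : t = iota @` (sl_of gl `&` weight_sum t).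

Lemma weight_data_lines : exists (vv : (g -> F) -> V) (ww : (g -> F) -> W), forall a, X a ->
  [/\ weight_space act t a = [set u | exists c, u = c *: vv a],
     weight_space acts t (\- a) = [set u | exists c, u = c *: ww a] & vv a <> 0].
Proof.
suff H a : exists vw : V * W, X a ->
  [/\ weight_space act t a = [set u | exists c, u = c *: vw.1],
     weight_space acts t (\- a) = [set u | exists c, u = c *: vw.2] & vw.1 <> 0].
  by have [f fP] := choice H; exists (fun a => (f a).1), (fun a => (f a).2).
have [Xa|nX] := pselect (X a); last by exists (0, 0).
have [/has_dim1P[v v0 vE] /has_dim1P[w w0 wE]] := dimX Xa.
by exists (v, w).
Qed.

Lemma weight_data_span x (vv : (g -> F) -> V) (ww : (g -> F) -> W) : t x -> (forall a, X a ->
  weight_space act t a = [set u | exists c, u = c *: vv a] /\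
  weight_space acts t (\- a) = [set u | exists c, u = c *: ww a]) ->
  exists r k, [/\ uniq r, forall i, i \in r -> X i,
    ttrace [seq (k i *: vv i, ww i) | i <- r] = 0 &
    x = iota (tsum [seq (k i *: vv i, ww i) | i <- r])].
Proof.
move=> tx lines; move: (tx); rewrite tE => -[a [sla Xa] <-].
have [al /lines[]//|al /lines[]//|r [k [ur Xr aE]]] := lines_span (vv := vv) (ww := ww) _ _ Xa.
by exists r, k; split=> //; [apply/sl_tsum; rewrite -aE | rewrite aE].
Qed.

Lemma weight_data_diag x : t x -> diag_on (ad x) [set: g].
Proof.
have [vv [ww vwP]] := weight_data_lines.
have lines a : X a -> weight_space act t a = [set u | exists c, u = c *: vv a] /\
  weight_space acts t (\- a) = [set u | exists c, u = c *: ww a] by move=> /vwP[].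
have va a : X a -> weight_space act t a (vv a).
  by move=> /vwP[-> _ _]; exists 1; rewrite scale1r.
have wa a : X a -> weight_space acts t (\- a) (ww a).
  by move=> /vwP[_ -> _]; exists 1; rewrite scale1r.
have orth a b : X a -> X b -> p (vv a) (ww b) <> 0 -> a = b.
  move=> Xa Xb; apply: (gweight_pair (t := t) _ _ (va _ Xa) (wa _ Xb)).
    by case: Xa => -[].
  by case: Xb => -[].
(* With [act y (vv a) = 0], iterates of [act y - a y] multiply [vv a] by powers of [- a y], so they
   never kill it. *)
have pa a : X a -> p (vv a) (ww a) <> 0.
  move=> Xa vw; have [[da _] a0] := Xa; have [y ty ay] := dual_neq0 da a0.
  have [r [k [ur Xr trs yE]]] := weight_data_span ty lines.
  have yv : act y (vv a) = 0.
    rewrite yE (act_tsum trs).1 /tensor_act big_map big1_seq // => b /= /Xr Xb.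
    suff -> : p (vv a) (ww b) = 0 by rewrite scale0r.
    by apply: contrapT => ab; apply: (ab); rewrite -(orth _ _ Xa Xb ab).
  have [i [_ iv]] := va a Xa; have [_ _ v0] := vwP a Xa.
  have it n : iter n (fun u => act y u - a y *: u) (vv a) = (- a y) ^+ n *: vv a.
    elim: n => [|n IHn]; rewrite ?scale1r // iterS IHn linearZr_LR /= yv scaler0 sub0r scalerA.
    by rewrite exprS -scaleNr mulNr.
  have := iv y ty; rewrite it => /eqP; rewrite scaler_eq0 expf_eq0 oppr_eq0.
  by move=> /orP[/andP[_ /eqP]|/eqP].
(* Rescaling makes the two families dual, as [diag_family] requires. *)
move=> tx; pose w' a := (p (vv a) (ww a))^-1 *: ww a.
have [|r [k [ur Xr trs ->]]] := weight_data_span (vv := vv) (ww := w') tx.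
  move=> a Xa; have [-> wE] := lines a Xa; split=> //; rewrite wE.
  have pa0 : p (vv a) (ww a) != 0 by apply/eqP/pa.
  apply/seteqP; split=> _ [c ->]; last by exists (c * (p (vv a) (ww a))^-1); rewrite scalerA.
  by exists (c * p (vv a) (ww a)); rewrite scalerA mulfK.
apply: diag_family => // i j /Xr Xi /Xr Xj; rewrite linearZr_LR /=.
have [->|ij] := eqVneq i j; first by rewrite mulVf //; apply/eqP/pa.
suff -> : p (vv i) (ww j) = 0 by rewrite mulr0.
by apply: contrapT => /(orth _ _ Xi Xj)/eqP; rewrite (negPf ij).
Qed.

Lemma weight_data_max y : diag_on (ad y) [set: g] -> (forall x, t x -> lie x y = 0) -> t y.
Proof.
move=> dy ty; rewrite tE; apply: commutant_sub => //; first exact: weight_data_diag.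
by rewrite slT.
Qed.

End Converse.

End Natural.

Section MaximalToral.
Variables (F : numClosedFieldType) (g : lieAlgType F) (gs hs : nat -> set g).
Hypothesis gP : root_exhaustion gs hs.

Lemma toral_diag t x : toral gs t -> t x -> diag_on (ad x) [set: g].
Proof. by move=> [_ ts] tx; apply/(semisimple_diag gP)/ts. Qed.

(** The sum of [t] and the line of [y] is abelian and consists of diagonalizable elements by
    [diag_comb]; so it is toral and equals [t]. *)
Lemma maximal_toral_commutant t y : maximal_toral gs t -> diag_on (ad y) [set: g] ->
  (forall x, t x -> lie x y = 0) -> t y.
Proof.
move=> [tt tmax] dy ty; have [at_ _] := tt; have sT := @subspaceT F g.
have tab x x' : t x -> t x' -> lie x x' = 0.
  by apply: (toral_abelian at_) => z; apply: toral_diag.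
pose t' := [set z | exists x c, t x /\ z = x + c *: y].
have t'l z z' : t' z -> t' z' -> lie z z' = 0.
  move=> [x [c [tx ->]]] [x' [c' [tx' ->]]].
  rewrite linearDl !linearDr !linearZl_LR !linearZr_LR /= liexx tab // ty // [lie y x']lieC ty //.
  by rewrite oppr0 !scaler0 !addr0.
suff <- : t' = t by exists 0, 1; split; [exact: subspace0 at_.1 | rewrite add0r scale1r].
apply: tmax => [|x tx]; last by exists x, 0; rewrite scale0r addr0.
split.
- have st : subspace t'.
    split=> [|d _ _ [x [c [tx ->]]] [x' [c' [tx' ->]]]].
      by exists 0, 0; rewrite scale0r addr0; split=> //; exact: subspace0 at_.1.
    exists (d *: x + x'), (d * c + c'); split; first exact: at_.1.2.
    by rewrite scalerDr scalerDl scalerA addrACA.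
  by split=> // z z' tz tz'; rewrite t'l //; exact: subspace0 st.
- move=> _ [x [c [tx ->]]]; apply/(semisimple_diag gP).
  apply: (@diag_comb _ _ (ad x) (ad y) _ c) => //.
  + by move=> z _; rewrite /= /ad linearDl linearZl_LR.
  + move=> z _ /=; apply/eqP; rewrite -subr_eq0 /ad lieJ ty // linear0l add0r subrr.
    by [].
  + exact: toral_diag tt tx.
Qed.

End MaximalToral.

Theorem theorem4p8 (R : realType)
    (V Vs : lmodType R[i])
    (p : {bilinear V -> Vs -> R[i] | *%R & *%R})
    (gl : lieAlgType R[i]) (tens : {bilinear V -> Vs -> gl})
    (g : lieAlgType R[i]) (gs hs : nat -> set g)
    (iota : gl -> g) (J : set g)
    (act : {bilinear g -> V -> V}) (acts : {bilinear g -> Vs -> Vs})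
    (dimV : countably_infinite_dim V) (dimVs : countably_infinite_dim Vs)
    (p_nondeg : nondegenerate p)
    (glP : is_gl p tens)
    (gP : root_exhaustion gs hs)
    (iotaP : sl_summand iota J)
    (actP : natural_modules p tens iota J act acts) :
  (forall t : set g, maximal_toral gs t ->
    [/\
      forall a b, dual t a -> dual t b ->
        ~ zero_on p (weight_space act t a) (weight_space acts t b) ->
        b = \- a /\
        (rank_ge p (locally_finite_part act t) (locally_finite_part acts t) 2 ->
         has_dim (weight_space act t a) 1 /\
         has_dim (weight_space acts t (\- a)) 1),
      forall a, dual t a ->
        zero_on p (weight_space act t a) (weight_space acts t (\- a)) ->
        tensor_sub tens (weight_space act t a) (weight_space acts t (\- a))
          `<=` sl_of gl /\
        iota @` tensor_sub tens (weight_space act t a)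
                                (weight_space acts t (\- a))
          `<=` lie_center (centralizer (iota @` sl_of gl) t),
      [/\ rank_ge p (locally_finite_part act t)
                    (locally_finite_part acts t) 2 ->
          zero_on p (weight_space act t (fun=> 0))
                    (weight_space acts t (fun=> 0)),
          has_rank p (weight_space act t (fun=> 0))
                     (weight_space acts t (fun=> 0)) 0 \/
          has_rank p (weight_space act t (fun=> 0))
                     (weight_space acts t (fun=> 0)) 1 &
          iota @` (tensor_sub tens (weight_space act t (fun=> 0))
                                   (weight_space acts t (fun=> 0))
                   `&` sl_of gl) `&` t = [set 0]] &
      lieprod (lieprod (centralizer (iota @` sl_of gl) t)
                       (centralizer (iota @` sl_of gl) t))
              (centralizer (iota @` sl_of gl) t) = [set 0]])
  /\
  (iota @` sl_of gl = [set: g] ->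
   forall t : set g, subalgebra t ->
    (maximal_toral gs t <->
     [/\
      zero_on p (weight_space act t (fun=> 0))
                (weight_space acts t (fun=> 0)) /\
      iota @` (tensor_sub tens (weight_space act t (fun=> 0))
                               (weight_space acts t (fun=> 0))
               `&` sl_of gl) `&` t = [set 0],
      supp act t `\ (fun=> 0) = [set \- b | b in supp acts t] `\ (fun=> 0) /\
      (forall a, (supp act t `\ (fun=> 0)) a ->
         has_dim (weight_space act t a) 1 /\
         has_dim (weight_space acts t (\- a)) 1) &
      t = iota @` (sl_of gl `&`
            lspan (\bigcup_(a in supp act t `\ (fun=> 0))
                     tensor_sub tens (weight_space act t a)
                                     (weight_space acts t (\- a))))])).
Proof.
split=> [t tm|slT t at_].
  have [at_ _] := tm.1; have dt x : t x -> diag_on (ad x) [set: g] := toral_diag gP tm.1.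
  have tmax y := maximal_toral_commutant (y := y) gP tm.
  split.
  - exact: (toral_pairing_weights dimVs p_nondeg glP iotaP actP at_ dt tmax).
  - exact: (toral_isotropic_center dimVs p_nondeg glP iotaP actP at_ dt).
  - split.
    + exact: (toral_zero_weight_isotropic dimVs p_nondeg glP iotaP actP at_ dt tmax).
    + exact: (toral_zero_weight_rank dimVs p_nondeg glP iotaP actP at_ dt tmax).
    + exact: (toral_zero_weight_disjoint dimVs p_nondeg glP iotaP actP at_ dt).
  - exact: (toral_centralizer_nilpotent dimVs p_nondeg glP iotaP actP at_ dt tmax).
split=> [tm|[[z0 _] [_ dimX] tE]].
  have dt x : t x -> diag_on (ad x) [set: g] := toral_diag gP tm.1.
  have tmax y := maximal_toral_commutant (y := y) gP tm.
  have rk := toral_rank2 dimVs p_nondeg glP iotaP actP at_ dt tmax slT.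
  split.
  - split; first exact: (toral_zero_weight_isotropic dimVs p_nondeg glP iotaP actP at_ dt tmax rk).
    exact: (toral_zero_weight_disjoint dimVs p_nondeg glP iotaP actP at_ dt).
  - exact: (toral_weight_dims dimVs p_nondeg glP iotaP actP at_ dt tmax slT).
  - exact: (toral_weight_sumE dimVs p_nondeg glP iotaP actP at_ dt tmax slT).
have dt x (tx : t x) := weight_data_diag dimVs p_nondeg glP iotaP actP dimX tE tx.
have tmax y dy := weight_data_max dimVs p_nondeg glP iotaP actP slT at_ z0 dimX tE (y := y) dy.
split; first by split=> // x tx; apply/(semisimple_diag gP); exact: dt.
(* A toral [t'] containing [t] is abelian, so its elements commute with [t] and [tmax] applies to
   them. *)
move=> t' tt' sub; apply/seteqP; split=> // y ty; apply: tmax; first exact: (toral_diag gP tt' ty).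
by move=> x /sub tx; apply: (toral_abelian tt'.1) => // z; exact: (toral_diag gP tt').
Qed.
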